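(* Let $\Omega\subset\mathbb R^2$ be a bounded connected domain with smooth boundary (possibly with holes), let $B\in C^\infty(\overline\Omega)$ with $B(x)>0$ on $\overline\Omega$, and let $\psi_0$ be the solution of $\Delta\psi_0=B$ in $\Omega$, $\psi_0=0$ on $\partial\Omega$. Then for every real ${\bf A}\in C^1(\overline\Omega;\mathbb R^2)$ with $\partial_{x_1}A_2-\partial_{x_2}A_1=B$, \[ \lim_{h\to0^+} h\log\lambda^D_{P_-}(h,{\bf A},B,\Omega)=2\inf_\Omega\psi_0 . \]
   Context: $\lambda^D_{P_-}(h,{\bf A},B,\Omega)$ is the ground state energy of the Dirichlet realization in $L^2(\Omega)$ of the Pauli operator $P_-=(hD_{x_1}-A_1)^2+(hD_{x_2}-A_2)^2-hB$, $D_{x_j}=-i\partial_{x_j}$, i.e. $\inf_{u\in H^1_0(\Omega)\setminus\{0\}}\big(\|(hD-{\bf A})u\|^2-h\int_\Omega B|u|^2\big)/\|u\|^2$. *)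

(* Defs.v *)
(* The plane R^2 is modelled as R * R (product
   topology, product sigma-algebra, Lebesgue measure leb2 = leb \x leb).
   Complex-valued functions u are represented by their real and imaginary
   parts (a, b). *)
From HB Require Import structures.
From mathcomp Require Import all_boot all_order all_algebra.
From mathcomp Require Import all_classical all_reals all_analysis.
Set Implicit Arguments. Unset Strict Implicit. Unset Printing Implicit Defensive.
Import Order.TTheory GRing.Theory Num.Theory.
Import numFieldNormedType.Exports.
Local Open Scope classical_set_scope.
Local Open Scope ring_scope.

Section Defs.
Variable R : realType.
Local Notation P := (R * R)%type.

Definition leb2 := (@lebesgue_measure R \x @lebesgue_measure R)%E.

Definition pd (b : bool) (f : P -> R) : P -> R := fun p =>
  if b then derive1 (fun t => f (t, p.2)) p.1
       else derive1 (fun t => f (p.1, t)) p.2.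

Definition pd_ex (b : bool) (f : P -> R) (p : P) : Prop :=
  if b then derivable (fun t => f (t, p.2)) p.1 1
       else derivable (fun t => f (p.1, t)) p.2 1.

Definition pdw (w : seq bool) (f : P -> R) : P -> R := foldr pd f w.

Definition smooth (f : P -> R) : Prop :=
  forall w : seq bool, continuous (pdw w f) /\ forall b p, pd_ex b (pdw w f) p.

Definition Ck_in (k : nat) (O : set P) (f : P -> R) : Prop :=
  forall w : seq bool, (size w <= k)%N ->
    {in O, continuous (pdw w f)} /\
    ((size w < k)%N -> forall b p, O p -> pd_ex b (pdw w f) p).

Definition Ck_bar (k : nat) (O : set P) (f : P -> R) : Prop :=
  Ck_in k O f /\
  forall w : seq bool, (size w <= k)%N ->
    exists g : P -> R, {within closure O, continuous g} /\
      forall p, O p -> pdw w f p = g p.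

Definition Cinf_bar (O : set P) (f : P -> R) : Prop := forall k, Ck_bar k O f.

Definition bounded_set2 (O : set P) : Prop :=
  exists M : R, forall p, O p -> `|p.1| <= M /\ `|p.2| <= M.

Definition smooth_boundary (O : set P) : Prop :=
  forall p, (closure O `\` O) p ->
    exists U : set P, exists F : P -> R,
      [/\ open U, U p, smooth F,
          (forall q, U q -> pd true F q != 0 \/ pd false F q != 0) &
          O `&` U = [set q | U q /\ F q < 0]].

Definition smooth_domain (O : set P) : Prop :=
  [/\ open O, O !=set0, connected O, bounded_set2 O & smooth_boundary O].

Definition Cc_inf (O : set P) (f : P -> R) : Prop :=
  smooth f /\ exists K : set P, [/\ compact K, K `<=` O &
                                 forall p, ~ K p -> f p = 0].

(* H^1_0(Omega) (real-valued): u belongs to the closure of C_c^infinity(Omega)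
   for the H^1 norm, with (weak) gradient (u1, u2) *)
Definition H10 (O : set P) (u u1 u2 : P -> R) : Prop :=
  [/\ measurable_fun setT u, measurable_fun setT u1, measurable_fun setT u2 &
      exists phi : nat -> P -> R,
        [/\ forall n, Cc_inf O (phi n),
            (fun n => \int[leb2]_(p in setT) (((phi n p - u p) ^+ 2)%:E))%E
               @ \oo --> 0%E,
            (fun n => \int[leb2]_(p in setT)
                        (((pd true (phi n) p - u1 p) ^+ 2)%:E))%E
               @ \oo --> 0%E &
            (fun n => \int[leb2]_(p in setT)
                        (((pd false (phi n) p - u2 p) ^+ 2)%:E))%E
               @ \oo --> 0%E]].

(* Rayleigh quotient of P_- = (hD - A)^2 - hB at u = a + i b, where
   (a1, a2), (b1, b2) are the gradients of a and b.  Pointwise,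
   |(h D_j - A_j) u|^2 = (h b_j - A_j a)^2 + (h a_j + A_j b)^2. *)
Definition pauli_rayleigh (O : set P) (h : R) (A1 A2 B : P -> R)
  (a a1 a2 b b1 b2 : P -> R) : R :=
  let kin := (\int[leb2]_(p in O)
     (((h * b1 p - A1 p * a p) ^+ 2 + (h * a1 p + A1 p * b p) ^+ 2
     + (h * b2 p - A2 p * a p) ^+ 2 + (h * a2 p + A2 p * b p) ^+ 2)%:E))%E in
  let pot := (\int[leb2]_(p in O) ((B p * (a p ^+ 2 + b p ^+ 2))%:E))%E in
  let nrm := (\int[leb2]_(p in O) ((a p ^+ 2 + b p ^+ 2)%:E))%E in
  (fine kin - h * fine pot) / fine nrm.

Definition lambdaD (h : R) (A1 A2 B : P -> R) (O : set P) : R :=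
  inf [set r | exists a a1 a2 b b1 b2 : P -> R,
      [/\ H10 O a a1 a2, H10 O b b1 b2,
          fine (\int[leb2]_(p in O) ((a p ^+ 2 + b p ^+ 2)%:E))%E != 0 &
          r = pauli_rayleigh O h A1 A2 B a a1 a2 b b1 b2]].

End Defs.

(* Main.v *)
(* Lower bound.  Writing u = exp (- psi0 / h) v, the commutation relation
   [pi_1, pi_2] = i h B turns the quadratic form of P_- into the squared norm of
   (pi_1 + i pi_2) u, which is exp (- psi0 / h) times a magnetic d-bar operator
   with zero field applied to v.  As m = inf psi0 <= psi0 <= 0, the weights are
   pinched between 1 and exp (- m / h), and a Poincare inequality for the flat
   operator gives lambda >= h^2 / (4 M^2) exp (2 m / h) when Omega lies in the
   square of half-side M.

   Upper bound.  The gauge field th = A - (rotated gradient of psi0) is closed.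
   On a domain with holes th / h need not be a gradient, even modulo 2 pi; the
   defect is removed by vortices placed off the support of chi, of strength at most
   2 pi.  They change the weight by a factor exp S with S bounded
   independently of h.  The trial state chi exp (- psi0 / h + S) e^{i phase},
   with chi = 1 where psi0 <= - e, has energy O (h^2 exp (2 e / h)) and squared
   norm at least c exp (- 2 (m + e) / h). *)
Require Import Defs.
From HB Require Import structures.
From mathcomp Require Import all_boot all_order all_algebra.
From mathcomp Require Import all_classical all_reals all_analysis.
From mathcomp Require Import measurable_realfun ring lra.
Set Implicit Arguments. Unset Strict Implicit. Unset Printing Implicit Defensive.
Import Order.TTheory GRing.Theory Num.Theory.
Import numFieldNormedType.Exports.
Local Open Scope classical_set_scope.
Local Open Scope ring_scope.

(** * Partial derivatives *)

Section calculus.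
Variable R : realType.
Local Notation P := (R * R)%type.
Implicit Types (b : bool) (f g : P -> R) (p : P) (U V : set P).

(** No basis of cycles around the holes is chosen and the topology of the domain never enters. A
    square grid covers the domain; every cell not contained in it carries a vortex at its centre,
    which cancels the residue modulo 2 pi of the circulation of th / h around that cell. Then all
    cells of the grid have circulation in 2 pi Z, and since the grid fills a whole square a phase
    exists modulo 2 pi. The number of vortices and their distance to the support of chi depend on
    the grid alone, whence the bound on S uniform in h. Regularity is the other obstacle. [A] is C^1
    and [psi0] is C^2 inside the domain, so the trial states are merely C^2, while [H10] is a
    closure of smooth functions: Bernstein polynomials bridge the gap. Nothing is known about
    derivatives of [psi0] at the boundary, so the trial states live in a compact subset; the price
    is the factor exp (2 e / h), removed by letting e tend to 0. Constants and powers of h are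
    harmless because h log h tends to 0. Finally [inf], [fine] and [pd] are total functions with
    default values: nonemptiness, lower bounds, integrability and differentiability are established
    wherever they are evaluated. *)

Definition co b p : R := if b then p.1 else p.2.
Definition sl b p (t : R) : P := if b then (t, p.2) else (p.1, t).

(** Existence and value of a partial derivative in one relation: [pd] has a default value where the
    derivative does not exist, so an equation on [pd] alone says nothing about differentiability. *)
Definition isd b f p (l : R) : Prop :=
  is_derive (co b p) (1 : R) (fun t => f (sl b p t)) l.

Lemma sl_co b p : sl b p (co b p) = p.
Proof. by case: b p => -[]. Qed.

Lemma sl_continuous b p : continuous (sl b p).
Proof.
move=> t; case: b.
- exact: (@cvg_pair _ _ _ (nbhs t) (nbhs t) (nbhs p.2) _ _ _ id (fun=> p.2)
    (@cvg_id _ _) (@cvg_cst _ _ _ _ _)).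
- exact: (@cvg_pair _ _ _ (nbhs t) (nbhs p.1) (nbhs t) _ _ _ (fun=> p.1) id
    (@cvg_cst _ _ _ _ _) (@cvg_id _ _)).
Qed.

Lemma isd_pd b f p l : isd b f p l -> pd_ex b f p /\ pd b f p = l.
Proof.
rewrite /isd /pd_ex /pd; case: b => /= H; rewrite derive1E.
- by split; [exact: ex_derive|exact: derive_val].
- by split; [exact: ex_derive|exact: derive_val].
Qed.

Lemma pd_ex_isd b f p : pd_ex b f p -> isd b f p (pd b f p).
Proof.
by rewrite /isd /pd_ex /pd; case: b => /= H; rewrite derive1E; exact/derivableP.
Qed.

Lemma isd_uniq b f p l l' : isd b f p l -> isd b f p l' -> l = l'.
Proof. by move=> /isd_pd[_ <-] /isd_pd[_ <-]. Qed.

Lemma isd_eq b f p l l' : isd b f p l -> l = l' -> isd b f p l'.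
Proof. by move=> + <-. Qed.

Lemma near_sl b p V : nbhs p V -> \forall t \near co b p, V (sl b p t).
Proof.
by move=> pV; apply: (@sl_continuous b p (co b p)); rewrite sl_co.
Qed.

Lemma isd_near b f g p l : (\near p, f p = g p) -> isd b f p l -> isd b g p l.
Proof.
move=> fg; rewrite /isd => H.
by apply: near_eq_is_derive H; exact: (@near_sl b p _ fg).
Qed.

Lemma isd_cst b (c : R) p : isd b (fun=> c) p 0.
Proof. exact: is_derive_cst. Qed.

Lemma isdD b f g p l l' : isd b f p l -> isd b g p l' ->
  isd b (fun q => f q + g q) p (l + l').
Proof. by move=> H H'; exact: (is_deriveD H H'). Qed.

Lemma isdN b f p l : isd b f p l -> isd b (fun q => - f q) p (- l).
Proof. by move=> H; exact: (is_deriveN H). Qed.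

Lemma isdM b f g p l l' : isd b f p l -> isd b g p l' ->
  isd b (fun q => f q * g q) p (l * g p + f p * l').
Proof.
move=> H H'; have K := is_deriveM H H'.
by apply: (is_derive_eq K); rewrite /GRing.scale/= sl_co; ring.
Qed.

Lemma isd_comp b (g : R -> R) f p l l' :
  is_derive (f p) (1 : R) g l' -> isd b f p l ->
  isd b (fun q => g (f q)) p (l' * l).
Proof.
move=> H' H; rewrite /isd.
have H'' : is_derive (f (sl b p (co b p))) 1 g l' by rewrite sl_co.
exact: (@is_derive1_comp _ g (fun t => f (sl b p t)) (co b p) l' l H'' H).
Qed.

Lemma isd_co b b' p : isd b (co b') p (b == b')%:R.
Proof.
rewrite /isd; case: b; case: b' => /=; rewrite /co/=; try exact: is_derive_id;
  exact: is_derive_cst.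
Qed.

(** C^n regularity with the partial derivatives as existential witnesses, so that sums, products and
    compositions are handled by giving the derivative as a formula. Continuity is that of a function
    on the plane at the points of [U], not of its restriction to [U]. *)
Fixpoint CC n U f : Prop :=
  (forall p, U p -> {for p, continuous f}) /\
  if n is n'.+1 then exists d : bool -> P -> R,
    forall b, (forall p, U p -> isd b f p (d b p)) /\ CC n' U (d b)
  else True.

Lemma CC_cont n U f : CC n U f -> forall p, U p -> {for p, continuous f}.
Proof. by case: n => [|n] []. Qed.

Lemma CCW n U f : CC n.+1 U f -> CC n U f.
Proof.
elim: n f => [|n IH] f [cf [d Hd]]; first by split.
split=> //; exists d => b; have [? /IH ?] := Hd b; by split.
Qed.

Lemma CC_sub n U V f : U `<=` V -> CC n V f -> CC n U f.
Proof.
move=> UV; elim: n f => [|n IH] f [cf H]; first by split=> // p /UV/cf.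
split; first by move=> p /UV/cf.
case: H => d Hd; exists d => b; have [? ?] := Hd b; split; last exact: IH.
by move=> p /UV; auto.
Qed.

Lemma CC_cst n U (c : R) : CC n U (fun=> c).
Proof.
elim: n c => [|n IH] c; first by split=> // p _; exact: cvg_cst.
split; first by move=> p _; exact: cvg_cst.
by exists (fun _ _ => 0) => b; split=> // p _; exact: isd_cst.
Qed.

Lemma CCD n U f g : CC n U f -> CC n U g -> CC n U (fun p => f p + g p).
Proof.
elim: n f g => [|n IH] f g [cf Hf] [cg Hg].
  by split=> // p Up; apply: cvgD; [exact: cf|exact: cg].
split; first by move=> p Up; apply: cvgD; [exact: cf|exact: cg].
case: Hf => d Hd; case: Hg => e He; exists (fun b p => d b p + e b p) => b.
have [? ?] := Hd b; have [? ?] := He b; split; last exact: IH.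
by move=> p Up; apply: isdD; auto.
Qed.

Lemma CCM n U f g : CC n U f -> CC n U g -> CC n U (fun p => f p * g p).
Proof.
elim: n f g => [|n IH] f g Cf Cg.
  case: Cf => cf _; case: Cg => cg _.
  by split=> // p Up; apply: cvgM; [exact: cf|exact: cg].
have := Cf => -[cf Hf]; have := Cg => -[cg Hg].
split; first by move=> p Up; apply: cvgM; [exact: cf|exact: cg].
case: Hf => d Hd; case: Hg => e He.
exists (fun b p => d b p * g p + f p * e b p) => b.
have [? ?] := Hd b; have [? ?] := He b; split.
  by move=> p Up; apply: isdM; auto.
by apply: CCD; apply: IH => //; exact: CCW.
Qed.

Lemma CCN n U f : CC n U f -> CC n U (fun p => - f p).
Proof.
move=> Cf; have := CCM (CC_cst n U (-1)) Cf.
by under eq_fun do rewrite mulN1r.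
Qed.

Lemma CCB n U f g : CC n U f -> CC n U g -> CC n U (fun p => f p - g p).
Proof. by move=> Cf Cg; apply: CCD => //; exact: CCN. Qed.

Lemma CC_co n U b : CC n U (co b).
Proof.
have cc : forall p, U p -> {for p, continuous (co b)}.
  by move=> p _; case: b; [exact: cvg_fst|exact: cvg_snd].
case: n => [|n]; first by split.
split=> //; exists (fun b' _ => (b' == b)%:R) => b'; split; last exact: CC_cst.
by move=> p _; exact: isd_co.
Qed.

Lemma CCX n U f k : CC n U f -> CC n U (fun p => f p ^+ k).
Proof.
move=> Cf; elim: k => [|k IH]; first exact: CC_cst.
by under eq_fun do rewrite exprS; exact: CCM.
Qed.

Lemma CC_sum n U (I : Type) (r : seq I) (Q : pred I) (F : I -> P -> R) :
  (forall i, Q i -> CC n U (F i)) -> CC n U (fun p => \sum_(i <- r | Q i) F i p).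
Proof.
move=> CF; elim: r => [|i r IH].
  by under eq_fun do rewrite big_nil; exact: CC_cst.
under eq_fun do rewrite big_cons.
by case Qi: (Q i) => //; apply: CCD => //; exact: CF.
Qed.

Lemma CC_prod n U (I : Type) (r : seq I) (F : I -> P -> R) :
  (forall i, CC n U (F i)) -> CC n U (fun p => \prod_(i <- r) F i p).
Proof.
move=> CF; elim: r => [|i r IH].
  by under eq_fun do rewrite big_nil; exact: CC_cst.
by under eq_fun do rewrite big_cons; apply: CCM => //; exact: CF.
Qed.

Lemma CC0_comp U f (g : R -> R) : CC 0 U f ->
  (forall p, U p -> {for f p, continuous g}) -> CC 0 U (fun p => g (f p)).
Proof.
by move=> [cf _] cg; split=> // p Up; apply: continuous_comp; [exact: cf|exact: cg].
Qed.

Lemma CC_comp n U f (g g' : R -> R) : CC n.+1 U f ->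
  (forall p, U p -> is_derive (f p) (1 : R) g (g' (f p))) ->
  CC n U (fun p => g' (f p)) -> CC n.+1 U (fun p => g (f p)).
Proof.
move=> [cf [d Hd]] gg' Cg'; split.
  move=> p Up; apply: continuous_comp; first exact: cf.
  apply: differentiable_continuous; apply/derivable1_diffP.
  by have H := gg' p Up; exact: ex_derive.
exists (fun b p => g' (f p) * d b p) => b; have [? ?] := Hd b; split.
  by move=> p Up; apply: isd_comp; auto.
exact: CCM.
Qed.

Lemma CC_exp n U f : CC n U f -> CC n U (fun p => expR (f p)).
Proof.
elim: n f => [|n IH] f Cf.
  by apply: CC0_comp => // p _; exact: continuous_expR.
apply: CC_comp Cf _ (IH _ (CCW Cf)) => p _; exact: is_derive_expR.
Qed.

Lemma CC_cossin n U f : CC n U f ->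
  CC n U (fun p => cos (f p)) /\ CC n U (fun p => sin (f p)).
Proof.
elim: n f => [|n IH] f Cf.
  by split; apply: CC0_comp => // p _; [exact: continuous_cos|exact: continuous_sin].
have [C S] := IH _ (CCW Cf); split.
- by apply: (@CC_comp n U f cos (fun t => - sin t)) => //; exact: CCN.
- by apply: (@CC_comp n U f sin cos).
Qed.

Lemma CC_inv n U f : (forall p, U p -> f p != 0) -> CC n U f ->
  CC n U (fun p => (f p)^-1).
Proof.
move=> f0; elim: n => [|n IH] Cf.
  apply: (@CC0_comp U f (@GRing.inv R)) => // p Up.
  by apply: cvgV; [exact: f0|exact: cvg_id].
apply: (@CC_comp n U f (@GRing.inv R) (fun t => - t ^- 2)) => //.
  move=> p Up; apply: (is_derive_eq (is_deriveV _ _)) => //; first exact: f0.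
  by rewrite /GRing.scale/= mulr1.
apply: CCN; under eq_fun do rewrite -exprVn; apply: CCX; exact: IH (CCW Cf).
Qed.

Lemma CC_ln n U f : (forall p, U p -> 0 < f p) -> CC n U f ->
  CC n U (fun p => ln (f p)).
Proof.
move=> f0; case: n => [|n] Cf.
  by apply: CC0_comp => // p Up; apply: continuous_ln; exact: f0.
apply: (@CC_comp n U f (@ln R) (fun t => t^-1)) => //.
  by move=> p Up; apply: is_derive1_ln; exact: f0.
by apply: CC_inv; [move=> p Up; rewrite gt_eqF// f0|exact: CCW].
Qed.

Lemma CC_ext n U f g : open U -> (forall p, U p -> f p = g p) ->
  CC n U f -> CC n U g.
Proof.
move=> oU fg; have fgn p : U p -> \near p, f p = g p.
  by move=> Up; near=> q; apply: fg; near: q; exact: open_nbhs_nbhs.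
have cg : (forall p, U p -> {for p, continuous f}) ->
    forall p, U p -> {for p, continuous g}.
  move=> cf p Up; change (g x @[x --> p] --> g p); rewrite -(fg _ Up).
  by apply: cvg_trans (cf p Up); apply: near_eq_cvg; exact: fgn.
case: n => [|n] [cf H]; first by split; auto.
split; first exact: cg.
case: H => d Hd; exists d => b; have [H1 H2] := Hd b; split=> // p Up.
by apply: isd_near (H1 p Up); exact: fgn.
Unshelve. all: end_near. Qed.

Lemma CC_pd n U f b : open U -> CC n.+1 U f ->
  (forall p, U p -> isd b f p (pd b f p)) /\ CC n U (pd b f).
Proof.
move=> oU [cf [d Hd]]; have [H1 H2] := Hd b; split.
  by move=> p Up; have [_ ->] := isd_pd (H1 p Up); exact: H1.
by apply: CC_ext H2 => // p Up; have [_ ->] := isd_pd (H1 p Up).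
Qed.

(** Each neighbourhood comes with its own derivative witnesses; [pd] is one global choice that
    agrees with all of them. *)
Lemma CC_local n U f :
  (forall p, U p -> exists V, [/\ open V, V p & CC n V f]) -> CC n U f.
Proof.
elim: n f => [|n IH] f loc.
  by split=> // p /loc [V [oV Vp [cf _]]]; exact: cf.
split.
  by move=> p /loc [V [oV Vp [cf _]]]; exact: cf.
exists (fun b => pd b f) => b; split.
  by move=> p /loc [V [oV Vp /(@CC_pd n V f b oV) [+ _]]]; exact.
by apply: IH => p /loc [V [oV Vp /(@CC_pd n V f b oV) [_ ?]]]; exists V.
Qed.

Lemma CC_of_Ck k (O : set P) f : Ck_in k O f -> CC k O f.
Proof.
elim: k f => [|k IH] f Hf.
  split=> // p Op; have [+ _] := Hf [::] isT.
  by apply; rewrite inE.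
split.
  by move=> p Op; have [+ _] := Hf [::] isT; apply; rewrite inE.
exists (fun b => pd b f) => b; split.
  move=> p Op; apply: pd_ex_isd; have [_ +] := Hf [::] isT; by apply.
apply: IH => w sw; have := Hf (rcons w b); rewrite size_rcons => /(_ sw) [].
have -> : pdw (rcons w b) f = pdw w (pd b f) by rewrite /pdw foldr_rcons.
by move=> H1 H2; split=> // ?; exact: H2.
Qed.

Lemma smooth_of_CC f : (forall n, CC n setT f) -> smooth f.
Proof.
move=> Cf w; have Cw n : CC n setT (pdw w f).
  elim: w n => [|b w IH] n; first exact: Cf.
  by have [_] := CC_pd b openT (IH n.+1).
split; first by move=> p; exact: (CC_cont (Cw 0%N)).
move=> b p; have [+ _] := CC_pd b openT (Cw 1%N).
by move=> /(_ p I)/isd_pd[].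
Qed.

Lemma CC_of_smooth n f : smooth f -> CC n setT f.
Proof.
move=> sf; apply: CC_of_Ck => w _; have [cw ew] := sf w.
by split=> [p _|_ b p _]; [exact: cw|exact: ew].
Qed.

(* [w] may be junk outside [U]: the product is extended by the zeros of [k]. *)
Lemma CC_zero_ext n U (K : set P) (k w : P -> R) : open U -> closed K ->
  K `<=` U -> (forall p, ~ K p -> k p = 0) -> CC n setT k -> CC n U w ->
  CC n setT (fun p => k p * w p).
Proof.
move=> oU cK KU k0 Ck Cw; apply: CC_local => p _.
have [Kp|nKp] := pselect (K p).
  exists U; split=> //; first exact: KU.
  by apply: CCM => //; apply: CC_sub Ck.
exists (~` K); split=> //; first exact: closed_openC.
apply: (@CC_ext n _ (fun=> 0)); [exact: closed_openC| |exact: CC_cst].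
by move=> q Kq; rewrite k0// mul0r.
Qed.

Lemma isd_zero_out b f (K : set P) p l : closed K ->
  (forall p, ~ K p -> f p = 0) -> ~ K p -> isd b f p l -> l = 0.
Proof.
move=> cK f0 nKp H; apply: (isd_uniq H).
apply: (@isd_near b (fun=> 0)); last exact: isd_cst.
near=> q; apply/esym/f0; near: q.
by apply: open_nbhs_nbhs; split=> //; exact: closed_openC.
Unshelve. all: end_near. Qed.

End calculus.

(** * Integration over the plane *)

Section measure.
Variable R : realType.
Local Notation P := (R * R)%type.
Implicit Types (b : bool) (f g : P -> R) (p : P) (U V : set P).

Definition box (p : P) (e : R) : set P :=
  [set q | `|q.1 - p.1| < e /\ `|q.2 - p.2| < e].

Lemma box_nbhs p e : 0 < e -> nbhs p (box p e).
Proof.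
move=> e0; have := nbhsx_ballx p _ e0.
by apply: filterS => q []; rewrite /ball/= => H1 H2; split; rewrite distrC.
Qed.

Lemma nbhs_box p V : nbhs p V -> exists2 e : R, 0 < e & box p e `<=` V.
Proof.
move=> /nbhs_ballP[e /= e0 H]; exists e => // q [q1 q2]; apply: H.
by split; rewrite /ball/= distrC.
Qed.

Lemma box_open p e : open (box p e).
Proof.
rewrite openE => q [q1 q2]; apply: filterS (_ : nbhs q (box q (Num.min (e - `|q.1 - p.1|) (e - `|q.2 - p.2|)))).
  move=> r [r1 r2]; move: r1 r2; rewrite !lt_min => /andP[r1 _] /andP[_ r2].
  have := ler_distD q.1 r.1 p.1; have := ler_distD q.2 r.2 p.2; split; lra.
by apply: box_nbhs; rewrite lt_min !subr_gt0 q1.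
Qed.

Lemma box_ball p e : box p e = ball p.1 e `*` ball p.2 e.
Proof. by apply/seteqP; split=> q [? ?]; split; rewrite /ball/= distrC. Qed.

Lemma box_measurable p e : measurable (box p e).
Proof. by rewrite box_ball; apply: measurableX; exact: measurable_ball. Qed.

Lemma dist_half (x y z d e : R) :
  `|x - y| < d -> `|y - z| < d -> d < e / 2 -> `|x - z| < e.
Proof. by move=> xy yz de; have := ler_distD y x z; lra. Qed.

(** The sigma-algebra of the plane is generated by measurable rectangles, so an open set has to be
    exhausted by countably many boxes: those with rational centre and radius 1 / (k + 1) that it
    contains, enumerated by [unpickle]. *)
Lemma open_measurable2 (O : set P) : open O -> measurable O.
Proof.
move=> oO.
pose B (x : rat * rat * nat) := box (ratr x.1.1, ratr x.1.2) x.2.+1%:R^-1.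
pose F n := if unpickle n is Some x then if `[< B x `<=` O >] then B x else set0
            else set0.
rewrite (_ : O = \bigcup_n F n).
  apply: bigcupT_measurable => n; rewrite /F; case: unpickle => [x|//].
  by case: ifP => // _; exact: box_measurable.
apply/seteqP; split=> [p Op|p [n _]]; last first.
  by rewrite /F; case: unpickle => [x|//]; case: ifPn => // /asboolP; exact.
have [e e0 eO] := nbhs_box (open_nbhs_nbhs (conj oO Op)).
have [k _ /(_ k (leqnn k)) ke] := near_infty_natSinv_lt (PosNum (divr_gt0 e0 (ltr0n _ 2))).
rewrite /= in ke.
have k0 : 0 < k.+1%:R^-1 :> R by rewrite invr_gt0.
have rt (x : R) : exists q : rat, `|x - ratr q| < k.+1%:R^-1.
  move: k0; set d := _^-1 => k0; have xd : x - d < x + d by lra.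
  have [q] := rat_in_itvoo xd.
  by rewrite in_itv/= => /andP[? ?]; exists q; rewrite ltr_norml; apply/andP; split; lra.
have [q1 h1] := rt p.1; have [q2 h2] := rt p.2.
have [n nE] : exists n, unpickle n = Some (q1, q2, k).
  by exists (pickle (q1, q2, k)); rewrite pickleK.
exists n; first exact: I.
rewrite /F nE ifT; first by split.
apply/asboolP => r [r1 r2]; apply: eO; rewrite /= in r1 r2.
by split; [apply: dist_half r1 _ ke|apply: dist_half r2 _ ke]; rewrite distrC.
Qed.

Lemma continuous_on_measurable (O : set P) f : open O ->
  (forall p, O p -> {for p, continuous f}) -> measurable_fun O f.
Proof.
move=> oO cf; apply: (measurability _ (RGenOpens.measurableE R)).
move=> _ [_ [a [b ->] <-]]; apply: open_measurable2.
rewrite openE => p [Op Vfp]; apply: filterI; first exact: open_nbhs_nbhs.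
apply: (cf p Op); apply: open_nbhs_nbhs; split=> //; exact: interval_open.
Qed.

Lemma continuous_measurable2 f : continuous f -> measurable_fun setT f.
Proof. by move=> cf; apply: continuous_on_measurable => [|p _]; [exact: openT|exact: cf]. Qed.

Definition sq (M : R) : set P := [set p | `|p.1| <= M /\ `|p.2| <= M].

Lemma sqE M : sq M = `[- M, M] `*` `[- M, M].
Proof.
by apply/seteqP; split=> p; rewrite /sq/= !in_itv/= !ler_norml => -[-> ->].
Qed.

Lemma sq_compact M : compact (sq M).
Proof. by rewrite sqE; apply: compact_setX; exact: segment_compact. Qed.

Lemma sq_closed M : closed (sq M).
Proof. by apply: compact_closed; [exact: norm_hausdorff|exact: sq_compact]. Qed.

Lemma sq_measurable M : measurable (sq M).
Proof. by rewrite sqE; apply: measurableX; exact: measurable_itv. Qed.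

Lemma leb2_sq M : (@leb2 R (sq M) < +oo)%E.
Proof.
have I : (@lebesgue_measure R (`[- M, M]%classic : set R)%R < +oo)%E.
  by rewrite lebesgue_measure_itv /=; case: ifP => _; rewrite ?ltry// -EFinD ltry.
rewrite sqE /leb2 product_measure1E; [|exact: measurable_itv..].
by rewrite lte_mul_pinfty// ge0_fin_numE.
Qed.

Definition cs (M : R) f := continuous f /\ forall p, ~ sq M p -> f p = 0.

Lemma cs_bounded M f : cs M f -> exists2 C, 0 <= C & forall p, `|f p| <= C.
Proof.
move=> [cf f0].
have [C [_ HC]] := compact_bounded (continuous_compact (continuous_subspaceT cf) (@sq_compact M)).
exists (`|C| + 1); first by rewrite addr_ge0.
move=> p; have [sp|/f0 ->] := pselect (sq M p); last by rewrite normr0 addr_ge0.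
by apply: HC; [rewrite (le_lt_trans (ler_norm C))// ltrDl|exists p].
Qed.

Lemma bounded_sq_integrable M f (C : R) : measurable_fun setT f ->
  (forall p, `|f p| <= C) -> (forall p, ~ sq M p -> f p = 0) ->
  (@leb2 R).-integrable setT (EFin \o f).
Proof.
move=> mf fC f0; have : (@leb2 R).-integrable (sq M) (EFin \o f).
  apply: measurable_bounded_integrable; [exact: sq_measurable|exact: leb2_sq| |].
    exact: measurable_funTS.
  exists C; split; first exact: num_real.
  by move=> x Cx p _ /=; rewrite (le_trans (fC p))// ltW.
rewrite integrable_mkcond; last exact: sq_measurable.
congr (_.-integrable _ _); apply/funext => p; rewrite patchE.
case: ifPn => //; rewrite notin_setE => /f0; rewrite /comp => ->//.
Qed.

Lemma cs_integrable M f : cs M f -> (@leb2 R).-integrable setT (EFin \o f).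
Proof.
move=> Cf; have [C _ fC] := cs_bounded Cf; case: Cf => cf f0.
by apply: (bounded_sq_integrable _ fC f0); exact: continuous_measurable2.
Qed.

Definition I2 f : R := Rintegral (@leb2 R) setT f.

Lemma I2D f g : (@leb2 R).-integrable setT (EFin \o f) ->
  (@leb2 R).-integrable setT (EFin \o g) -> I2 (fun p => f p + g p) = I2 f + I2 g.
Proof. by move=> ? ?; exact: RintegralD. Qed.

Lemma I2Z f (r : R) : (@leb2 R).-integrable setT (EFin \o f) ->
  I2 (fun p => r * f p) = r * I2 f.
Proof. by move=> ?; exact: RintegralZl. Qed.

Lemma I2_le f g : (@leb2 R).-integrable setT (EFin \o f) ->
  (@leb2 R).-integrable setT (EFin \o g) -> (forall p, f p <= g p) -> I2 f <= I2 g.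
Proof. by move=> ? ? ?; apply: le_Rintegral. Qed.

Lemma integral_derive0 (M : R) (g g' : R -> R) : continuous g' ->
  (forall t, is_derive t (1 : R) g (g' t)) ->
  (forall t, M < `|t| -> g t = 0) ->
  (\int[@lebesgue_measure R]_t (g' t)%:E = 0)%E.
Proof.
move=> cg' gg' g0; pose N : R := `|M| + 1.
have N0 : 0 < N by rewrite ltr_wpDl.
have MN : M < N by rewrite (le_lt_trans (ler_norm M))// ltrDl.
have g'0 t : M < `|t| -> g' t = 0.
  move=> Mt; have [_ <-] := gg' t.
  rewrite (@near_eq_derive _ _ _ _ (cst 0)) ?derive_cst//.
  near=> s; rewrite g0//; near: s.
  by apply: (cvgr_gt _ (@norm_continuous _ _ t)).
have -> : (\int[@lebesgue_measure R]_t (g' t)%:E =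
    \int[@lebesgue_measure R]_(t in (`[- N, N]%classic : set R)%R) (g' t)%:E)%E.
  rewrite [RHS]integral_mkcond; apply: eq_integral => t _; rewrite patchE.
  case: ifPn => //; rewrite notin_setE/= in_itv/= -ler_norml => /negP.
  by rewrite -ltNge => Nt; rewrite g'0// (lt_trans MN).
have cg t : {for t, continuous g}.
  apply: differentiable_continuous; apply/derivable1_diffP.
  by have H := gg' t; exact: ex_derive.
rewrite (@continuous_FTC2 _ g' g).
- by rewrite !g0 ?sube0// ?normrN gtr0_norm.
- by lra.
- exact: continuous_subspaceT.
- split.
  + by move=> x _; have H := gg' x; exact: ex_derive.
  + by apply: cvg_at_right_filter; exact: cg.
  + by apply: cvg_at_left_filter; exact: cg.
- by move=> x _; rewrite derive1E; have H := gg' x; exact: derive_val.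
Unshelve. all: end_near. Qed.

(** Fubini with the variable of direction [b] innermost: on every line the fundamental theorem
    leaves only values of [f] outside the square. All integrations by parts reduce to this. *)
Lemma I2_derive0 M b f f' : cs M f -> cs M f' -> (forall p, isd b f p (f' p)) ->
  I2 f' = 0.
Proof.
move=> [cf f0] Cf' ff'; have If' := cs_integrable Cf'; case: Cf' => cf' _.
rewrite /I2 /Rintegral.
suff -> : (\int[@leb2 R]_p (f' p)%:E = 0)%E by [].
have slc b' p : continuous (fun t => f' (sl b' p t)).
  by move=> t; apply: continuous_comp; [exact: sl_continuous|exact: cf'].
case: b ff' => ff'.
- apply: etrans (esym (@integral21_prod_meas1 _ _ _ _ _ lebesgue_measure lebesgue_measure _ If')) _.
  rewrite (eq_integral (cst 0%E)) ?integral0// => y _.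
  rewrite /fubini_G; apply: (@integral_derive0 M (fun t => f (t, y))).
  + exact: (slc true (0, y)).
  + by move=> t; exact: (ff' (t, y)).
  + by move=> t Mt; apply: f0 => -[/=]; rewrite leNgt Mt.
- apply: etrans (esym (@integral12_prod_meas1 _ _ _ _ _ lebesgue_measure lebesgue_measure _ If')) _.
  rewrite (eq_integral (cst 0%E)) ?integral0// => x _.
  rewrite /fubini_F; apply: (@integral_derive0 M (fun t => f (x, t))).
  + exact: (slc false (x, 0)).
  + by move=> t; exact: (ff' (x, t)).
  + by move=> t Mt; apply: f0 => -[_ /=]; rewrite leNgt Mt.
Qed.

End measure.

(** * Symmetry of second derivatives *)

Section schwarz.
Variable R : realType.
Local Notation P := (R * R)%type.
Implicit Types (b : bool) (f g : P -> R) (p : P) (U V : set P).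

Lemma mvt_line b f d p (s t : R) : s < t ->
  (forall c, s <= c <= t -> isd b f (sl b p c) (d (sl b p c))) ->
  exists2 c, s < c < t & f (sl b p t) - f (sl b p s) = d (sl b p c) * (t - s).
Proof.
move=> st Hd.
have Hd' c : s <= c <= t ->
    is_derive c (1 : R) (fun t => f (sl b p t)) (d (sl b p c)).
  by move=> /Hd; case: b Hd.
have [||c Hc E] := @MVT R (fun t => f (sl b p t)) (fun t => d (sl b p t)) s t st.
- by move=> c; rewrite in_itv/= => /andP[/ltW sc /ltW ct]; apply: Hd'; rewrite sc.
- apply: derivable_within_continuous => c; rewrite in_itv/= => /Hd' H.
  exact: ex_derive.
- by exists c => //; move: Hc; rewrite in_itv.
Qed.

(** The mean value theorem in direction [b], applied to the difference in the other direction, and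
    then once more in that other direction. The left-hand side is symmetric in the two coordinates,
    the right-hand side is a mixed derivative in the order prescribed by [b]. *)
Let second_difference b f f' f'' p (s : R) : 0 < s ->
  (forall q, p.1 <= q.1 <= p.1 + s -> p.2 <= q.2 <= p.2 + s ->
     isd b f q (f' q) /\ isd (~~ b) f' q (f'' q)) ->
  exists q, [/\ p.1 <= q.1 <= p.1 + s, p.2 <= q.2 <= p.2 + s &
    f (p.1 + s, p.2 + s) - f (p.1 + s, p.2) - f (p.1, p.2 + s) + f p
      = f'' q * s ^+ 2].
Proof.
move=> s0; case: b => Hd.
- pose g (q : P) := f (q.1, p.2 + s) - f (q.1, p.2).
  have [||x /andP[x1 x2] /= E1] :=
    @mvt_line true g (fun q => f' (q.1, p.2 + s) - f' (q.1, p.2)) p p.1 (p.1 + s).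
  + by lra.
  + move=> c cc; have [H1 _] := Hd (c, p.2 + s) ltac:(by []) ltac:(by rewrite /=; lra).
    have [H2 _] := Hd (c, p.2) ltac:(by []) ltac:(by rewrite /=; lra).
    exact: (is_deriveB H1 H2).
  have [||y /andP[y1 y2] /= E2] :=
    @mvt_line false f' f'' (x, p.2) p.2 (p.2 + s).
  + by lra.
  + by move=> c cc; have [] := Hd (x, c) ltac:(by rewrite /=; lra) ltac:(by []).
  exists (x, y); split=> /=; [lra|lra|].
  move: E1; rewrite /g/= E2 (surjective_pairing p)/=.
  have -> : p.1 + s - p.1 = s by ring.
  have -> : p.2 + s - p.2 = s by ring.
  by move=> E1; rewrite expr2 mulrA -E1; ring.
- pose g (q : P) := f (p.1 + s, q.2) - f (p.1, q.2).
  have [||x /andP[x1 x2] /= E1] :=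
    @mvt_line false g (fun q => f' (p.1 + s, q.2) - f' (p.1, q.2)) p p.2 (p.2 + s).
  + by lra.
  + move=> c cc; have [H1 _] := Hd (p.1 + s, c) ltac:(by rewrite /=; lra) ltac:(by []).
    have [H2 _] := Hd (p.1, c) ltac:(by rewrite /=; lra) ltac:(by []).
    exact: (is_deriveB H1 H2).
  have [||y /andP[y1 y2] /= E2] :=
    @mvt_line true f' f'' (p.1, x) p.1 (p.1 + s).
  + by lra.
  + by move=> c cc; have [] := Hd (c, x) ltac:(by []) ltac:(by rewrite /=; lra).
  exists (y, x); split=> /=; [lra|lra|].
  move: E1; rewrite /g/= E2 (surjective_pairing p)/=.
  have -> : p.1 + s - p.1 = s by ring.
  have -> : p.2 + s - p.2 = s by ring.
  by move=> E1; rewrite expr2 mulrA -E1; ring.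
Qed.

Lemma continuous_dist f p (e : R) : {for p, continuous f} -> 0 < e ->
  nbhs p [set q | `|f p - f q| < e].
Proof. by move=> /(@cvgr_dist_lt _ _ _ _ _) + e0 => /(_ e e0). Qed.

(** One second difference over a small square is a value of each mixed derivative, at two possibly
    different points of the square; continuity of both derivatives at [p] closes the gap. *)
Lemma pd_comm U f p : open U -> CC 2 U f -> U p ->
  pd true (pd false f) p = pd false (pd true f) p.
Proof.
move=> oU Cf Up.
have [H1 C1] := CC_pd true oU Cf; have [H2 C2] := CC_pd false oU Cf.
have [H12 C12] := CC_pd false oU C1; have [H21 C21] := CC_pd true oU C2.
apply/eqP; rewrite -subr_eq0 -normr_le0; apply/ler_addgt0Pl => e e0.
have c12 := CC_cont C12 Up; have c21 := CC_cont C21 Up.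
have e2 : 0 < e / 2 by rewrite divr_gt0.
have [r r0 Hr] : exists2 r : R, 0 < r & box p r `<=` [set q | [/\ U q,
    `|pd false (pd true f) p - pd false (pd true f) q| < e / 2 &
    `|pd true (pd false f) p - pd true (pd false f) q| < e / 2]].
  have [r1 r10 h1] := nbhs_box (open_nbhs_nbhs (conj oU Up)).
  have [r2 r20 h2] := nbhs_box (continuous_dist c12 e2).
  have [r3 r30 h3] := nbhs_box (continuous_dist c21 e2).
  exists (Num.min r1 (Num.min r2 r3)); first by rewrite !lt_min r10 r20.
  move=> q [/=]; rewrite !lt_min => /and3P[? ? ?] /and3P[? ? ?].
  by split; [exact: h1|exact: h2|exact: h3].
have rr : 0 < r / 2 by rewrite divr_gt0.
have inb q : p.1 <= q.1 <= p.1 + r / 2 -> p.2 <= q.2 <= p.2 + r / 2 -> box p r q.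
  by move=> /andP[? ?] /andP[? ?]; split; rewrite ger0_norm; lra.
have [|q1 [q11 q12 E1]] := @second_difference true f (pd true f) (pd false (pd true f)) p _ rr.
  by move=> q /inb/[apply]/Hr [Uq _ _]; split; [exact: H1|exact: H12].
have [|q2 [q21 q22 E2]] := @second_difference false f (pd false f) (pd true (pd false f)) p _ rr.
  by move=> q /inb/[apply]/Hr [Uq _ _]; split; [exact: H2|exact: H21].
have {E1 E2} E : pd false (pd true f) q1 = pd true (pd false f) q2.
  apply: (@mulIf _ ((r / 2) ^+ 2)); first by rewrite expf_neq0// gt_eqF.
  exact: etrans (esym E1) E2.
have [_ D1 _] := Hr _ (inb _ q11 q12); have [_ _ D2] := Hr _ (inb _ q21 q22).
rewrite E in D1; rewrite [e + 0]addr0 distrC.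
apply/ltW/(le_lt_trans (ler_distD (pd true (pd false f) q2) _ _)).
rewrite [ltRHS]splitr; apply: ltrD; [exact: D1|rewrite distrC; exact: D2].
Qed.

End schwarz.

(** * Energy and mass densities *)

Section pauli_densities.
Variable R : realType.
Local Notation P := (R * R)%type.

Definition kin (h : R) (A1 A2 a a1 a2 b b1 b2 : P -> R) (p : P) : R :=
  (h * b1 p - A1 p * a p) ^+ 2 + (h * a1 p + A1 p * b p) ^+ 2
  + (h * b2 p - A2 p * a p) ^+ 2 + (h * a2 p + A2 p * b p) ^+ 2.

(* The density of |(pi_1 + i pi_2) (a + i b)|^2 with pi_j = - i h d_j - A_j. *)
Definition dbar (h : R) (A1 A2 a a1 a2 b b1 b2 : P -> R) (p : P) : R :=
  (h * b1 p - A1 p * a p + (h * a2 p + A2 p * b p)) ^+ 2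
  + (h * b2 p - A2 p * a p - (h * a1 p + A1 p * b p)) ^+ 2.

Definition mass (a b : P -> R) (p : P) : R := a p ^+ 2 + b p ^+ 2.

End pauli_densities.

(** * The Pauli form on test functions *)

Section test_functions.
Variable R : realType.
Local Notation P := (R * R)%type.
Variables (O K : set P) (M : R).
Hypotheses (oO : open O) (cK : closed K) (KO : K `<=` O) (KM : K `<=` sq M).
Implicit Types (f g : P -> R) (p : P).

(** Test functions of finite regularity, already extended by zero to the plane: multiplication by a
    coefficient that is regular only in [O] stays in the class, and integration by parts never meets
    the boundary of [O]. *)
Definition tf n f := CC n setT f /\ forall p, ~ K p -> f p = 0.

Lemma tf_cs n f : tf n f -> cs M f.
Proof.
move=> [Cf f0]; split=> [p|p nM]; first exact: (CC_cont Cf).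
by apply: f0 => /KM.
Qed.

Lemma tfI n f : tf n f -> (@leb2 R).-integrable setT (EFin \o f).
Proof. by move=> /tf_cs; exact: cs_integrable. Qed.

Lemma tf0 n f p : tf n f -> ~ K p -> f p = 0.
Proof. by move=> [_ f0]; exact: f0. Qed.

Lemma tfW n f : tf n.+1 f -> tf n f.
Proof. by move=> [/CCW]. Qed.

Lemma tfD n f g : tf n f -> tf n g -> tf n (fun p => f p + g p).
Proof.
move=> [Cf f0] [Cg g0]; split; first exact: CCD.
by move=> p Kp; rewrite f0// g0// addr0.
Qed.

Lemma tfN n f : tf n f -> tf n (fun p => - f p).
Proof. by move=> [Cf f0]; split; [exact: CCN|move=> p /f0 ->; rewrite oppr0]. Qed.

Lemma tfMl n f g : CC n O g -> tf n f -> tf n (fun p => g p * f p).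
Proof.
move=> Cg [Cf f0]; split; last by move=> p /f0 ->; rewrite mulr0.
under eq_fun do rewrite mulrC.
exact: (CC_zero_ext oO cK KO f0 Cf Cg).
Qed.

Lemma tfM n f g : tf n f -> tf n g -> tf n (fun p => f p * g p).
Proof. by move=> [Cf _] tg; apply: tfMl => //; exact: CC_sub Cf. Qed.

Lemma tfZ n (r : R) f : tf n f -> tf n (fun p => r * f p).
Proof. by move=> tg; apply: tfMl => //; exact: CC_cst. Qed.

Lemma tfX n f : tf n f -> tf n (fun p => f p ^+ 2).
Proof. by move=> tg; under eq_fun do rewrite expr2; exact: tfM. Qed.

Lemma tf_isd n f b p : tf n.+1 f -> isd b f p (pd b f p).
Proof. by move=> [/(CC_pd b openT)[H _] _]; exact: H. Qed.

Lemma tf_pd n f b : tf n.+1 f -> tf n (pd b f).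
Proof.
move=> t; have [[/(CC_pd b openT)[H C] f0]] := (t, t); move=> _; split=> // p Kp.
by apply: (isd_zero_out cK f0 Kp); exact: H.
Qed.

Lemma tf_mass n f g : tf n f -> tf n g -> tf n (mass f g).
Proof. by move=> ? ?; apply: tfD; exact: tfX. Qed.

Lemma tf_kin h A1 A2 a b : CC 0 O A1 -> CC 0 O A2 -> tf 1 a -> tf 1 b ->
  tf 0 (kin h A1 A2 a (pd true a) (pd false a) b (pd true b) (pd false b)).
Proof.
move=> C1 C2 ta tb; rewrite /kin.
have tz (u : bool) f : tf 1 f -> tf 0 (fun p => h * pd u f p).
  by move=> t; apply: tfZ; exact: tf_pd.
have tm A f : CC 0 O A -> tf 1 f -> tf 0 (fun p => A p * f p).
  by move=> C t; apply: tfMl => //; exact: tfW.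
apply: tfD; [apply: tfD; [apply: tfD|]|]; apply: tfX; apply: tfD;
  [exact: tz|apply: tfN; exact: tm|exact: tz|exact: tm|
   exact: tz|apply: tfN; exact: tm|exact: tz|exact: tm].
Qed.

Lemma tf_dbar h A1 A2 a b : CC 0 O A1 -> CC 0 O A2 -> tf 1 a -> tf 1 b ->
  tf 0 (dbar h A1 A2 a (pd true a) (pd false a) b (pd true b) (pd false b)).
Proof.
move=> C1 C2 ta tb; rewrite /dbar.
have tz (u : bool) f : tf 1 f -> tf 0 (fun p => h * pd u f p).
  by move=> t; apply: tfZ; exact: tf_pd.
have tm A f : CC 0 O A -> tf 1 f -> tf 0 (fun p => A p * f p).
  by move=> C t; apply: tfMl => //; exact: tfW.
apply: tfD; apply: tfX.
- by apply: tfD; apply: tfD; [exact: tz|apply: tfN; exact: tm|exact: tz|exact: tm].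
- apply: tfD; last apply: tfN; apply: tfD; [exact: tz|apply: tfN; exact: tm|exact: tz|exact: tm].
Qed.

(* With pi_j = - i h d_j - A_j and [pi_1, pi_2] = i h B, the cross term of
   |(pi_1 + i pi_2) u|^2 is - h B |u|^2 up to a divergence. *)
Lemma pauli_identity h A1 A2 B a b : CC 1 O A1 -> CC 1 O A2 -> CC 0 O B ->
  (forall p, O p -> pd true A2 p - pd false A1 p = B p) -> tf 2 a -> tf 2 b ->
  I2 (kin h A1 A2 a (pd true a) (pd false a) b (pd true b) (pd false b))
    - h * I2 (fun p => B p * mass a b p)
  = I2 (dbar h A1 A2 a (pd true a) (pd false a) b (pd true b) (pd false b)).
Proof.
move=> C1 C2 CB curlA ta tb.
have [ta1 tb1] := (tfW ta, tfW tb).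
have tk := tf_kin h (CCW C1) (CCW C2) ta1 tb1.
have td := tf_dbar h (CCW C1) (CCW C2) ta1 tb1.
have tB : tf 0 (fun p => B p * mass a b p).
  by apply: tfMl => //; apply: tf_mass; exact: tfW.
(* The cross term is 2 h^2 (d_1 b d_2 a - d_2 b d_1 a) + h (A2 d_1 |u|^2 - A1 d_2 |u|^2). Its
   Jacobian part is the divergence of 2 h^2 (b d_2 a, - b d_1 a) by symmetry of second derivatives,
   and the rest is the divergence of h (A2 |u|^2, - A1 |u|^2) minus h B |u|^2. *)
pose J1 p := 2 * h ^+ 2 * (b p * pd false a p) + h * (A2 p * mass a b p).
pose J2 p := - (2 * h ^+ 2 * (b p * pd true a p) + h * (A1 p * mass a b p)).
have tJ1 : tf 1 J1.
  by apply: tfD; apply: tfZ; [apply: tfM => //; exact: tf_pd|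
    apply: tfMl => //; exact: tf_mass].
have tJ2 : tf 1 J2.
  by apply: tfN; apply: tfD; apply: tfZ; [apply: tfM => //; exact: tf_pd|
    apply: tfMl => //; exact: tf_mass].
have I1 : I2 (pd true J1) = 0.
  apply: (@I2_derive0 _ M true J1); [exact: tf_cs tJ1|exact: tf_cs (tf_pd true tJ1)|].
  by move=> p; exact: tf_isd tJ1.
have I2' : I2 (pd false J2) = 0.
  apply: (@I2_derive0 _ M false J2); [exact: tf_cs tJ2|exact: tf_cs (tf_pd false tJ2)|].
  by move=> p; exact: tf_isd tJ2.
set k := kin _ _ _ _ _ _ _ _ _; set d := dbar _ _ _ _ _ _ _ _ _.
rewrite -/k in tk; rewrite -/d in td.
suff E p : k p + (- h) * (B p * mass a b p) = d p + (- 1) * (pd true J1 p + pd false J2 p).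
  transitivity (I2 (fun p => k p + (- h) * (B p * mass a b p))).
    rewrite I2D; [|exact: tfI tk|exact: tfI (tfZ _ tB)].
    by rewrite I2Z ?mulNr//; exact: tfI tB.
  rewrite (_ : (fun p => _) = fun p => d p + (- 1) * (pd true J1 p + pd false J2 p)); last exact/funext.
  have [t1 t2] := (tf_pd true tJ1, tf_pd false tJ2).
  rewrite I2D; [|exact: tfI td|exact: tfI (tfZ _ (tfD t1 t2))].
  rewrite I2Z; last exact: tfI (tfD t1 t2).
  rewrite I2D; [|exact: tfI t1|exact: tfI t2].
  by rewrite I1 I2' addr0 mulr0 addr0.
have [Kp|nKp] := pselect (K p); last first.
  rewrite (tf0 tk nKp) (tf0 td nKp) (tf0 tB nKp) (tf0 (tf_pd true tJ1) nKp).
  rewrite (tf0 (tf_pd false tJ2) nKp).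
  by rewrite !(mulr0, addr0).
have Op := KO Kp.
have a1 := tf_isd true p ta; have a2 := tf_isd false p ta.
have b1 := tf_isd true p tb; have b2 := tf_isd false p tb.
have a12 := tf_isd false p (tf_pd true ta); have a21 := tf_isd true p (tf_pd false ta).
have aC : pd true (pd false a) p = pd false (pd true a) p.
  by have [Ca _] := ta; exact: (pd_comm openT Ca).
rewrite {}aC in a21.
have A21 := (CC_pd true oO C2).1 p Op; have A12 := (CC_pd false oO C1).1 p Op.
have [_ E1] := isd_pd (isdD
  (isdM (isd_cst true (2 * h ^+ 2) p) (isdM b1 a21))
  (isdM (isd_cst true h p) (isdM A21 (isdD (isdM a1 a1) (isdM b1 b1))))).
have [_ E2] := isd_pd (isdN (isdD
  (isdM (isd_cst false (2 * h ^+ 2) p) (isdM b2 a12))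
  (isdM (isd_cst false h p) (isdM A12 (isdD (isdM a2 a2) (isdM b2 b2)))))).
rewrite -[pd true J1 p]/(pd true (fun q => 2 * h ^+ 2 * (b q * pd false a q) + h * (A2 q * (a q * a q + b q * b q))) p) {}E1.
rewrite -[pd false J2 p]/(pd false (fun q => - (2 * h ^+ 2 * (b q * pd true a q) + h * (A1 q * (a q * a q + b q * b q)))) p) {}E2.
rewrite /k /d /kin /dbar /mass -(curlA p Op).
move: (pd true a p) (pd false a p) (pd true b p) (pd false b p)
  (pd false (pd true a) p) (pd true A2 p) (pd false A1 p) => x1 x2 y1 y2 x12 z1 z2.
by ring.
Qed.

End test_functions.

(** * Magnetic Poincare inequality and the lower bound on test functions *)

Section lower_test.
Variable R : realType.
Local Notation P := (R * R)%type.
Variables (O K : set P) (M : R).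
Hypotheses (oO : open O) (cK : closed K) (KO : K `<=` O) (KM : K `<=` sq M).
Hypothesis M0 : 0 < M.
Implicit Types (f g : P -> R) (p : P).
Local Notation tf := (tf K).

(** The potential cancels in a (h a1 + A1 b) + b (h b1 - A1 a) = h (a a1 + b b1), so the derivative
    of |u|^2 is controlled by the magnetic gradient alone. With q = (h a1 + A1 b) / h and p = (h b1
    - A1 a) / h, the estimate then follows from the squares of a + 2 x q and b + 2 x p. *)
Lemma poincare_pointwise (h x N A1 A2 a a1 a2 b b1 b2 : R) : 0 < h -> `|x| <= N ->
  2^-1 * (a ^+ 2 + b ^+ 2) + - (2 * N ^+ 2 / h ^+ 2) *
    ((h * b1 - A1 * a) ^+ 2 + (h * a1 + A1 * b) ^+ 2
     + (h * b2 - A2 * a) ^+ 2 + (h * a2 + A2 * b) ^+ 2)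
  <= (a * a + b * b) + x * (a1 * a + a * a1 + (b1 * b + b * b1)).
Proof.
move=> h0 xN.
have h00 : h != 0 by rewrite gt_eqF.
have xN2 : x ^+ 2 <= N ^+ 2.
  by rewrite -(real_normK (num_real x)) lerXn2r// nnegrE ?(le_trans _ xN).
set p1 := h * b1 - A1 * a; set q1 := h * a1 + A1 * b.
set r := (h * b2 - A2 * a) ^+ 2; set s := (h * a2 + A2 * b) ^+ 2.
have r0 : 0 <= r by exact: sqr_ge0.
have s0 : 0 <= s by exact: sqr_ge0.
have -> : (a * a + b * b) + x * (a1 * a + a * a1 + (b1 * b + b * b1)) =
    a ^+ 2 + b ^+ 2 + 2 * x * (a * (q1 / h) + b * (p1 / h)).
  by rewrite /p1 /q1; field.
have -> : - (2 * N ^+ 2 / h ^+ 2) * (p1 ^+ 2 + q1 ^+ 2 + r + s) =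
    - 2 * N ^+ 2 * ((p1 / h) ^+ 2 + (q1 / h) ^+ 2 + (r + s) / h ^+ 2) by field.
have rs : 0 <= (r + s) / h ^+ 2 by rewrite divr_ge0 ?addr_ge0 ?sqr_ge0.
move: (p1 / h) (q1 / h) ((r + s) / h ^+ 2) rs => p q t t0.
have H1 := sqr_ge0 (a + 2 * x * q); have H2 := sqr_ge0 (b + 2 * x * p).
have H3 : 0 <= (N ^+ 2 - x ^+ 2) * (p ^+ 2 + q ^+ 2).
  by rewrite mulr_ge0 ?subr_ge0 ?addr_ge0 ?sqr_ge0.
have H4 : 0 <= N ^+ 2 * t by rewrite mulr_ge0 ?sqr_ge0.
lra.
Qed.

(** The integral of d_1 (x_1 |u|^2) is zero, and |x_1| <= M on the support. The pointwise bound
    turns this into half the mass being at most 2 M^2 / h^2 times the kinetic energy. *)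
Lemma magnetic_poincare h A1 A2 a b : 0 < h -> CC 0 O A1 -> CC 0 O A2 ->
  tf 1 a -> tf 1 b ->
  I2 (mass a b) <= (4 * M ^+ 2 / h ^+ 2) *
    I2 (kin h A1 A2 a (pd true a) (pd false a) b (pd true b) (pd false b)).
Proof.
move=> h0 C1 C2 ta tb.
have tk := tf_kin oO cK KO h C1 C2 ta tb.
have tm := tf_mass oO cK KO ta tb.
pose F p := p.1 * mass a b p.
have tF : tf 1 F by exact: (tfMl oO cK KO (CC_co 1 O true) tm).
have IF : I2 (pd true F) = 0.
  apply: (@I2_derive0 _ M true F); [exact: (tf_cs KM tF)|exact: (tf_cs KM (tf_pd cK true tF))|].
  by move=> p; exact: tf_isd tF.
set k := kin _ _ _ _ _ _ _ _ _; rewrite -/k in tk.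
have E p : pd true F p = mass a b p +
   p.1 * (pd true a p * a p + a p * pd true a p + (pd true b p * b p + b p * pd true b p)).
  have a1 := tf_isd true p ta; have b1 := tf_isd true p tb.
  have [_] := isd_pd (isdM (isd_co true true p) (isdD (isdM a1 a1) (isdM b1 b1))).
  rewrite -[pd true F p]/(pd true (fun q => co true q * (a q * a q + b q * b q)) p) => ->.
  by rewrite /mass /= mul1r !expr2.
have tm2 := tfZ oO cK KO 2^-1 (tfW tm); have tk2 := tfZ oO cK KO (- (2 * M ^+ 2 / h ^+ 2)) tk.
have tF1 := tf_pd cK true tF.
have : I2 (fun p => 2^-1 * mass a b p + - (2 * M ^+ 2 / h ^+ 2) * k p) <= I2 (pd true F).
  apply: I2_le; [exact: (tfI KM (tfD tm2 tk2))|exact: (tfI KM tF1)|] => p.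
  rewrite E /mass /k /kin; have [Kp|nKp] := pselect (K p).
    have [x1 _] := KM Kp.
    by rewrite [in leRHS]expr2 [in leRHS]expr2; exact: poincare_pointwise.
  rewrite (tf0 ta nKp) (tf0 tb nKp) (tf0 (tf_pd cK true ta) nKp)
    (tf0 (tf_pd cK false ta) nKp) (tf0 (tf_pd cK true tb) nKp)
    (tf0 (tf_pd cK false tb) nKp).
  by rewrite !(mulr0, subr0, addr0, expr0n)/= ?(mulr0, addr0).
rewrite IF I2D; [|exact: (tfI KM tm2)|exact: (tfI KM tk2)].
rewrite I2Z; [|exact: (tfI KM (tfW tm))]; rewrite I2Z; [|exact: (tfI KM tk)].
move: (I2 _) (I2 _) => x y.
have -> : 4 * M ^+ 2 / h ^+ 2 = 2 * (2 * M ^+ 2 / h ^+ 2) by field; rewrite gt_eqF.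
move: (_ / _) => z; lra.
Qed.

Variables (h m : R) (A1 A2 B psi : P -> R).
Hypotheses (h0 : 0 < h) (C1 : CC 1 O A1) (C2 : CC 1 O A2) (CB : CC 0 O B)
  (Cpsi : CC 2 O psi)
  (curlA : forall p, O p -> pd true A2 p - pd false A1 p = B p)
  (lap : forall p, O p -> pd true (pd true psi) p + pd false (pd false psi) p = B p)
  (psi_le0 : forall p, O p -> psi p <= 0) (m_le : forall p, O p -> m <= psi p).

Lemma lower_test a b : tf 2 a -> tf 2 b ->
  h ^+ 2 / (4 * M ^+ 2) * expR (2 * m / h) * I2 (mass a b) <=
  I2 (kin h A1 A2 a (pd true a) (pd false a) b (pd true b) (pd false b))
    - h * I2 (fun p => B p * mass a b p).
Proof.
move=> ta tb; rewrite (pauli_identity oO cK KO KM h C1 C2 CB curlA ta tb).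
have [ps1 Cp1] := CC_pd true oO Cpsi; have [ps2 Cp2] := CC_pd false oO Cpsi.
have [ps11 _] := CC_pd true oO Cp1; have [ps22 _] := CC_pd false oO Cp2.
(* The potential of the operator acting on v = exp (psi / h) u; its curl is B minus the Laplacian of
   [psi], that is zero. *)
pose T1 p := A1 p + pd false psi p; pose T2 p := A2 p - pd true psi p.
have CT1 : CC 1 O T1 by exact: CCD.
have CT2 : CC 1 O T2 by exact: CCB.
have curlT p : O p -> pd true T2 p - pd false T1 p = 0.
  move=> Op; have A21 := (CC_pd true oO C2).1 p Op; have A12 := (CC_pd false oO C1).1 p Op.
  have [_] := isd_pd (isdD A21 (isdN (ps11 p Op))).
  have [_] := isd_pd (isdD A12 (ps22 p Op)).
  rewrite -[pd true T2 p]/(pd true (fun q => A2 q + - pd true psi q) p) => -> ->.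
  move: (curlA Op) (lap Op); move: (pd true A2 p) (pd false A1 p) (B p)
    (pd true (pd true psi) p) (pd false (pd false psi) p) => x1 x2 x3 x4 x5; lra.
pose E p := expR (h^-1 * psi p).
have CE : CC 2 O E by apply: CC_exp; apply: CCM => //; exact: CC_cst.
have dE (u : bool) p : O p -> isd u E p (E p * (h^-1 * pd u psi p)).
  move=> Op; apply: isd_eq.
    apply: (isd_comp (is_derive_expR _)); apply: isdM (isd_cst _ _ _) _.
    by case: u; [exact: ps1|exact: ps2].
  by rewrite mul0r add0r.
pose v p := E p * a p; pose w p := E p * b p.
have tv : tf 2 v := tfMl oO cK KO CE ta.
have tw : tf 2 w := tfMl oO cK KO CE tb.
have dv (u : bool) p : O p -> pd u v p = E p * (h^-1 * pd u psi p) * a p + E p * pd u a p.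
  by move=> Op; have [_ ->] := isd_pd (isdM (dE u p Op) (tf_isd u p ta)).
have dw (u : bool) p : O p -> pd u w p = E p * (h^-1 * pd u psi p) * b p + E p * pd u b p.
  by move=> Op; have [_ ->] := isd_pd (isdM (dE u p Op) (tf_isd u p tb)).
have tdA := tf_dbar oO cK KO h (CCW C1) (CCW C2) (tfW ta) (tfW tb).
have tdT := tf_dbar oO cK KO h (CCW CT1) (CCW CT2) (tfW tv) (tfW tw).
have tm := tf_mass oO cK KO ta tb; have tmv := tf_mass oO cK KO tv tw.
(* Pointwise the density for [T] at exp (psi / h) u is E^2 times the density for [A] at u, and E <=
   1 because [psi] is nonpositive. *)
have L1 : I2 (dbar h T1 T2 v (pd true v) (pd false v) w (pd true w) (pd false w)) <=
          I2 (dbar h A1 A2 a (pd true a) (pd false a) b (pd true b) (pd false b)).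
  apply: I2_le; [exact: (tfI KM tdT)|exact: (tfI KM tdA)|] => p.
  have [Kp|nKp] := pselect (K p); last by rewrite (tf0 tdT nKp) (tf0 tdA nKp).
  have Op := KO Kp.
  rewrite /dbar !dv ?dw// /v /w /T1 /T2.
  have E1 : E p ^+ 2 <= 1.
    rewrite expr_le1 ?expR_ge0// -expR0 ler_expR pmulr_rle0 ?invr_gt0//.
    exact: psi_le0.
  have : 0 <= (1 - E p ^+ 2) * ((h * pd true b p - A1 p * a p + (h * pd false a p + A2 p * b p)) ^+ 2
    + (h * pd false b p - A2 p * a p - (h * pd true a p + A1 p * b p)) ^+ 2).
    by rewrite mulr_ge0 ?subr_ge0 ?addr_ge0 ?sqr_ge0.
  rewrite mulrBl mul1r subr_ge0; apply: le_trans; rewrite le_eqVlt; apply/orP; left; apply/eqP.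
  move: (E p) (a p) (b p) (A1 p) (A2 p) (pd true a p) (pd false a p) (pd true b p)
    (pd false b p) (pd true psi p) (pd false psi p) => e ? ? ? ? ? ? ? ? ? ?.
  by field; rewrite gt_eqF.
apply: le_trans L1.
(* With zero field the same identity turns the d-bar energy of the transformed state into its full
   kinetic energy, which is what the Poincare inequality bounds. *)
have := pauli_identity oO cK KO KM h CT1 CT2 (CC_cst 0 O 0) curlT tv tw.
rewrite (_ : (fun p => 0 * mass v w p) = fun p => 0 * mass a b p); last first.
  by apply/funext => p; rewrite !mul0r.
rewrite I2Z; last exact: (tfI KM tm).
rewrite mul0r mulr0 subr0 => <-.
have L2 := magnetic_poincare h0 (CCW CT1) (CCW CT2) (tfW tv) (tfW tw).
have L3 : expR (2 * m / h) * I2 (mass a b) <= I2 (mass v w).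
  rewrite -I2Z; last exact: (tfI KM tm).
  apply: I2_le; [exact: (tfI KM (tfZ oO cK KO _ tm))|exact: (tfI KM tmv)|] => p.
  have [Kp|nKp] := pselect (K p); last by rewrite (tf0 tmv nKp) (tf0 tm nKp) mulr0.
  have -> : mass v w p = E p ^+ 2 * mass a b p by rewrite /mass /v /w; ring.
  rewrite ler_wpM2r ?addr_ge0 ?sqr_ge0// /E -expRM_natl ler_expR.
  rewrite -[2 * m / h]mulrA ler_pM2l// mulrC ler_pM2l ?invr_gt0//.
  by apply: m_le; exact: KO.
set k := I2 (kin _ _ _ _ _ _ _ _ _) in L2 *.
have L4 := le_trans L3 L2.
rewrite -mulrA (_ : k = h ^+ 2 / (4 * M ^+ 2) * (4 * M ^+ 2 / h ^+ 2 * k)).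
  by rewrite ler_wpM2l// ?divr_ge0 ?mulr_ge0 ?sqr_ge0 ?ltW.
by field; rewrite !gt_eqF.
Qed.

End lower_test.

(** * Passage to the form domain and the lower bound *)

Section square_integrable.
Variable R : realType.
Local Notation P := (measurableTypeR R * measurableTypeR R)%type.
Local Notation mu := (@leb2 R).
Variable D : set P.
Hypothesis mD : measurable D.
Implicit Types (f g : P -> R) (p : P).

Definition L2 f := measurable_fun D f /\
  mu.-integrable D (EFin \o (fun p => f p ^+ 2)).

Definition n2 f : R := Rintegral mu D (fun p => f p ^+ 2).

Lemma n2_ge0 f : 0 <= n2 f.
Proof. by apply: Rintegral_ge0 => p _; exact: sqr_ge0. Qed.

Lemma integrable_comb (x y : R) f g : mu.-integrable D (EFin \o f) ->
  mu.-integrable D (EFin \o g) ->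
  mu.-integrable D (EFin \o (fun p => x * f p + y * g p)) /\
  Rintegral mu D (fun p => x * f p + y * g p) =
  x * Rintegral mu D f + y * Rintegral mu D g.
Proof.
move=> If Ig.
have Ix : mu.-integrable D (EFin \o (fun p => x * f p)).
  by have := integrableZl mD x If; apply: eq_integrable.
have Iy : mu.-integrable D (EFin \o (fun p => y * g p)).
  by have := integrableZl mD y Ig; apply: eq_integrable.
split; first by have := integrableD mD Ix Iy; apply: eq_integrable.
by rewrite RintegralD// !RintegralZl.
Qed.

Lemma L2_le (c : R) f g h : measurable_fun D f -> L2 g -> L2 h ->
  (forall p, D p -> f p ^+ 2 <= c * g p ^+ 2 + c * h p ^+ 2) -> L2 f.
Proof.
move=> mf [_ Ig] [_ Ih] H; split=> //.
have [I _] := integrable_comb c c Ig Ih.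
apply: le_integrable I => //.
  by apply/measurable_EFinP; exact: measurable_funX.
move=> p Dp; rewrite /= lee_fin ger0_norm ?sqr_ge0// (le_trans (H p Dp))//.
exact: ler_norm.
Qed.

Lemma n2_le (c : R) f g h : L2 f -> L2 g -> L2 h ->
  (forall p, D p -> f p ^+ 2 <= c * g p ^+ 2 + c * h p ^+ 2) ->
  n2 f <= c * n2 g + c * n2 h.
Proof.
move=> [_ If] [_ Ig] [_ Ih] H.
have [I <-] := integrable_comb c c Ig Ih.
exact: le_Rintegral.
Qed.

Lemma L2_comb (C : R) (al be f g : P -> R) :
  measurable_fun D al -> measurable_fun D be ->
  (forall p, D p -> `|al p| <= C) -> (forall p, D p -> `|be p| <= C) ->
  L2 f -> L2 g ->
  let u p := al p * f p + be p * g p in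
  L2 u /\ n2 u <= 2 * C ^+ 2 * n2 f + 2 * C ^+ 2 * n2 g.
Proof.
move=> mal mbe alC beC Lf Lg u.
have H p : D p -> u p ^+ 2 <= 2 * C ^+ 2 * f p ^+ 2 + 2 * C ^+ 2 * g p ^+ 2.
  move=> Dp; have sC (x : R) : `|x| <= C -> x ^+ 2 <= C ^+ 2.
    move=> xC; rewrite -(real_normK (num_real x)) lerXn2r// nnegrE.
    exact: le_trans xC.
  have := sC _ (alC p Dp); have := sC _ (beC p Dp); rewrite /u.
  move: (al p) (be p) (f p) (g p) => x y s t yC xC.
  have H1 : 0 <= (C ^+ 2 - x ^+ 2) * s ^+ 2 by rewrite mulr_ge0 ?subr_ge0 ?sqr_ge0.
  have H2 : 0 <= (C ^+ 2 - y ^+ 2) * t ^+ 2 by rewrite mulr_ge0 ?subr_ge0 ?sqr_ge0.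
  have H3 := sqr_ge0 (x * s - y * t); lra.
have mu_ : measurable_fun D u.
  by apply: measurable_funD; apply: measurable_funM => //; [case: Lf|case: Lg].
have Lu : L2 u by exact: L2_le H.
by split=> //; exact: n2_le H.
Qed.

Definition cvg2 (f_ : nat -> P -> R) f :=
  [/\ forall n, L2 (f_ n), L2 f & n2 (fun p => f_ n p - f p) @[n --> \oo] --> 0].

Lemma L2B f g : L2 f -> L2 g -> L2 (fun p => f p - g p).
Proof.
move=> Lf Lg; have [|||| L _] := @L2_comb 1 (cst 1) (cst (-1)) f g _ _ _ _ Lf Lg.
- exact: measurable_cst.
- exact: measurable_cst.
- by move=> p _; rewrite normr1.
- by move=> p _; rewrite normrN1.
by move: L; under eq_fun do rewrite mul1r mulN1r.
Qed.

Lemma cvg2_comb (C : R) (al be : P -> R) (f_ g_ : nat -> P -> R) f g :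
  measurable_fun D al -> measurable_fun D be ->
  (forall p, D p -> `|al p| <= C) -> (forall p, D p -> `|be p| <= C) ->
  cvg2 f_ f -> cvg2 g_ g ->
  cvg2 (fun n p => al p * f_ n p + be p * g_ n p) (fun p => al p * f p + be p * g p).
Proof.
move=> mal mbe alC beC [Lf_ Lf f0] [Lg_ Lg g0]; split.
- by move=> n; have [] := L2_comb mal mbe alC beC (Lf_ n) (Lg_ n).
- by have [] := L2_comb mal mbe alC beC Lf Lg.
apply: (@squeeze_cvgr _ _ _ _ (fun=> 0) (fun n =>
    2 * C ^+ 2 * n2 (fun p => f_ n p - f p) + 2 * C ^+ 2 * n2 (fun p => g_ n p - g p))).
- apply: nearW => n; rewrite n2_ge0/=.
  have [_ H] := L2_comb mal mbe alC beC (L2B (Lf_ n) Lf) (L2B (Lg_ n) Lg).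
  apply: le_trans H; rewrite le_eqVlt; apply/orP; left; apply/eqP.
  by congr (n2 _); apply/funext => p; ring.
- exact: cvg_cst.
- have := cvgD (cvgM (cvg_cst (2 * C ^+ 2)) f0) (cvgM (cvg_cst (2 * C ^+ 2)) g0).
  by rewrite mulr0 addr0; exact.
Qed.

(** With e_ = f_n - f, the pointwise inequality |f^2 - f_n^2| <= d f^2 + (1 + 1/d) e_^2 replaces
    Cauchy-Schwarz. The choice of [d] makes the first term at most half the tolerance, the 1 in its
    denominator covering the case of zero norm. *)
Lemma cvg2_norm (f_ : nat -> P -> R) f : cvg2 f_ f -> n2 (f_ n) @[n --> \oo] --> n2 f.
Proof.
move=> [Lf_ Lf f0]; apply/cvgrPdist_le => e e0.
pose d := e / (2 * (n2 f + 1)).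
have x1 : 0 < n2 f + 1 by rewrite ltr_wpDl// n2_ge0.
have d0 : 0 < d by rewrite divr_gt0// mulr_gt0.
have c0 : 0 < 1 + d^-1 by rewrite addr_gt0// invr_gt0.
have ec : 0 < e / (2 * (1 + d^-1)) by rewrite divr_gt0// mulr_gt0.
near=> n.
have Hn : n2 (fun p => f_ n p - f p) < e / (2 * (1 + d^-1)).
  have : `|0 - n2 (fun p => f_ n p - f p)| < e / (2 * (1 + d^-1)).
    by near: n; move/cvgrPdist_lt : f0; apply.
  by rewrite sub0r normrN ger0_norm// n2_ge0.
pose e_ p := f_ n p - f p; rewrite -/e_ in Hn.
have Le : L2 e_ by exact: L2B.
have pw p : `|f p ^+ 2 - f_ n p ^+ 2| <= d * f p ^+ 2 + (1 + d^-1) * e_ p ^+ 2.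
  rewrite /e_; move: (f p) (f_ n p) => s t.
  have dV : d * d^-1 = 1 by rewrite divff// gt_eqF.
  have H1 : 0 <= d^-1 * (d * s + (t - s)) ^+ 2 by rewrite mulr_ge0 ?sqr_ge0// invr_ge0 ltW.
  have H2 : 0 <= d^-1 * (d * s - (t - s)) ^+ 2 by rewrite mulr_ge0 ?sqr_ge0// invr_ge0 ltW.
  have E1 : d^-1 * (d * s + (t - s)) ^+ 2 = d * s ^+ 2 + 2 * s * (t - s) + d^-1 * (t - s) ^+ 2.
    by field; rewrite gt_eqF.
  have E2 : d^-1 * (d * s - (t - s)) ^+ 2 = d * s ^+ 2 - 2 * s * (t - s) + d^-1 * (t - s) ^+ 2.
    by field; rewrite gt_eqF.
  rewrite E1 in H1; rewrite E2 in H2; rewrite ler_norml mulrDl mul1r.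
  have H3 := sqr_ge0 (t - s); move: (d^-1 * _) H1 H2 => z H1 H2.
  by apply/andP; split; lra.
have I2d : `|n2 f - n2 (f_ n)| <= d * n2 f + (1 + d^-1) * n2 e_.
  have [_ If] := Lf; have [_ Ifn] := Lf_ n; have [_ Ie] := Le.
  rewrite -RintegralB//.
  have IB : mu.-integrable D (EFin \o (fun p => f p ^+ 2 - f_ n p ^+ 2)).
    by have := integrableB mD If Ifn; apply: eq_integrable.
  apply: (le_trans (le_normr_Rintegral mD IB)).
  have [I <-] := integrable_comb d (1 + d^-1) If Ie.
  by apply: le_Rintegral => //; exact: (integrable_norm IB).
apply: (le_trans I2d).
have -> : e = e / 2 + e / 2 by rewrite -splitr.
apply: lerD.
  rewrite /d mulrAC ler_pdivrMr ?mulr_gt0//.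
  rewrite (_ : e / 2 * (2 * (n2 f + 1)) = e * (n2 f + 1)); last by field.
  by rewrite ler_pM2l// lerDl.
move/ltW: Hn; rewrite ler_pdivlMr ?mulr_gt0// => Hn.
rewrite ler_pdivlMr//; apply: le_trans Hn; rewrite le_eqVlt; apply/orP; left; apply/eqP; ring.
Unshelve. all: end_near. Qed.

(** Square integrability of the limit is not assumed in [H10]. It comes from the convergence: some
    distance to [f_ n] is finite, and f^2 <= 2 f_n^2 + 2 (f_n - f)^2. *)
Lemma L2_of_cvg0 (f_ : nat -> P -> R) f :
  (forall n, L2 (f_ n)) -> measurable_fun setT f ->
  (forall n, measurable_fun setT (f_ n)) ->
  (fun n => \int[mu]_(p in setT) (((f_ n p - f p) ^+ 2)%:E))%E @ \oo --> 0%E ->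
  cvg2 f_ f.
Proof.
move=> Lf_ mf mf_ /fine_cvgP[fin cv].
have md n : measurable_fun setT (fun p => f_ n p - f p) by exact: measurable_funB.
have Le n : (\int[mu]_(p in setT) (((f_ n p - f p) ^+ 2)%:E))%E \is a fin_num ->
    L2 (fun p => f_ n p - f p).
  move=> fn; split; first exact: measurable_funTS.
  apply: (@integrableS _ _ _ mu setT) => //.
  apply/integrableP; split.
    by apply/measurable_EFinP; exact: measurable_funX.
  under eq_integral do rewrite /= ger0_norm ?sqr_ge0//.
  by rewrite -ge0_fin_numE// integral_ge0// => p _; rewrite lee_fin sqr_ge0.
have Lf : L2 f.
  have [n fn] := filter_ex fin.
  apply: (@L2_le 2 _ (f_ n) (fun p => f_ n p - f p)) => //.
  - exact: measurable_funTS.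
  - exact: Le.
  move=> p _; have := sqr_ge0 (2 * f_ n p - f p); move: (f_ n p) (f p) => s t; lra.
split=> //.
apply: (@squeeze_cvgr _ _ _ _ (fun=> 0) (fun n =>
  fine (\int[mu]_(p in setT) (((f_ n p - f p) ^+ 2)%:E))%E)) => //; last exact: cvg_cst.
apply: filterS fin => n fn; rewrite n2_ge0/=.
apply: fine_le => //.
  have [_ I] := Le n fn; exact: integrable_fin_num.
apply: ge0_subset_integral => //.
  by apply/measurable_EFinP; exact: measurable_funX.
by move=> p _; rewrite lee_fin sqr_ge0.
Qed.

End square_integrable.

(** * Maximum principle and bounds on the closure of the domain *)

Section max_principle.
Variable R : realType.
Local Notation P := (R * R)%type.
Implicit Types (f g : P -> R) (p : P) (O : set P).

Lemma sl_box b p t e : 0 < e -> `|t - co b p| < e -> box p e (sl b p t).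
Proof. by move=> e0; case: b => H; split=> //=; rewrite subrr normr0. Qed.

(** Were the second derivative positive at the maximum, the first derivative, zero there, would be
    positive just after [p] on the line, and [f] would exceed its maximum; two mean values make this
    precise. *)
Lemma second_derivative_max O f b p : open O -> CC 2 O f -> O p ->
  (forall q, O q -> f q <= f p) -> pd b (pd b f) p <= 0.
Proof.
move=> oO Cf Op fmax; rewrite leNgt; apply/negP => L0.
have [H1 C1] := CC_pd b oO Cf; have [H2 C2] := CC_pd b oO C1.
move: (pd b f) (pd b (pd b f)) L0 H1 C1 H2 C2 => f1 f2 L0 H1 C1 H2 C2.
have [r1 r10 h1] := nbhs_box (open_nbhs_nbhs (conj oO Op)).
have [r2 r20 h2] := nbhs_box (continuous_dist (CC_cont C2 Op) L0).
pose r := Num.min r1 r2.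
have r0 : 0 < r by rewrite lt_min r10.
have inO t : `|t - co b p| < r -> O (sl b p t).
  by rewrite lt_min => /andP[? _]; apply: h1; exact: sl_box.
have pos t : `|t - co b p| < r -> 0 < f2 (sl b p t).
  rewrite lt_min => /andP[_ tr2].
  have : `|f2 p - f2 (sl b p t)| < f2 p := h2 _ (sl_box r20 tr2).
  by rewrite ltr_distlC subrr => /andP[+ _].
have itv t : t \in `]co b p - r, co b p + r[ -> `|t - co b p| < r.
  by rewrite in_itv/= ltr_distl.
have D t : `|t - co b p| < r -> isd b f (sl b p t) (f1 (sl b p t)).
  by move=> /inO; exact: H1.
have D0 : f1 p = 0.
  suff H : isd b f p 0 by exact: (isd_uniq (H1 p Op) H).
  apply: (@derive1_at_max _ _ (co b p - r) (co b p + r)).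
  - by lra.
  - by move=> t /itv/D; rewrite /isd; case: (b) => H; exact: ex_derive.
  - by rewrite in_itv/=; apply/andP; split; lra.
  - by move=> t /itv/inO/fmax; rewrite sl_co.
have cr : co b p < co b p + r / 2 by lra.
have near t : co b p <= t <= co b p + r / 2 -> `|t - co b p| < r.
  by move=> /andP[? ?]; rewrite ger0_norm; lra.
have [t /andP[t1 t2] E1] := mvt_line cr (fun t H => D t (near t H)).
have [|s /andP[s1 s2] E2] := @mvt_line _ b (f1) (f2) p _ _ t1.
  move=> s /andP[? ?]; apply: H2; apply: inO; apply: near.
  by apply/andP; split; lra.
have Es : 0 < f1 (sl b p t).
  rewrite [X in _ - f1 X](sl_co b p) D0 subr0 in E2; rewrite E2 mulr_gt0 ?subr_gt0//.
  by apply: pos; apply: near; apply/andP; split; lra.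
have : 0 < f (sl b p (co b p + r / 2)) - f p.
  by rewrite [X in _ - f X](sl_co b p) in E1; rewrite E1 mulr_gt0 ?subr_gt0.
rewrite subr_gt0 ltNge => /negP; apply; apply: fmax; apply: inO; apply: near.
by rewrite lexx ltW.
Qed.

Lemma closure_sq O M : (forall p, O p -> `|p.1| <= M /\ `|p.2| <= M) ->
  closure O `<=` sq M.
Proof. by move=> OM; rewrite closureE => p; apply; split=> //; exact: sq_closed. Qed.

Lemma closure_compact O M : (forall p, O p -> `|p.1| <= M /\ `|p.2| <= M) ->
  compact (closure O).
Proof.
move=> OM; apply: (subclosed_compact _ (@sq_compact R M)); first exact: closed_closure.
exact: closure_sq.
Qed.

(** The Laplacian is strictly positive, so a maximum over the compact closure cannot be interior,
    and no perturbation by a quadratic function is called for. *)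
Lemma max_principle O f : open O -> O !=set0 -> bounded_set2 O -> CC 2 O f ->
  {within closure O, continuous f} ->
  (forall p, O p -> 0 < pd true (pd true f) p + pd false (pd false f) p) ->
  (forall p, (closure O `\` O) p -> f p = 0) -> forall p, O p -> f p <= 0.
Proof.
move=> oO [p0 Op0] [M OM] Cf cf lap f0 p Op.
have cO := closure_compact OM.
have ne : closure O !=set0 by exists p0; exact: subset_closure.
have [c /set_mem Oc fc] := compact_EVT_max ne cO cf.
have fcO q : O q -> f q <= f c by move=> /(@subset_closure _ O)/mem_set/fc.
apply: le_trans (fcO _ Op) _.
have [Occ|nOc] := pselect (O c); last by rewrite f0.
have := lap c Occ.
have := second_derivative_max true oO Cf Occ fcO.
have := second_derivative_max false oO Cf Occ fcO.
move: (pd true _ _) (pd false _ _) => x y; lra.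
Qed.

Lemma lbounded_image O f : O !=set0 -> bounded_set2 O ->
  {within closure O, continuous f} -> has_inf [set f p | p in O].
Proof.
move=> [p0 Op0] [M OM] cf; split; first by exists (f p0), p0.
have ne : closure O !=set0 by exists p0; exact: subset_closure.
have [c _ fc] := compact_EVT_min ne (closure_compact OM) cf.
by exists (f c) => _ [p Op <-]; apply: fc; apply/mem_set/subset_closure.
Qed.

Lemma Ck_bar_bounded k O f : bounded_set2 O -> Ck_bar k O f ->
  exists2 C, 0 < C & forall p, O p -> `|f p| <= C.
Proof.
move=> [M OM] [_ H]; have [g [cg fg]] := H [::] isT.
have [C [_ HC]] := compact_bounded (continuous_compact cg (closure_compact OM)).
exists (`|C| + 1); first by rewrite ltr_wpDl.
move=> p Op; rewrite -[f p]/(pdw [::] f p) (fg p Op); apply: HC.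
  by rewrite (le_lt_trans (ler_norm C))// ltrDl.
by exists p => //; exact: subset_closure.
Qed.

End max_principle.

(** * Extension of the lower bound to the form domain *)

Section lower_H10.
Variable R : realType.
Local Notation P := (R * R)%type.
Local Notation mu := (@leb2 R).
Implicit Types (f g : P -> R) (p : P).
Variables (O : set P) (M : R).
Hypotheses (oO : open O) (OM : O `<=` sq M) (M0 : 0 < M).

Let mO : measurable (O : set (measurableTypeR R * measurableTypeR R)).
Proof. exact: open_measurable2. Qed.

Lemma L2_cs f : cs M f -> L2 O f.
Proof.
move=> Cf; have [cf f0] := Cf.
have mf : measurable_fun setT f := continuous_measurable2 cf.
have I : mu.-integrable setT (EFin \o (fun p => f p ^+ 2)).
  apply: (@cs_integrable _ M); split.
    have C0 : CC 0 setT f by split=> // p _; exact: cf.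
    by move=> p; exact: (CC_cont (CCX 2 C0)).
  by move=> p /f0 ->; rewrite expr0n.
split; first exact: measurable_funTS.
exact: (integrableS _ mO _ I).
Qed.

Lemma I2_on f : (forall p, ~ O p -> f p = 0) -> I2 f = Rintegral mu O f.
Proof.
move=> f0; rewrite /I2 [RHS]Rintegral_mkcond; apply: eq_Rintegral => p _.
by rewrite patchE; case: ifPn => //; rewrite notin_setE => /f0.
Qed.

Lemma Cc_inf_tf f : Cc_inf O f ->
  exists K, [/\ closed K, K `<=` O & forall n, tf K n f].
Proof.
move=> [sf [K [cK KO f0]]]; exists K; split=> //.
  by apply: compact_closed => //; exact: norm_hausdorff.
by move=> n; split=> //; exact: CC_of_smooth.
Qed.

Lemma tf_sub (K K' : set P) n f : K `<=` K' -> tf K n f -> tf K' n f.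
Proof. by move=> KK [Cf f0]; split=> // p nK; apply: f0 => /KK. Qed.

Lemma H10_cvg2 u u1 u2 : H10 O u u1 u2 -> exists phi : nat -> P -> R,
  [/\ forall n, Cc_inf O (phi n), cvg2 O phi u,
      cvg2 O (fun n => pd true (phi n)) u1 & cvg2 O (fun n => pd false (phi n)) u2].
Proof.
move=> [mu0 mu1 mu2 [phi [Cphi c0 c1 c2]]]; exists phi.
have T n : exists K, [/\ closed K, K `<=` sq M & tf K 1 (phi n)].
  have [K [cK KO tK]] := Cc_inf_tf (Cphi n); exists K; split=> //.
  by move=> p /KO/OM.
have X n : cs M (phi n) /\ forall u, cs M (pd u (phi n)).
  have [K [cK KM tK]] := T n; split; first exact: (tf_cs KM tK).
  by move=> u'; exact: (tf_cs KM (tf_pd cK u' tK)).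
split=> //.
- apply: L2_of_cvg0 c0 => //.
  + by move=> n; apply: L2_cs; case: (X n).
  + by move=> n; apply: continuous_measurable2; case: (X n) => -[].
- apply: L2_of_cvg0 c1 => //.
  + by move=> n; apply: L2_cs; case: (X n) => _; exact.
  + by move=> n; apply: continuous_measurable2; case: (X n) => _ /(_ true)[].
- apply: L2_of_cvg0 c2 => //.
  + by move=> n; apply: L2_cs; case: (X n) => _; exact.
  + by move=> n; apply: continuous_measurable2; case: (X n) => _ /(_ false)[].
Qed.

Lemma Rintegral_sqrD f g : mu.-integrable O (EFin \o f) -> L2 O g ->
  mu.-integrable O (EFin \o (fun p => f p + g p ^+ 2)) /\
  Rintegral mu O (fun p => f p + g p ^+ 2) = Rintegral mu O f + n2 O g.
Proof.
move=> If [_ Ig]; have [I E] := integrable_comb mO 1 1 If Ig.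
split; first by apply: eq_integrable I => // p _ /=; rewrite !mul1r.
by rewrite !mul1r in E; rewrite -E; apply: eq_Rintegral => p _; rewrite !mul1r.
Qed.

Variables (h m C : R) (A1 A2 B psi : P -> R).
Hypotheses (h0 : 0 < h) (C1 : CC 1 O A1) (C2 : CC 1 O A2) (CB : CC 0 O B)
  (Cpsi : CC 2 O psi)
  (curlA : forall p, O p -> pd true A2 p - pd false A1 p = B p)
  (lap : forall p, O p -> pd true (pd true psi) p + pd false (pd false psi) p = B p)
  (psi_le0 : forall p, O p -> psi p <= 0) (m_le : forall p, O p -> m <= psi p)
  (B0 : forall p, O p -> 0 < B p)
  (A1C : forall p, O p -> `|A1 p| <= C) (A2C : forall p, O p -> `|A2 p| <= C)
  (BC : forall p, O p -> B p <= C ^+ 2) (hC : h <= C).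

(** Squared norms of combinations with bounded coefficients are exactly what [cvg2_comb] and
    [cvg2_norm] pass to the limit. The constant h is one of the coefficients, which is why it has to
    be bounded by [C] as well. *)
Lemma kin_n2 a a1 a2 b b1 b2 :
  L2 O a -> L2 O a1 -> L2 O a2 -> L2 O b -> L2 O b1 -> L2 O b2 ->
  Rintegral mu O (kin h A1 A2 a a1 a2 b b1 b2) =
  n2 O (fun p => h * b1 p + - A1 p * a p) + n2 O (fun p => h * a1 p + A1 p * b p)
  + n2 O (fun p => h * b2 p + - A2 p * a p) + n2 O (fun p => h * a2 p + A2 p * b p).
Proof.
move=> La La1 La2 Lb Lb1 Lb2.
have C0 : 0 <= C by rewrite (le_trans _ hC)// ltW.
have mh : measurable_fun O (fun=> h) by exact: measurable_cst.
have hC' p : O p -> `|h| <= C by rewrite gtr0_norm.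
have mA (A : P -> R) : CC 1 O A -> measurable_fun O A.
  by move=> CA; apply: continuous_on_measurable => // p; exact: (CC_cont CA).
have mN (A : P -> R) : CC 1 O A -> measurable_fun O (fun p => - A p).
  by move=> CA; apply: mA; exact: CCN.
have NC (A : P -> R) : (forall p, O p -> `|A p| <= C) -> forall p, O p -> `|- A p| <= C.
  by move=> H p; rewrite normrN; exact: H.
have [L1 _] := L2_comb mO mh (mN _ C1) hC' (NC _ A1C) Lb1 La.
have [L2' _] := L2_comb mO mh (mA _ C1) hC' A1C La1 Lb.
have [L3 _] := L2_comb mO mh (mN _ C2) hC' (NC _ A2C) Lb2 La.
have [L4 _] := L2_comb mO mh (mA _ C2) hC' A2C La2 Lb.
have [_ I1] := L1.
have [I12 E12] := Rintegral_sqrD I1 L2'.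
have [I123 E123] := Rintegral_sqrD I12 L3.
have [_ E] := Rintegral_sqrD I123 L4.
rewrite [X in X + n2 O _](_ : _ = Rintegral mu O (fun p => (h * b1 p + - A1 p * a p) ^+ 2
  + (h * a1 p + A1 p * b p) ^+ 2 + (h * b2 p + - A2 p * a p) ^+ 2)).
  by rewrite -E; apply: eq_Rintegral => p _; rewrite /kin !mulNr.
by rewrite E123 E12.
Qed.

(** Positivity of [B] allows its square root as a multiplier, so that the potential term is a sum of
    squared norms too; hence the bound of [B] by C^2. The zero coefficients only fit both terms to
    the shape of [cvg2_comb]. *)
Lemma pot_n2 a b : L2 O a -> L2 O b ->
  Rintegral mu O (fun p => B p * mass a b p) =
  n2 O (fun p => Num.sqrt (B p) * a p + 0 * b p) + n2 O (fun p => 0 * a p + Num.sqrt (B p) * b p).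
Proof.
move=> La Lb.
have C0 : 0 <= C by rewrite (le_trans _ hC)// ltW.
have mz : measurable_fun O (fun=> 0 : R) by exact: measurable_cst.
have zC p : O p -> `|0 : R| <= C by rewrite normr0.
have mB : measurable_fun O (fun p => Num.sqrt (B p)).
  apply: continuous_on_measurable => // p Op; apply: continuous_comp.
    exact: (CC_cont CB).
  exact: sqrt_continuous.
have BC' p : O p -> `|Num.sqrt (B p)| <= C.
  move=> Op; rewrite ger0_norm ?sqrtr_ge0// -[C]ger0_norm// -sqrtr_sqr.
  by rewrite ler_wsqrtr// BC.
have [L1 _] := L2_comb mO mB mz BC' zC La Lb.
have [L2' _] := L2_comb mO mz mB zC BC' La Lb.
have [_ I1] := L1.
have [_ <-] := Rintegral_sqrD I1 L2'.
apply: eq_Rintegral => p /set_mem Op.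
rewrite /mass !mul0r addr0 add0r !exprMn sqr_sqrtr ?mulrDr//.
by rewrite ltW// B0.
Qed.

Lemma mass_n2 a b : L2 O a -> L2 O b ->
  Rintegral mu O (mass a b) = n2 O a + n2 O b.
Proof.
by move=> [_ Ia] Lb; have [_ E] := Rintegral_sqrD Ia Lb.
Qed.

(** Multiplied by the norm, the inequality is closed under convergence of the four squared norms of
    the kinetic term, the two of the potential and the two of the mass; it holds along the
    approximating test functions. *)
Lemma lower_H10 a a1 a2 b b1 b2 : H10 O a a1 a2 -> H10 O b b1 b2 ->
  fine (\int[mu]_(p in O) ((a p ^+ 2 + b p ^+ 2)%:E))%E != 0 ->
  h ^+ 2 / (4 * M ^+ 2) * expR (2 * m / h) <= pauli_rayleigh O h A1 A2 B a a1 a2 b b1 b2.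
Proof.
move=> /H10_cvg2[f [Cf cf cf1 cf2]] /H10_cvg2[g [Cg cg cg1 cg2]] nz.
rewrite /pauli_rayleigh.
rewrite -[fine (\int[mu]_(p in O) _)]/(Rintegral mu O (mass a b)) in nz *.
rewrite -[X in X - _]/(Rintegral mu O (kin h A1 A2 a a1 a2 b b1 b2)).
rewrite -[fine (\int[mu]_(p in O) _)]/(Rintegral mu O (fun p => B p * mass a b p)).
have n0 : 0 < Rintegral mu O (mass a b).
  by rewrite lt_neqAle eq_sym nz/= Rintegral_ge0// => p _; rewrite addr_ge0 ?sqr_ge0.
rewrite ler_pdivlMr//.
have C0 : 0 <= C by rewrite (le_trans _ hC)// ltW.
have mh : measurable_fun O (fun=> h) by exact: measurable_cst.
have hC' p : O p -> `|h| <= C by rewrite gtr0_norm.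
have mz : measurable_fun O (fun=> 0 : R) by exact: measurable_cst.
have zC p : O p -> `|0 : R| <= C by rewrite normr0.
have mA (A : P -> R) : CC 1 O A -> measurable_fun O A.
  by move=> CA; apply: continuous_on_measurable => // p; exact: (CC_cont CA).
have mN (A : P -> R) : CC 1 O A -> measurable_fun O (fun p => - A p).
  by move=> CA; apply: mA; exact: CCN.
have NC (A : P -> R) : (forall p, O p -> `|A p| <= C) -> forall p, O p -> `|- A p| <= C.
  by move=> H p; rewrite normrN; exact: H.
have mB : measurable_fun O (fun p => Num.sqrt (B p)).
  apply: continuous_on_measurable => // p Op; apply: continuous_comp.
    exact: (CC_cont CB).
  exact: sqrt_continuous.
have BC' p : O p -> `|Num.sqrt (B p)| <= C.
  move=> Op; rewrite ger0_norm ?sqrtr_ge0// -[C]ger0_norm// -sqrtr_sqr.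
  by rewrite ler_wsqrtr// BC.
have L u_ u : cvg2 O u_ u -> (forall n, L2 O (u_ n)) /\ L2 O u by case.
have [Lf La] := L _ _ cf; have [Lf1 La1] := L _ _ cf1; have [Lf2 La2] := L _ _ cf2.
have [Lg Lb] := L _ _ cg; have [Lg1 Lb1] := L _ _ cg1; have [Lg2 Lb2] := L _ _ cg2.
rewrite kin_n2// pot_n2// mass_n2//.
have K1 := cvg2_norm mO (cvg2_comb mO mh (mN _ C1) hC' (NC _ A1C) cg1 cf).
have K2 := cvg2_norm mO (cvg2_comb mO mh (mA _ C1) hC' A1C cf1 cg).
have K3 := cvg2_norm mO (cvg2_comb mO mh (mN _ C2) hC' (NC _ A2C) cg2 cf).
have K4 := cvg2_norm mO (cvg2_comb mO mh (mA _ C2) hC' A2C cf2 cg).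
have K5 := cvg2_norm mO (cvg2_comb mO mB mz BC' zC cf cg).
have K6 := cvg2_norm mO (cvg2_comb mO mz mB zC BC' cf cg).
have K7 := cvg2_norm mO cf; have K8 := cvg2_norm mO cg.
have LHS := cvgM (cvg_cst (h ^+ 2 / (4 * M ^+ 2) * expR (2 * m / h))) (cvgD K7 K8).
have RHS := cvgB (cvgD (cvgD (cvgD K1 K2) K3) K4) (cvgM (cvg_cst h) (cvgD K5 K6)).
apply: (ler_cvg_to (LHS _ _ _) (RHS _ _ _ _ _ _ _)); apply: nearW => n.
have [Kf [cKf KfO tf_]] := Cc_inf_tf (Cf n).
have [Kg [cKg KgO tg_]] := Cc_inf_tf (Cg n).
(* Real and imaginary parts are approximated independently, with different supports; the estimate on
   test functions is used on their union. *)
have cK : closed (Kf `|` Kg) by exact: closedU.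
have KO : Kf `|` Kg `<=` O by move=> p [/KfO|/KgO].
have KM : Kf `|` Kg `<=` sq M by move=> p /KO/OM.
have tf2 := tf_sub (@subsetUl _ Kf Kg) (tf_ 2).
have tg2 := tf_sub (@subsetUr _ Kf Kg) (tg_ 2).
have := lower_test oO cK KO KM M0 h0 C1 C2 CB Cpsi curlA lap psi_le0 m_le tf2 tg2.
have out k u p : tf (Kf `|` Kg) k u -> ~ O p -> u p = 0.
  by move=> t nO; apply: (tf0 t) => /KO.
have tm := tf_mass oO cK KO tf2 tg2.
have tB : tf (Kf `|` Kg) 0 (fun p => B p * mass (f n) (g n) p).
  by apply: (tfMl oO cK KO CB); exact: tfW (tfW tm).
have tk := tf_kin oO cK KO h (CCW C1) (CCW C2) (tfW tf2) (tfW tg2).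
rewrite !I2_on; [|by move=> p; exact: out tB|by move=> p; exact: out tk|by move=> p; exact: out tm].
by rewrite kin_n2// pot_n2// mass_n2.
Qed.

End lower_H10.

(** * Cutoff functions *)

Section cutoff.
Variable R : realType.
Local Notation P := (R * R)%type.
Implicit Types (f g : P -> R) (p : P).

Lemma is_derive_quadratic (f : R -> R) (C : R) :
  (forall t, `|f t| <= C * t ^+ 2) -> is_derive (0 : R) (1 : R) f 0.
Proof.
move=> fC.
have f0 : f 0 = 0.
  by apply/eqP; rewrite -normr_le0 (le_trans (fC 0))// expr0n mulr0.
have cv : (fun h : R => h^-1 *: ((f \o shift 0) (h *: 1) - f 0)) @ 0^' --> (0 : R).
  apply/cvgrPdist_le => e e0; near=> h.
  have h0 : h != 0 by near: h; exact: nbhs_dnbhs_neq.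
  rewrite sub0r normrN f0 subr0 /= addr0 /GRing.scale/= mulr1 normrM normfV.
  rewrite ler_pdivrMl ?normr_gt0//; apply: (le_trans (fC h)).
  rewrite -(real_normK (num_real h)) expr2 mulrA [leRHS]mulrC ler_wpM2r//.
  have : `|h| < e / (`|C| + 1).
    near: h; apply: dnbhs0_lt; rewrite divr_gt0// ltr_wpDl//.
  rewrite ltr_pdivlMr ?ltr_wpDl// => H.
  apply: le_trans (ltW H); rewrite mulrC ler_wpM2l// (le_trans (ler_norm C))// lerDl.
  exact: ler01.
apply: DeriveDef; first by apply/cvg_ex; exists 0.
exact/cvg_lim.
Unshelve. all: end_near. Qed.

(** The powers of 1/t make the family stable: the derivative of [flat k] is a combination of
    [flat k.+2] and [flat k.+1], so smoothness of exp (- 1/t) at 0 is an induction over the whole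
    family. *)
Definition flat (k : nat) (t : R) : R := if 0 < t then t^-1 ^+ k * expR (- t^-1) else 0.

Lemma flat_ge0 k t : 0 <= flat k t.
Proof.
rewrite /flat; case: ifPn => // t0; rewrite mulr_ge0 ?expR_ge0// exprn_ge0//.
by rewrite invr_ge0 ltW.
Qed.

(** With x = 1/t and K = k + 2, the constant K^K comes from (x / K)^K <= exp (x / K)^K = exp x. The
    two extra powers of t give derivative zero at the origin. *)
Lemma flat_quadratic k : exists C : R, forall t, `|flat k t| <= C * t ^+ 2.
Proof.
exists (k.+2%:R ^+ k.+2) => t; rewrite ger0_norm ?flat_ge0// /flat.
case: ifPn => [t0|_]; last by rewrite mulr_ge0 ?sqr_ge0// exprn_ge0.
set x := t^-1; have x0 : 0 < x by rewrite invr_gt0.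
have K0 : 0 < k.+2%:R :> R by [].
rewrite expRN ler_pdivrMr ?expR_gt0//.
have : (x / k.+2%:R) ^+ k.+2 <= expR x.
  have -> : expR x = expR (x / k.+2%:R) ^+ k.+2.
    by rewrite -expRM_natl mulrC divfK// gt_eqF.
  rewrite lerXn2r ?nnegrE ?expR_ge0 ?divr_ge0 ?ltW//.
  by apply: lt_le_trans (expR_ge1Dx _); rewrite ltrDr.
rewrite expr_div_n ler_pdivrMr ?exprn_gt0// => H.
have -> : k.+2%:R ^+ k.+2 * t ^+ 2 * expR x = expR x * k.+2%:R ^+ k.+2 / x ^+ 2.
  by rewrite exprVn invrK mulrAC [_ * expR x]mulrC.
by rewrite ler_pdivlMr ?exprn_gt0// -exprD addn2.
Qed.

Lemma flat_pos k t : 0 < t -> flat k t = t^-1 ^+ k * expR (- t^-1).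
Proof. by rewrite /flat => ->. Qed.

Lemma flat_neg k t : t <= 0 -> flat k t = 0.
Proof. by rewrite /flat leNgt => /negbTE ->. Qed.

Lemma is_derive_flat k t :
  is_derive t (1 : R) (flat k) (flat k.+2 t - k%:R * flat k.+1 t).
Proof.
have [t0|t0|->] := ltgtP t 0.
- rewrite !flat_neg ?ltW// mulr0 subr0.
  apply: (@near_eq_is_derive _ _ _ (cst 0)).
  near=> s; rewrite flat_neg//; apply: ltW; near: s; exact: lt_nbhsl.
- rewrite !flat_pos//.
  pose G : R -> R := fun t => t^-1 ^+ k * expR (- t^-1).
  have near_G : \near t, G t = flat k t.
    by near=> s; rewrite flat_pos//; near: s; exact: lt_nbhsr.
  apply: (near_eq_is_derive near_G).
  have tn : t != 0 by rewrite gt_eqF.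
  have D1 : is_derive t 1 (fun s : R => s^-1) (- t ^- 2).
    apply: is_derive_eq (is_deriveV tn (is_derive_id _ _)) _.
    by rewrite /GRing.scale/= mulr1.
  have D2 : is_derive t 1 (fun s : R => expR (- s^-1)) (expR (- t^-1) * (- - t ^- 2)).
    exact: (is_derive1_comp (is_derive_expR _) (is_deriveN D1)).
  have D3 := is_deriveX k D1; rewrite exprfctE in D3.
  have D4 := is_deriveM D3 D2; apply: (is_derive_eq D4).
  rewrite /GRing.scale/= opprK -exprVn.
  clear; case: k => [|k]; first by rewrite !mulr0n !mul0r; ring.
  by rewrite -mulr_natl !exprS /=; ring.
- rewrite !flat_neg// mulr0 subr0.
  by have [C HC] := flat_quadratic k; exact: is_derive_quadratic HC.
Unshelve. all: end_near. Qed.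

Lemma CC_flat n U F k : CC n U F -> CC n U (fun p => flat k (F p)).
Proof.
elim: n F k => [|n IH] F k CF.
  apply: CC0_comp => // p _; apply: differentiable_continuous.
  by apply/derivable1_diffP; have H := is_derive_flat k (F p); exact: ex_derive.
apply: (@CC_comp _ n U F (flat k) (fun t => flat k.+2 t - k%:R * flat k.+1 t)) => //.
  by move=> p _; exact: is_derive_flat.
apply: CCB; first exact: IH (CCW CF).
by apply: CCM; [exact: CC_cst|exact: IH (CCW CF)].
Qed.

Definition step (t : R) : R := flat 0 t / (flat 0 t + flat 0 (1 - t)).

Lemma step_den t : 0 < flat 0 t + flat 0 (1 - t).
Proof.
have [t0|t0] := ltP 0 t.
  by rewrite ltr_wpDr ?flat_ge0// flat_pos// mul1r expR_gt0.
by rewrite ltr_wpDl ?flat_ge0// flat_pos ?mul1r ?expR_gt0//; lra.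
Qed.

Lemma step0 t : t <= 0 -> step t = 0.
Proof. by move=> t0; rewrite /step flat_neg// mul0r. Qed.

Lemma step1 t : 1 <= t -> step t = 1.
Proof.
move=> t1; have := step_den t; rewrite /step (@flat_neg _ (1 - t)); last by lra.
by rewrite addr0 => H; rewrite divff// gt_eqF.
Qed.

Lemma step_itv t : 0 <= step t <= 1.
Proof.
rewrite divr_ge0 ?addr_ge0 ?flat_ge0//= ler_pdivrMr ?step_den// mul1r lerDl.
exact: flat_ge0.
Qed.

Lemma CC_step n U F : CC n U F -> CC n U (fun p => step (F p)).
Proof.
move=> CF; apply: CCM; first exact: CC_flat.
apply: CC_inv; first by move=> p _; rewrite gt_eqF// step_den.
apply: CCD; first exact: CC_flat.
by apply: CC_flat; apply: CCB => //; exact: CC_cst.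
Qed.

(** The argument is quadratic in p, which keeps the bump smooth at its centre; it equals 1 up to
    Euclidean distance r and 0 from distance r sqrt 2 on. *)
Definition cut (c : P) (r : R) (p : P) : R :=
  step (2 - ((p.1 - c.1) ^+ 2 + (p.2 - c.2) ^+ 2) / r ^+ 2).

Lemma CC_cut n c r : CC n setT (cut c r).
Proof.
apply: CC_step; apply: CCB; first exact: CC_cst.
apply: CCM; last exact: CC_cst.
by apply: CCD; apply: CCX; apply: CCB; (try exact: CC_cst);
  [exact: (CC_co n setT true)|exact: (CC_co n setT false)].
Qed.

Lemma cut1 c r p : 0 < r -> box c (r / 2) p -> cut c r p = 1.
Proof.
move=> r0 [h1 h2]; apply: step1.
have sq x : `|x| < r / 2 -> x ^+ 2 <= r ^+ 2 / 4.
  move=> xr; rewrite -(real_normK (num_real x)).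
  have -> : r ^+ 2 / 4 = (r / 2) ^+ 2 by field.
  by rewrite lerXn2r// ?nnegrE ?ltW// divr_gt0.
rewrite lerBrDr -lerBrDl ler_pdivrMr ?exprn_gt0//.
have := sq _ h1; have := sq _ h2; move: (_ ^+ 2) (_ ^+ 2) (r ^+ 2) (sqr_ge0 r) => x y z; lra.
Qed.

Lemma cut0 c r p : 0 < r -> ~ (`|p.1 - c.1| <= r * 2 /\ `|p.2 - c.2| <= r * 2) ->
  cut c r p = 0.
Proof.
move=> r0 H; apply: step0.
rewrite subr_le0 ler_pdivlMr ?exprn_gt0//.
have sq x : r * 2 < `|x| -> 2 * r ^+ 2 <= x ^+ 2.
  move=> xr; rewrite -(real_normK (num_real x)).
  have r2 : 0 <= r * 2 by lra.
  have : (r * 2) ^+ 2 <= `|x| ^+ 2 by rewrite lerXn2r ?nnegrE// ltW.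
  have := sqr_ge0 r; rewrite exprMn; lra.
have [h1|h1] := ltP (r * 2) `|p.1 - c.1|.
  by have := sq _ h1; have := sqr_ge0 (p.2 - c.2); lra.
have [h2|h2] := ltP (r * 2) `|p.2 - c.2|.
  by have := sq _ h2; have := sqr_ge0 (p.1 - c.1); lra.
by exfalso; apply: H.
Qed.

Lemma cbox_compact (c : P) (r : R) :
  compact [set p : P | `|p.1 - c.1| <= r /\ `|p.2 - c.2| <= r].
Proof.
rewrite (_ : [set p | _] = `[c.1 - r, c.1 + r] `*` `[c.2 - r, c.2 + r]).
  by apply: compact_setX; exact: segment_compact.
apply/seteqP; split=> p; rewrite /= !in_itv/= !ler_distl => -[? ?];
  by split; rewrite // addrC.
Qed.

(** The value 1 is required near each point of [K], not only on [K], so that the derivatives of chi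
    vanish there. *)
Lemma cutoff (O K : set P) : open O -> compact K -> K `<=` O ->
  exists chi : P -> R, [/\ Cc_inf O chi, forall p, 0 <= chi p <= 1 &
    forall p, K p -> \near p, chi p = 1].
Proof.
move=> oO cK KO.
have [r Hr] : {r : P -> R & forall c, 0 < r c /\
    (O c -> [set p : P | `|p.1 - c.1| <= r c * 2 /\ `|p.2 - c.2| <= r c * 2] `<=` O)}.
  apply: (@choice P R (fun c r => 0 < r /\
    (O c -> [set p : P | `|p.1 - c.1| <= r * 2 /\ `|p.2 - c.2| <= r * 2] `<=` O))) => c.
  have [Oc|nOc] := pselect (O c); last by exists 1; split.
  have [e e0 eO] := nbhs_box (open_nbhs_nbhs (conj oO Oc)).
  exists (e / 4); split; first by rewrite divr_gt0.
  by move=> _ p [p1 p2]; apply: eO; split; lra.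
have /(_ P O (fun c => box c (r c / 2))) [] : cover_compact K.
  have : @compact [the normedModType R of (R * R)%type] K by exact: cK.
  by rewrite compact_cover; exact.
- by move=> c _; exact: box_open.
- move=> p Kp; exists p; first exact: KO.
  have [r0 _] := Hr p; by split; rewrite subrr normr0 divr_gt0.
move=> D DO KD.
pose D' : seq P := finmap.enum_fset D.
(* The product over a finite subcover stays between 0 and 1, vanishes as soon as one bump equals 1
   and equals 1 off all the supports; its complement to 1 is the cutoff. *)
pose F p := \prod_(c <- D') (1 - cut c (r c) p).
have CF n : CC n setT F.
  by apply: CC_prod => c; apply: CCB; [exact: CC_cst|exact: CC_cut].
have F01 p : 0 <= F p <= 1.
  have H c : 0 <= 1 - cut c (r c) p <= 1.
    have /andP[] := step_itv (2 - ((p.1 - c.1) ^+ 2 + (p.2 - c.2) ^+ 2) / (r c) ^+ 2).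
    by rewrite -/(cut c (r c) p) => ? ?; apply/andP; split; lra.
  apply: (big_ind (fun x : R => 0 <= x <= 1)) => [|x y /andP[? ?] /andP[? ?]|c _].
  - by rewrite ler01 lexx.
  - by rewrite mulr_ge0//= mulr_ile1.
  - exact: H.
exists (fun p => 1 - F p); split.
- split.
    by apply: smooth_of_CC => n; apply: CCB; [exact: CC_cst|exact: CF].
  have : exists K', [/\ compact K', K' `<=` O & forall p, ~ K' p -> F p = 1].
    have DO' c : c \in D' -> O c by move=> /DO/set_mem.
    rewrite /F; elim: (D') DO' => [|c s IH] DO'.
      by exists set0; split=> //; [exact: compact0|move=> p _; rewrite big_nil].
    have [K' [cK' K'O H]] := IH (fun c cs => DO' c ltac:(by rewrite inE cs orbT)).
    have [r0 rO] := Hr c.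
    exists (K' `|` [set p : P | `|p.1 - c.1| <= r c * 2 /\ `|p.2 - c.2| <= r c * 2]).
    split.
    + by apply: compactU => //; exact: cbox_compact.
    + by move=> p [/K'O//|]; apply: rO; apply: DO'; rewrite inE eqxx.
    + move=> p /not_orP[nK' nb]; rewrite big_cons (H p nK') mulr1 cut0//.
      by rewrite subr0.
  move=> [K' [cK' K'O H]]; exists K'; split=> // p /H ->; exact: subrr.
- by move=> p; have /andP[? ?] := F01 p; apply/andP; split; lra.
- move=> p /KD[c /= cD pc].
  have [r0 _] := Hr c.
  have N : nbhs p (box c (r c / 2)).
    by apply: open_nbhs_nbhs; split=> //; exact: box_open.
  apply: filterS N => q /(cut1 r0) E.
  have -> : F q = 0.
    rewrite /F (big_rem c)//= E subrr mul0r//.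
  by rewrite subr0.
Qed.

End cutoff.

(** * Density of smooth test functions *)

Section bernstein.
Variable R : realType.
Local Notation P := (R * R)%type.
Implicit Types (f g : nat -> R) (s t : R).

(* The Bernstein operator [\sum_k 'C(n, k) s^k (1 - s)^(n - k) f k], computed
   along the first of [n] Bernoulli trials. *)
Fixpoint bern n s f : R :=
  if n is n'.+1 then s * bern n' s (fun k => f k.+1) + (1 - s) * bern n' s f
  else f 0%N.

Lemma bernD n s f g : bern n s (fun k => f k + g k) = bern n s f + bern n s g.
Proof. by elim: n f g => [|n IH] f g //=; rewrite !IH; ring. Qed.

Lemma bernZ n s (c : R) f : bern n s (fun k => c * f k) = c * bern n s f.
Proof. by elim: n f => [|n IH] f //=; rewrite !IH; ring. Qed.

Lemma bernB n s f g : bern n s (fun k => f k - g k) = bern n s f - bern n s g.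
Proof. by elim: n f g => [|n IH] f g //=; rewrite !IH; ring. Qed.

Lemma bern_cst n s (c : R) : bern n s (fun=> c) = c.
Proof. by elim: n => [|n IH] //=; rewrite IH; ring. Qed.

Lemma bern_le n s f g : 0 <= s <= 1 -> (forall k, (k <= n)%N -> f k <= g k) ->
  bern n s f <= bern n s g.
Proof.
move=> /andP[s0 s1]; elim: n f g => [|n IH] f g fg /=; first exact: fg.
apply: lerD; apply: ler_wpM2l; rewrite ?subr_ge0//; apply: IH => k kn; apply: fg => //.
exact: leqW.
Qed.

Lemma bern_id n s : bern n s (fun k => k%:R) = n%:R * s.
Proof.
elim: n => [|n IH] /=; first by rewrite mul0r.
under [X in bern _ _ X]eq_fun do rewrite -natr1.
by rewrite bernD IH bern_cst -natr1; ring.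
Qed.

Lemma bern_sqr n s :
  bern n s (fun k => k%:R ^+ 2) = n%:R * s * (1 - s) + (n%:R * s) ^+ 2.
Proof.
elim: n => [|n IH] /=; first by rewrite !mul0r expr0n addr0.
rewrite (_ : (fun k : nat => k.+1%:R ^+ 2) = fun k : nat => k%:R ^+ 2 + (2 * k%:R + 1)).
  by rewrite bernD bernD bernZ bern_id bern_cst IH -natr1; ring.
by apply/funext => k; rewrite -natr1; ring.
Qed.

Lemma bern_var n s : 0 <= s <= 1 -> (0 < n)%N ->
  bern n s (fun k => (k%:R / n%:R - s) ^+ 2) <= (4 * n%:R)^-1.
Proof.
move=> /andP[s0 s1] n0; have nR : 0 < n%:R :> R by rewrite ltr0n.
have -> : bern n s (fun k => (k%:R / n%:R - s) ^+ 2) = s * (1 - s) / n%:R.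
  rewrite (_ : (fun k : nat => _) = fun k : nat => (n%:R ^- 2) * k%:R ^+ 2 +
      ((- 2 * s / n%:R) * k%:R + s ^+ 2)).
    by rewrite bernD bernD !bernZ bern_id bern_sqr bern_cst; field; rewrite gt_eqF.
  by apply/funext => k; field; rewrite gt_eqF.
rewrite invfM ler_pM2r ?invr_gt0//.
have := sqr_ge0 (s - 2^-1); lra.
Qed.

(** Chebyshev's argument: a majorant quadratic in the deviations of the two frequencies is averaged
    by the operator into the two variances, each at most 1/4 divided by the number of trials. *)
Lemma bern2_approx n m s t (F : nat -> nat -> R) (c A Q : R) :
  0 <= s <= 1 -> 0 <= t <= 1 -> (0 < n)%N -> (0 < m)%N -> 0 <= Q ->
  (forall k l, (k <= n)%N -> (l <= m)%N ->
    `|F k l - c| <= A + Q * ((k%:R / n%:R - s) ^+ 2 + (l%:R / m%:R - t) ^+ 2)) ->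
  `|bern n s (fun k => bern m t (F k)) - c| <= A + Q * ((4 * n%:R)^-1 + (4 * m%:R)^-1).
Proof.
move=> s01 t01 n0 m0 Q0 H.
have V : bern n s (fun k => bern m t (fun l =>
    A + Q * ((k%:R / n%:R - s) ^+ 2 + (l%:R / m%:R - t) ^+ 2))) <=
    A + Q * ((4 * n%:R)^-1 + (4 * m%:R)^-1).
  have -> : (fun k : nat => bern m t (fun l =>
      A + Q * ((k%:R / n%:R - s) ^+ 2 + (l%:R / m%:R - t) ^+ 2))) =
    fun k : nat => A + Q * ((k%:R / n%:R - s) ^+ 2 + bern m t (fun l => (l%:R / m%:R - t) ^+ 2)).
    by apply/funext => k; rewrite bernD bern_cst bernZ bernD bern_cst.
  rewrite bernD bern_cst bernZ bernD bern_cst lerD2l ler_wpM2l// lerD//; exact: bern_var.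
rewrite ler_distl; apply/andP; split.
- rewrite lerBlDr -lerBlDl; apply: le_trans V.
  rewrite -[X in X - _](bern_cst n s c) -bernB; apply: bern_le => // k kn.
  rewrite -[X in X - _](bern_cst m t c) -bernB; apply: bern_le => // l lm.
  by rewrite -[leLHS]opprB lerNl; have := H k l kn lm; rewrite ler_norml => /andP[].
- rewrite -lerBlDl; apply: le_trans V.
  rewrite -[X in _ - X](bern_cst n s c) -bernB; apply: bern_le => // k kn.
  rewrite -[X in _ - X](bern_cst m t c) -bernB; apply: bern_le => // l lm.
  by have := H k l kn lm; rewrite ler_norml => /andP[].
Qed.

Lemma bern_comm n m s t (F : nat -> nat -> R) :
  bern n s (fun k => bern m t (F k)) = bern m t (fun l => bern n s (fun k => F k l)).
Proof.
elim: n F => [|n IH] F //=.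
by rewrite bernD !bernZ (IH (fun k => F k.+1)) IH.
Qed.

Lemma CC_bern r (U : set P) n (S : P -> R) (F : nat -> P -> R) :
  CC r U S -> (forall k, CC r U (F k)) ->
  CC r U (fun q => bern n (S q) (fun k => F k q)).
Proof.
move=> CS; elim: n F => [|n IH] F CF /=; first exact: CF.
apply: CCD; apply: CCM => //.
- by apply: (IH (fun k => F k.+1)) => k; exact: CF.
- by apply: CCB => //; exact: CC_cst.
- exact: IH.
Qed.

(** The classical formula: the derivative of a Bernstein operator of degree n + 1 is n + 1 times the
    operator of degree n on first differences. The [F k] may depend on the other coordinate, whence
    the condition that only their derivative along [b] vanishes. *)
Lemma isd_bern b n (S : P -> R) (F : nat -> P -> R) (p : P) (l : R) :
  isd b S p l -> (forall k, isd b (F k) p 0) ->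
  isd b (fun q => bern n.+1 (S q) (fun k => F k q)) p
    (n.+1%:R * bern n (S p) (fun k => F k.+1 p - F k p) * l).
Proof.
move=> dS; elim: n F => [|n IH] F dF.
  apply: isd_eq.
    exact: (isdD (isdM dS (dF 1%N)) (isdM (isdD (isd_cst b 1 p) (isdN dS)) (dF 0%N))).
  by rewrite /=; ring.
have D1 := IH (fun k => F k.+1) (fun k => dF k.+1).
have D0 := IH F dF.
apply: isd_eq.
  exact: (isdD (isdM dS D1) (isdM (isdD (isd_cst b 1 p) (isdN dS)) D0)).
rewrite -[n.+2%:R]natr1 !bernB /=.
move: (bern n _ _) (bern n _ _) (bern n _ _) => x y z.
by move: (n.+1%:R) => w; ring.
Qed.

End bernstein.

(** * Polynomial approximation of functions and their gradients on a square *)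

Section bernstein_approximation.
Variable R : realType.
Local Notation P := (R * R)%type.
Implicit Types (f g u : P -> R) (p q : P).
Variables (K : set P) (M : R).
Hypotheses (cK : closed K) (KM : K `<=` sq M) (M0 : 0 < M).

Lemma tf_lipschitz g : tf K 1 g -> exists2 L, 0 <= L &
  forall p q, `|g p - g q| <= L * (`|p.1 - q.1| + `|p.2 - q.2|).
Proof.
move=> tg.
have [L1 L10 H1] := cs_bounded (tf_cs KM (tf_pd cK true tg)).
have [L2 L20 H2] := cs_bounded (tf_cs KM (tf_pd cK false tg)).
have line b L p s t : (forall q, `|pd b g q| <= L) ->
    `|g (sl b p s) - g (sl b p t)| <= L * `|s - t|.
  move=> HL; have L0 : 0 <= L by exact: le_trans (HL p).
  wlog st : s t / s < t.
    move=> H; have [st|ts|->] := ltgtP s t; first exact: H.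
      by rewrite distrC [`|s - t|]distrC; exact: H.
    by rewrite !subrr normr0 mulr0.
  have [c _ E] := mvt_line st (fun c _ => tf_isd b (sl b p c) tg).
  rewrite distrC E normrM [`|s - t|]distrC ler_wpM2r//; exact: HL.
exists (L1 + L2); first exact: addr_ge0.
move=> [p1 p2] [q1 q2] /=.
apply: (le_trans (ler_distD (g (q1, p2)) _ _)).
have h1 := line true L1 (p1, p2) p1 q1 H1.
have h2 := line false L2 (q1, p2) p2 q2 H2.
rewrite /= in h1 h2; apply: (le_trans (lerD h1 h2)).
rewrite mulrDl; apply: lerD; rewrite ler_wpM2l// ?lerDl ?lerDr//.
Qed.

Let node (N k : nat) : R := - M + 2 * M * (k%:R / N%:R).
Let coord (x : R) : R := (x + M) / (2 * M).
Definition pt b (x y : R) : P := if b then (x, y) else (y, x).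

Let coord_itv x : `|x| <= M -> 0 <= coord x <= 1.
Proof.
rewrite ler_norml => /andP[? ?]; rewrite /coord; apply/andP; split.
  by apply: divr_ge0; lra.
by rewrite ler_pdivrMr ?mulr_gt0//; lra.
Qed.

Let node_dist N k x : node N k - x = 2 * M * (k%:R / N%:R - coord x).
Proof. by rewrite /node /coord; move: (k%:R / N%:R) => z; field; rewrite gt_eqF. Qed.

Let node_norm N k x : `|node N k - x| = 2 * M * `|k%:R / N%:R - coord x|.
Proof. by rewrite node_dist normrM gtr0_norm// mulr_gt0. Qed.

Definition bernP N u q : R := bern N (coord q.1) (fun k => bern N (coord q.2)
  (fun l => u (node N k, node N l))).

(** The operators in the two variables commute, so either coordinate can be made the outer one
    before differentiating along it. *)
Lemma bernPE b N u q : bernP N u q = bern N (coord (co b q)) (fun k =>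
  bern N (coord (co (~~ b) q)) (fun l => u (pt b (node N k) (node N l)))).
Proof. by case: b; rewrite /bernP //= bern_comm. Qed.

Let CC_coord r U b : CC r U (fun q => coord (co b q)).
Proof.
apply: CCM; last exact: CC_cst.
by apply: CCD; [exact: CC_co|exact: CC_cst].
Qed.

Lemma CC_bernP r U N u : CC r U (bernP N u).
Proof.
apply: (CC_bern N (CC_coord r U true)) => k; apply: (CC_bern N (CC_coord r U false)) => l.
exact: CC_cst.
Qed.

Let isd_coord b q : isd b (fun q => coord (co b q)) q (2 * M)^-1.
Proof.
apply: isd_eq.
  exact: (isdM (isdD (isd_co b b q) (isd_cst b M q)) (isd_cst b (2 * M)^-1 q)).
by rewrite eqxx addr0 mulr0 addr0 mul1r.
Qed.

Lemma isd_bernP b n u q : isd b (bernP n.+1 u) q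
  (bern n (coord (co b q)) (fun k => bern n.+1 (coord (co (~~ b) q)) (fun l =>
    (n.+1%:R / (2 * M)) * (u (pt b (node n.+1 k.+1) (node n.+1 l))
                         - u (pt b (node n.+1 k) (node n.+1 l)))))).
Proof.
rewrite (_ : bernP n.+1 u = fun q => bern n.+1 (coord (co b q)) (fun k =>
  bern n.+1 (coord (co (~~ b) q)) (fun l => u (pt b (node n.+1 k) (node n.+1 l))))).
  apply: isd_eq.
    apply: (@isd_bern _ b n (fun q => coord (co b q)) (fun k q =>
      bern n.+1 (coord (co (~~ b) q)) (fun l => u (pt b (node n.+1 k) (node n.+1 l))))).
      exact: isd_coord.
    move=> k; rewrite /isd /=; case: (b) => /=; exact: is_derive_cst.
  rewrite (_ : (fun k => bern n.+1 _ (fun l => _ * _)) = fun k => (n.+1%:R / (2 * M)) *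
      (bern n.+1 (coord (co (~~ b) q)) (fun l => u (pt b (node n.+1 k.+1) (node n.+1 l)))
     - bern n.+1 (coord (co (~~ b) q)) (fun l => u (pt b (node n.+1 k) (node n.+1 l))))).
    by rewrite bernZ; move: (bern _ _ _) (n.+1%:R) ((2 * M)^-1) => x y z; ring.
  by apply/funext => k; rewrite bernZ bernB.
by apply/funext => q'; exact: bernPE.
Qed.

Let amgm (eta x : R) : 0 < eta -> `|x| <= eta + x ^+ 2 / (4 * eta).
Proof.
move=> e0; have := sqr_ge0 (2 * eta - `|x|).
rewrite -(real_normK (num_real x)); move: `|x| => y H.
rewrite -lerBlDl ler_pdivlMr ?mulr_gt0//; lra.
Qed.

(** Two derivatives of [u] give Lipschitz bounds for [u] and its gradient, with which [bern2_approx]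
    is explicit. The gradient of the polynomial averages difference quotients of [u] at the nodes,
    and these are values of the gradient of [u] nearby. *)
Lemma bernP_approx u (e : R) : tf K 2 u -> 0 < e -> exists p : P -> R,
  [/\ forall n, CC n setT p, forall q, sq M q -> `|p q - u q| <= e &
   forall q b, sq M q -> `|pd b p q - pd b u q| <= e].
Proof.
move=> tu e0.
have q3 : e / 4 + (e / 4 + e / 4) <= e by lra.
have q4 : e / 4 + e / 4 + (e / 4 + e / 4) <= e by lra.
have [L0 L00 H0] := tf_lipschitz (tfW tu).
have [L1 L10 H1] := tf_lipschitz (tf_pd cK true tu).
have [L2 L20 H2] := tf_lipschitz (tf_pd cK false tu).
pose L := L0 + L1 + L2 + 1.
have L_ge L' : L' \in [:: L0; L1; L2] -> 0 <= L' <= L.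
  by rewrite !inE /L => /or3P[] /eqP ->; apply/andP; split=> //; lra.
have Lpos : 0 < L by rewrite /L; lra.
have HL g L' : L' \in [:: L0; L1; L2] ->
    (forall p q, `|g p - g q| <= L' * (`|p.1 - q.1| + `|p.2 - q.2|)) ->
    forall b p q, `|g p - g q| <= L * (`|co b p - co b q| + `|co (~~ b) p - co (~~ b) q|).
  move=> /L_ge/andP[_ LL] H b p q; apply: (le_trans (H p q)).
  have -> : `|p.1 - q.1| + `|p.2 - q.2| = `|co b p - co b q| + `|co (~~ b) p - co (~~ b) q|.
    by case: b => //=; rewrite addrC.
  by rewrite ler_wpM2r// addr_ge0.
have Hu := HL u L0 ltac:(by rewrite inE eqxx) H0.
have Hpd b' : forall b p q, `|pd b' u p - pd b' u q| <=
    L * (`|co b p - co b q| + `|co (~~ b) p - co (~~ b) q|).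
  have m1 : L1 \in [:: L0; L1; L2] by rewrite !inE eqxx orbT.
  have m2 : L2 \in [:: L0; L1; L2] by rewrite !inE eqxx !orbT.
  by case: b'; [exact: HL m1 H1|exact: HL m2 H2].
(* By [amgm] a linear deviation |x| is at most eta + x^2 / (4 eta). This [eta] makes the constant
   part of the error e / 4, and [Q] is the coefficient left on the squares. *)
pose eta := e / (16 * M * L).
have eta0 : 0 < eta by rewrite divr_gt0// !mulr_gt0.
pose Q := L * (2 * M) / (4 * eta).
have M2 : 0 < 2 * M by rewrite mulr_gt0.
have LM2 : 0 < L * (2 * M) by rewrite mulr_gt0.
have eta4 : 0 < 4 * eta by rewrite mulr_gt0.
have Q0 : 0 <= Q by apply/ltW; rewrite divr_gt0.
(* The degree makes each variance term, and the error due to the mesh size 2 M / n, at most e /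
   4. *)
have [n nbig] : exists n, [/\ (0 < n)%N, Q * (4 * n%:R)^-1 <= e / 4 &
    L * (2 * M / n%:R) <= e / 4].
  pose X := 4 * (Q + L * (2 * M)) / e.
  have X0 : 0 < X by rewrite divr_gt0// mulr_gt0// ltr_wpDl.
  pose n := (Num.truncn X).+1.
  have Xn : X <= n%:R := ltW (truncnS_gt X).
  exists n.
  have nR : 0 < n%:R :> R by rewrite ltr0n.
  have LM := ltW LM2.
  move: Xn; rewrite ler_pdivrMr// => Xn; split=> //.
    rewrite ler_pdivrMr ?mulr_gt0//; move: (L * (2 * M)) LM Xn => z z0 Xn.
    have := mulr_ge0 (ltW nR) (ltW e0); lra.
  by rewrite mulrA ler_pdivrMr//; lra.
case: nbig => n0 nb1 nb2.
have nR : 0 < n%:R :> R by rewrite ltr0n.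
have nb1' : Q * (4 * n.+1%:R)^-1 <= e / 4.
  apply: le_trans nb1; rewrite ler_wpM2l// lef_pV2 ?posrE ?mulr_gt0// ler_pM2l// ler_nat//.
have nb2' : L * (2 * M / n.+1%:R) <= e / 4.
  apply: le_trans nb2; apply: ler_wpM2l; first exact: ltW.
  apply: ler_wpM2l; first exact: ltW.
  by rewrite lef_pV2 ?posrE// ler_nat.
have Leta : L * (4 * M * eta) = e / 4.
  by rewrite /eta; field; rewrite !gt_eqF.
have key (d x y : R) : L * (d + 2 * M * `|x| + 2 * M * `|y|) <=
    L * d + L * (4 * M * eta) + Q * (x ^+ 2 + y ^+ 2).
  have hx := amgm x eta0; have hy := amgm y eta0.
  have -> : L * d + L * (4 * M * eta) + Q * (x ^+ 2 + y ^+ 2) =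
    L * (d + 2 * M * (eta + x ^+ 2 / (4 * eta)) + 2 * M * (eta + y ^+ 2 / (4 * eta))).
    by rewrite /Q; field; rewrite gt_eqF.
  rewrite ler_pM2l// !lerD// ler_pM2l// mulr_gt0//.
have sq_co b q : sq M q -> `|co b q| <= M by case: b => -[].
exists (bernP n.+1 u); split.
- by move=> r; exact: CC_bernP.
- move=> q Mq; rewrite (bernPE true).
  apply: (le_trans (bern2_approx (coord_itv (sq_co true q Mq)) (coord_itv (sq_co false q Mq))
    (ltn0Sn n) (ltn0Sn n) Q0 (A := L * (4 * M * eta)) _)).
    move=> k l _ _; apply: (le_trans (Hu true _ _)).
    rewrite /= !node_norm.
    by have := key 0 (k%:R / n.+1%:R - coord q.1) (l%:R / n.+1%:R - coord q.2);
      rewrite mulr0 !add0r; apply: le_trans.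
  by rewrite Leta mulrDr; exact: (le_trans (lerD (lexx _) (lerD nb1' nb1')) q3).
- move=> q b Mq; have [_ ->] := isd_pd (isd_bernP b n u q).
  apply: (le_trans (bern2_approx (coord_itv (sq_co b q Mq)) (coord_itv (sq_co (~~ b) q Mq))
    n0 (ltn0Sn n) Q0 (A := L * (2 * M / n.+1%:R) + L * (4 * M * eta)) _)).
    move=> k l kn _.
    have sR : 0 < n.+1%:R :> R by rewrite ltr0n.
    have Enode : node n.+1 k.+1 - node n.+1 k = 2 * M / n.+1%:R.
      by rewrite /node -[k.+1%:R]natr1; field; rewrite gt_eqF.
    have node_lt : node n.+1 k < node n.+1 k.+1.
      by rewrite -subr_gt0 Enode divr_gt0// mulr_gt0.
    (* The difference quotient between consecutive nodes is the partial derivative of [u] at an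
       intermediate point [c]. *)
    have [c /andP[c1 c2] E] := mvt_line node_lt
      (fun c _ => tf_isd b (sl b (pt b 0 (node n.+1 l)) c) tu).
    have slpt x : sl b (pt b 0 (node n.+1 l)) x = pt b x (node n.+1 l) by case: (b).
    rewrite !slpt Enode in E; rewrite E.
    rewrite (_ : n.+1%:R / (2 * M) * _ = pd b u (pt b c (node n.+1 l))); last first.
      by move: (pd b u _) => z; field; rewrite !gt_eqF.
    apply: (le_trans (Hpd b b _ _)).
    have -> : co b (pt b c (node n.+1 l)) = c by case: (b).
    have -> : co (~~ b) (pt b c (node n.+1 l)) = node n.+1 l by case: (b).
    apply: le_trans (key _ _ _); rewrite ler_pM2l//.
    rewrite [X in _ + X <= _]node_norm.
    rewrite lerD2r.
    (* After differentiation the outer operator has degree n, but the nodes are those of degree n +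
       1. Since k <= n, the fraction k / n lies between k / (n + 1) and (k + 1) / (n + 1), hence
       within one mesh of [c]. *)
    have n1 : node n.+1 k <= node n k.
      rewrite /node lerD2l ler_pM2l ?mulr_gt0// ler_wpM2l// lef_pV2 ?posrE// ler_nat//.
    have n2' : node n k <= node n.+1 k.+1.
      rewrite /node lerD2l ler_pM2l ?mulr_gt0// ler_pdivrMr// mulrAC ler_pdivlMr//.
      by rewrite -!natrM ler_nat mulnS mulSn leq_add2r.
    have : `|c - node n k| <= 2 * M / n.+1%:R.
      rewrite -Enode; move: n1 n2' c1 c2; clear.
      move: (node _ _) (node _ _) (node _ _) => x y z ? ? ? ?.
      by rewrite ler_norml; apply/andP; split; lra.
    have := ler_distD (node n k) c (co b q).
    rewrite [X in _ <= _ + X]node_norm.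
    by move=> H2' H1'; exact: (le_trans H2' (lerD H1' (lexx _))).
  rewrite Leta mulrDr.
  by exact: (le_trans (lerD (lerD nb2' (lexx _)) (lerD nb1 nb1')) q4).
Qed.

End bernstein_approximation.

(** * Compactly supported C^2 functions belong to the form domain *)

Section density.
Variable R : realType.
Local Notation P := (R * R)%type.
Local Notation mu := (@leb2 R).
Implicit Types (f g u : P -> R) (p q : P).

Lemma cs0 (M : R) f p : cs M f -> ~ sq M p -> f p = 0.
Proof. by move=> [_ f0]; exact: f0. Qed.

Lemma cvg0_sup (M : R) (f_ : nat -> P -> R) (c_ : nat -> R) :
  (forall n, continuous (f_ n)) -> (forall n p, ~ sq M p -> f_ n p = 0) ->
  (forall n p, `|f_ n p| <= c_ n) -> c_ n @[n --> \oo] --> 0 ->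
  (fun n => \int[mu]_(p in setT) ((f_ n p ^+ 2)%:E))%E @ \oo --> 0%E.
Proof.
move=> cf f0 fc c0.
have cs2 n : cs M (fun p => f_ n p ^+ 2).
  split; last by move=> p /f0 ->; rewrite expr0n.
  have C0 : CC 0 setT (f_ n) by split=> // p _; exact: cf.
  by move=> p; exact: (CC_cont (CCX 2 C0)).
pose ind : P -> R := \1_(sq M).
have Iind : mu.-integrable setT (EFin \o ind).
  apply: (@bounded_sq_integrable _ M _ 1).
  - apply: measurable_indic; exact: sq_measurable.
  - by move=> p; rewrite /ind indicE; case: (_ \in _); rewrite ?normr1 ?normr0.
  - by move=> p nM; rewrite /ind indicE memNset.
have E n : (\int[mu]_(p in setT) ((f_ n p ^+ 2)%:E))%E = (I2 (fun p => f_ n p ^+ 2))%:E.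
  rewrite /I2 /Rintegral fineK//; apply: integrable_fin_num => //.
  exact: (cs_integrable (cs2 n)).
rewrite (_ : (fun n => _) = fun n => (I2 (fun p => f_ n p ^+ 2))%:E); last exact/funext.
apply: cvg_EFin; first exact: nearW.
apply: (@squeeze_cvgr _ _ _ _ (fun=> 0) (fun n => (c_ n * c_ n) * I2 ind)).
- apply: nearW => n; apply/andP; split.
    by apply: Rintegral_ge0 => p _; exact: sqr_ge0.
  have IZ : mu.-integrable setT (EFin \o (fun p => (c_ n * c_ n) * ind p)).
    have := @integrableZl _ _ _ mu setT _ (c_ n * c_ n) _ Iind.
    by move=> /(_ measurableT); apply: eq_integrable => // p _; rewrite /= EFinM.
  rewrite -I2Z//; apply: I2_le => //; first exact: cs_integrable (cs2 n).
  move=> p; rewrite /ind indicE; have [pM|pM] := pselect (sq M p).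
    rewrite mem_set// mulr1 -(real_normK (num_real (f_ n p))) -expr2.
    by rewrite lerXn2r ?nnegrE//; exact: le_trans (fc n p).
  by rewrite memNset// mulr0 f0// expr0n.
- exact: cvg_cst.
- have := cvgM (cvgM c0 c0) (cvg_cst (I2 ind)).
  by rewrite mul0r mul0r; exact.
Qed.

(** The approximants are a smooth cutoff, equal to 1 near [K], times Bernstein polynomials: the
    polynomials bring smoothness, the cutoff compact support inside [O], and uniform convergence in
    a bounded square implies convergence in the mean. *)
Lemma tf_H10 (O K : set P) (M : R) u : open O -> O `<=` sq M -> 0 < M ->
  compact K -> K `<=` O -> tf K 2 u -> H10 O u (pd true u) (pd false u).
Proof.
move=> oO OM M0 cK KO tu.
have clK : closed K by apply: compact_closed => //; exact: norm_hausdorff.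
have KM : K `<=` sq M by move=> p /KO/OM.
have [chi [Cchi chi01 chi1]] := cutoff oO cK KO.
have [K' [clK' K'O tchi]] := Cc_inf_tf Cchi.
have K'M : K' `<=` sq M by move=> p /K'O/OM.
have [C C0 HC] : exists2 C, 0 <= C & forall b q, `|pd b chi q| <= C.
  have [C1 C10 H1] := cs_bounded (tf_cs K'M (tf_pd clK' true (tchi 1))).
  have [C2 C20 H2] := cs_bounded (tf_cs K'M (tf_pd clK' false (tchi 1))).
  exists (C1 + C2); first exact: addr_ge0.
  by case=> q; [apply: (le_trans (H1 q))|apply: (le_trans (H2 q))]; rewrite ?lerDl ?lerDr.
have e0 (n : nat) : 0 < n.+1%:R^-1 :> R by rewrite invr_gt0.
have [pn Hpn] := choice (fun n => bernP_approx clK KM M0 tu (e0 n)).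
pose phi n q := chi q * pn n q.
have Cphi r n : tf K' r (phi n).
  have [Cp _ _] := Hpn n; have [Cc c0] := tchi r.
  by split; [exact: CCM|move=> q /c0; rewrite /phi => ->; rewrite mul0r].
have dphi b n q : pd b (phi n) q = pd b chi q * pn n q + chi q * pd b (pn n) q.
  have [Cp _ _] := Hpn n.
  have [dp _] := CC_pd b openT (Cp 1%N).
  by have [_] := isd_pd (isdM (tf_isd b q (tchi 1)) (dp q I)).
have chiu q : chi q * u q = u q.
  have [Kq|nKq] := pselect (K q); last by rewrite (tf0 tu nKq) mulr0.
  by rewrite (nbhs_singleton (chi1 q Kq)) mul1r.
have chidu b q : chi q * pd b u q = pd b u q /\ pd b chi q * u q = 0.
  have [Kq|nKq] := pselect (K q); last first.
    by rewrite (tf0 tu nKq) (tf0 (tf_pd clK b tu) nKq) !mulr0.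
  rewrite (nbhs_singleton (chi1 q Kq)) mul1r; split=> //.
  suff -> : pd b chi q = 0 by rewrite mul0r.
  apply: (isd_uniq (tf_isd b q (tchi 1))).
  apply: (@isd_near _ b (fun=> 1)); last exact: isd_cst.
  by have := chi1 q Kq; apply: filterS => q' ->.
have chin q : `|chi q| <= 1.
  by have /andP[? ?] := chi01 q; rewrite ger0_norm.
have cu : continuous u by have [] := tf_cs KM tu.
have cdu b : continuous (pd b u) by have [] := tf_cs KM (tf_pd clK b tu).
have cphi n : continuous (phi n) by have [] := tf_cs K'M (Cphi 0%N n).
have cdphi b n : continuous (pd b (phi n)) by have [] := tf_cs K'M (tf_pd clK' b (Cphi 1%N n)).
have lim0 : ((C + 1) * n.+1%:R^-1) @[n --> \oo] --> (0 : R).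
  have := cvgM (@cvg_cst _ (C + 1) _ \oo _) (@cvg_harmonic R).
  by rewrite mulr0; exact.
have grad b : (fun n => \int[mu]_(p in setT) (((pd b (phi n) p - pd b u p) ^+ 2)%:E))%E
    @ \oo --> 0%E.
  apply: (@cvg0_sup M (fun n p => pd b (phi n) p - pd b u p) (fun n => (C + 1) * n.+1%:R^-1)) => //.
  - by move=> n p; apply: cvgB; [exact: cdphi|exact: cdu].
  - move=> n p nM.
    by rewrite (cs0 (tf_cs K'M (tf_pd clK' b (Cphi 1%N n))) nM) (cs0 (tf_cs KM (tf_pd clK b tu)) nM) subrr.
  - move=> n q; have [Mq|nM] := pselect (sq M q); last first.
      rewrite (cs0 (tf_cs K'M (tf_pd clK' b (Cphi 1%N n))) nM) (cs0 (tf_cs KM (tf_pd clK b tu)) nM) subrr.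
      by rewrite normr0 mulr_ge0 ?addr_ge0 ?invr_ge0.
    have [_ H1 H2] := Hpn n; have [E1 E2] := chidu b q.
    (* As chi u = u and (d chi) u = 0, both terms of the product rule are errors of the polynomial
       approximation; this gives the rate (C + 1) / (n + 1). *)
    have -> : pd b (phi n) q - pd b u q =
        pd b chi q * (pn n q - u q) + chi q * (pd b (pn n) q - pd b u q).
      rewrite dphi !mulrBr E1 E2 subr0.
      by move: (pd b chi q) (pd b (pn n) q) (pd b u q) => x y z; ring.
    apply: (le_trans (ler_normD _ _)); rewrite mulrDl !normrM; apply: lerD.
      by apply: ler_pM => //; exact: H1.
    by apply: ler_pM => //; exact: H2.
split.
- exact: continuous_measurable2.
- exact: continuous_measurable2 (cdu true).
- exact: continuous_measurable2 (cdu false).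
exists phi; split; [| |exact: (grad true)|exact: (grad false)].
- move=> n; split; first by apply: smooth_of_CC => r; have [] := Cphi r n.
  have [_ [K2 [cK2 K2O c2]]] := Cchi; exists K2; split=> // p /c2 E.
  by rewrite /phi E mul0r.
- apply: (@cvg0_sup M (fun n p => phi n p - u p) (fun n => (C + 1) * n.+1%:R^-1)) => //.
  + by move=> n p; apply: cvgB; [exact: cphi|exact: cu].
  + by move=> n p nM; rewrite (cs0 (tf_cs K'M (Cphi 0%N n)) nM) (cs0 (tf_cs KM tu) nM) subrr.
  + move=> n q; have [Mq|nM] := pselect (sq M q); last first.
      rewrite (cs0 (tf_cs K'M (Cphi 0%N n)) nM) (cs0 (tf_cs KM tu) nM) subrr.
      by rewrite normr0 mulr_ge0 ?addr_ge0 ?invr_ge0.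
    have [_ H1 _] := Hpn n.
    rewrite -(chiu q) /phi -mulrBr normrM; apply: ler_pM => //; last exact: H1.
    by apply: (le_trans (chin q)); rewrite lerDr.
Qed.

End density.

(** * Potentials and vortices on a grid *)

Section potentials.
Variable R : realType.
Local Notation P := (R * R)%type.
Local Notation lam := (@lebesgue_measure R).
Implicit Types (f g u : P -> R) (p q : P) (U V : set P).

Lemma compact_box (O K : set P) : open O -> compact K -> K `<=` O ->
  exists2 d : R, 0 < d & forall k, K k -> box k d `<=` O.
Proof.
move=> oO /compact_near_coveringP cK KO.
have := cK R 0^'+ (fun e k => box k e `<=` O) _.
have H : forall x, K x -> \forall x' \near x & i \near 0^'+, box x' i `<=` O.
  move=> x Kx; have [r r0 rO] := nbhs_box (open_nbhs_nbhs (conj oO (KO x Kx))).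
  have r2 : 0 < r / 2 by rewrite divr_gt0.
  exists (box x (r / 2), [set e | e < r / 2]).
    by split; [exact: box_nbhs|exact: nbhs_right_lt].
  move=> [x' e] [/= [x1 x2] er] q [/= q1 q2]; apply: rO.
  have := ler_distD x'.1 q.1 x.1; have := ler_distD x'.2 q.2 x.2; split; lra.
move=> /(_ _ H) N.
have [d [d0 Hd]] : exists d : R, 0 < d /\ K `<=` (fun k => box k d `<=` O).
  near (0 : R)^'+ => d; exists d; split; first by near: d; exact: nbhs_right_gt.
  by near: d; exact: N.
by exists d => // k /Hd.
Unshelve. all: end_near. Qed.

Lemma between_dist (r x y c : R) :
  `|x - y| < r -> (x <= c <= y) || (y <= c <= x) -> `|c - y| < r.
Proof. by rewrite !ltr_norml => /andP[? ?] /orP[] /andP[? ?]; apply/andP; split; lra. Qed.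

(** Partial derivatives alone do not imply continuity, but here they are locally bounded: the mean
    value theorem on the two legs of a path parallel to the axes gives a local Lipschitz bound. It
    serves potentials that are known only through their gradients. *)
Lemma CC0_of_isd U f (d : bool -> P -> R) : open U ->
  (forall b p, U p -> isd b f p (d b p)) -> (forall b, CC 0 U (d b)) -> CC 0 U f.
Proof.
move=> oU Hd Cd; split=> // p Up.
have [r r0 rU] := nbhs_box (open_nbhs_nbhs (conj oU Up)).
have [r1 r10 h1] := nbhs_box (continuous_dist (CC_cont (Cd true) Up) ltr01).
have [r2 r20 h2] := nbhs_box (continuous_dist (CC_cont (Cd false) Up) ltr01).
pose r' := Num.min r (Num.min r1 r2).
have r'0 : 0 < r' by rewrite !lt_min r0 r10.
have inb q : box p r' q -> [/\ U q, `|d true q| <= `|d true p| + 1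
    & `|d false q| <= `|d false p| + 1].
  move=> [/=]; rewrite !lt_min => /and3P[? ? ?] /and3P[? ? ?].
  have B (b : bool) (x y : R) : `|x - y| < 1 -> `|y| <= `|x| + 1.
    move=> xy; rewrite -[y](subrK x); apply: (le_trans (ler_normD _ _)).
    by rewrite distrC addrC lerD2l ltW.
  split; first exact: rU.
  - by apply: (B true); exact: (h1 q).
  - by apply: (B true); exact: (h2 q).
pose L := `|d true p| + `|d false p| + 1.
have L0 : 0 < L by rewrite ltr_wpDl ?addr_ge0.
have line b q s t : (forall c, s <= c <= t -> box p r' (sl b q c)) -> s <= t ->
    `|f (sl b q t) - f (sl b q s)| <= L * (t - s).
  move=> H; rewrite le_eqVlt => /orP[/eqP ->|st]; first by rewrite !subrr normr0 mulr0.
  have [c /andP[c1 c2] ->] := mvt_line st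
    (fun c Hc => Hd b _ (let: And3 u _ _ := inb _ (H c Hc) in u)).
  rewrite normrM (ger0_norm (_ : 0 <= t - s)) ?subr_ge0 ?(ltW st)//.
  rewrite ler_wpM2r ?subr_ge0 ?(ltW st)//.
  have [_ t1 t2] := inb _ (H c ltac:(by rewrite !ltW)).
  move: (sl b q c) t1 t2 => x t1 t2; rewrite /L; case: (b); [apply: (le_trans t1)|apply: (le_trans t2)].
    by rewrite lerD2r lerDl.
  by rewrite lerD2r lerDr.
have line' b q s t : (forall c, (s <= c <= t) || (t <= c <= s) -> box p r' (sl b q c)) ->
    `|f (sl b q t) - f (sl b q s)| <= L * `|t - s|.
  move=> H; have [st|ts] := leP s t.
    rewrite (ger0_norm (_ : 0 <= t - s)) ?subr_ge0//; apply: line => // c Hc.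
    by apply: H; rewrite Hc.
  rewrite distrC [`|t - s|]distrC (ger0_norm (_ : 0 <= s - t)) ?subr_ge0 ?(ltW ts)//.
  by apply: line => [c Hc|]; [apply: H; rewrite Hc orbT|exact: ltW].
apply/cvgrPdist_le => e e0.
pose r3 := Num.min r' (e / (2 * L)).
have r30 : 0 < r3 by rewrite lt_min r'0 divr_gt0// mulr_gt0.
have r3r : r3 <= r' by rewrite ge_min lexx.
have r3e : r3 <= e / (2 * L) by rewrite ge_min lexx orbT.
apply: filterS (box_nbhs p r30) => q [q1' q2'].
have q1 := lt_le_trans q1' r3r; have e1 := lt_le_trans q1' r3e.
have q2 := lt_le_trans q2' r3r; have e2 := lt_le_trans q2' r3e.
have seg := @between_dist r'.
have H1 := @line' true (q.1, p.2) q.1 p.1 (fun c Hc => conj (seg q.1 p.1 c q1 Hc)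
  (_ : `|p.2 - p.2| < r')).
have H2 := @line' false (q.1, q.2) q.2 p.2 (fun c Hc => conj q1 (seg q.2 p.2 c q2 Hc)).
have {}H1 := H1 ltac:(by rewrite subrr normr0).
rewrite /= in H1 H2.
rewrite (surjective_pairing p) (surjective_pairing q).
apply: (le_trans (ler_distD (f (q.1, p.2)) _ _)).
apply: (le_trans (lerD H1 H2)).
rewrite -mulrDr -ler_pdivlMl//; rewrite distrC [X in _ + X <= _]distrC.
have -> : L^-1 * e = e / (2 * L) + e / (2 * L) by field; rewrite gt_eqF.
by rewrite lerD// ltW.
Qed.

Lemma continuous_segment_integrable (g : R -> R) (a b : R) :
  (forall t, a <= t <= b -> {for t, continuous g}) ->
  lam.-integrable `[a, b] (EFin \o g) /\ {within `[a, b], continuous g}.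
Proof.
move=> cg; have wg : {within `[a, b], continuous g}.
  apply: continuous_in_subspaceT => t /set_mem; rewrite /= in_itv/=; exact: cg.
split=> //; apply: continuous_compact_integrable => //; exact: segment_compact.
Qed.

Lemma FTC_segment (g G : R -> R) (a b : R) : a < b ->
  (forall t, a <= t <= b -> {for t, continuous g}) ->
  (forall t, a <= t <= b -> is_derive t (1 : R) G (g t)) ->
  Rintegral lam `[a, b] g = G b - G a.
Proof.
move=> ab cg dG; have [_ wg] := continuous_segment_integrable cg.
have cG t : a <= t <= b -> {for t, continuous G}.
  move=> tab; apply: differentiable_continuous; apply/derivable1_diffP.
  by have H := dG t tab; exact: ex_derive.
have D : derivable_oo_LRcontinuous G a b.
  split.
  - move=> t; rewrite in_itv/= => /andP[/ltW t1 /ltW t2].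
    by have H := dG t (introT andP (conj t1 t2)); exact: ex_derive.
  - by apply: cvg_at_right_filter; apply: cG; rewrite lexx ltW.
  - by apply: cvg_at_left_filter; apply: cG; rewrite lexx ltW.
have E : {in `]a, b[, derive1 G =1 g}.
  move=> t; rewrite in_itv/= => /andP[/ltW t1 /ltW t2].
  by rewrite derive1E; have H := dG t (introT andP (conj t1 t2)); exact: derive_val.
by rewrite /Rintegral (@continuous_FTC2 _ g G a b ab wg D E).
Qed.

Lemma FTC_derive (g : R -> R) (a b x : R) : a < x < b ->
  (forall t, a <= t <= b -> {for t, continuous g}) ->
  is_derive x (1 : R) (fun x => Rintegral lam `[a, x] g) (g x).
Proof.
move=> /andP[ax xb] cg; have [Ig _] := continuous_segment_integrable cg.
have axb : a <= x <= b by rewrite !ltW.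
have [D E] := @continuous_FTC1_closed R g a x b xb Ig ax (cg x axb).
by apply: DeriveDef; [exact: D|rewrite -derive1E; exact: E].
Qed.

Lemma poincare_rect U (l r b t : R) (g1 g2 : P -> R) : open U ->
  (forall p, l <= p.1 <= r -> b <= p.2 <= t -> U p) ->
  CC 1 U g1 -> CC 1 U g2 -> (forall p, U p -> pd true g2 p = pd false g1 p) ->
  exists F : P -> R, forall p, l < p.1 < r -> b < p.2 < t ->
    isd true F p (g1 p) /\ isd false F p (g2 p).
Proof.
move=> oU HU C1 C2 closed.
pose F1 (p : P) := Rintegral lam `[l, p.1] (fun s => g1 (s, b)).
pose F2 (p : P) := Rintegral lam `[b, p.2] (fun s => g2 (p.1, s)).
have cont1 g y : CC 0 U g -> b <= y <= t -> forall s, l <= s <= r ->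
    {for s, continuous (fun s => g (s, y))}.
  move=> Cg yy s ss; apply: (@continuous_comp _ _ _ (sl true (s, y)) g).
    exact: sl_continuous.
  by apply: (CC_cont Cg); apply: HU.
have cont2 g x : CC 0 U g -> l <= x <= r -> forall s, b <= s <= t ->
    {for s, continuous (fun s => g (x, s))}.
  move=> Cg xx s ss; apply: (@continuous_comp _ _ _ (sl false (x, s)) g).
    exact: sl_continuous.
  by apply: (CC_cont Cg); apply: HU.
have [d2 Cd2] := CC_pd true oU C2; have [d1 Cd1] := CC_pd false oU C1.
exists (fun p => F1 p + F2 p) => -[x y] /= /andP[lx xr] /andP[by_ yt].
have lr : l <= x <= r by rewrite !ltW.
have bt : b <= b <= t by rewrite lexx ltW// (lt_trans by_).
split; last first.
  rewrite -[g2 _]add0r; apply: (@isdD _ _ F1 F2).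
    by rewrite /isd /F1 /=; exact: is_derive_cst.
  rewrite /isd /=.
  by apply: (@FTC_derive (fun s => g2 (x, s)) b t y); [rewrite by_|exact: cont2 (CCW C2) lr].
have -> : g1 (x, y) = g1 (x, b) + Rintegral lam `[b, y] (fun s => pd true g2 (x, s)).
  suff -> : Rintegral lam `[b, y] (fun s => pd true g2 (x, s)) = g1 (x, y) - g1 (x, b).
    by rewrite subrKC.
  have inU s : b <= s <= y -> U (x, s).
    by move=> /andP[s1 s2]; apply: HU => //=; rewrite s1 (le_trans s2)// ltW.
  transitivity (Rintegral lam `[b, y] (fun s => pd false g1 (x, s))).
    by apply: eq_Rintegral => s /set_mem; rewrite /= in_itv/= => /inU; exact: closed.
  apply: (@FTC_segment _ (fun s => g1 (x, s)) b y by_) => s sby.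
    by apply: (cont2 _ x Cd1 lr); case/andP: sby => s1 s2; rewrite s1 (le_trans s2)// ltW.
  exact: (d1 (x, s) (inU s sby)).
apply: (@isdD _ _ F1 F2).
  rewrite /isd /=.
  by apply: (@FTC_derive (fun s => g1 (s, b)) l r x); [rewrite lx|exact: cont1 (CCW C1) bt].
rewrite /isd /=.
(* A bound on the closed rectangle, which provides the dominating function for differentiation under
   the integral. *)
have [C HC] : exists C : R, forall s u : R, l <= s <= r -> b <= u <= t -> `|pd true g2 (s, u)| <= C.
  have cpt : compact (`[l, r]%classic `*` `[b, t]%classic : set P).
    by apply: compact_setX; exact: segment_compact.
  have cc : {within (`[l, r]%classic `*` `[b, t]%classic : set P), continuous (pd true g2)}.
    apply: continuous_in_subspaceT => p /set_mem[]; rewrite /= !in_itv/= => p1 p2.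
    by apply: (CC_cont Cd2); apply: HU.
  have [C [_ HC]] := compact_bounded (continuous_compact cc cpt).
  exists (`|C| + 1) => s u ss uu; apply: HC.
    by rewrite (le_lt_trans (ler_norm C))// ltrDl.
  by exists (s, u) => //; split; rewrite /= in_itv.
have yt' s : b <= s <= y -> b <= s <= t.
  by move=> /andP[s1 s2]; rewrite s1 (le_trans s2)// ltW.
pose f (x s : R) := g2 (x, s).
have Ixlr : (`]l, r[%classic : set R) x by rewrite /= in_itv/= lx.
have If z : (`]l, r[%classic : set R) z -> lam.-integrable `[b, y] (EFin \o f z).
  rewrite /= in_itv/= => /andP[z1 z2].
  have [] // := @continuous_segment_integrable (f z) b y _.
  by move=> s /yt'; apply: (cont2 _ z (CCW C2)); rewrite !ltW.
have df z s : (`]l, r[%classic : set R) z -> (`[b, y]%classic : set R) s -> is_derive z (1 : R) (f^~ s) (pd true g2 (z, s)).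
  rewrite /= !in_itv/= => /andP[z1 z2] /yt' s12.
  by apply: (d2 (z, s)); apply: HU => //=; rewrite !ltW.
have df1 z s : (`]l, r[%classic : set R) z -> (`[b, y]%classic : set R) s -> derivable (f^~ s) z 1.
  by move=> Hz Hs; have H := df z s Hz Hs; exact: ex_derive.
have dfE z s : (`]l, r[%classic : set R) z -> (`[b, y]%classic : set R) s ->
    partial1of2 f z s = pd true g2 (z, s).
  by move=> Hz Hs; rewrite partial1of2E; have H := df z s Hz Hs; exact: derive_val.
have IG : lam.-integrable `[b, y] (EFin \o cst `|C|).
  by apply: (@continuous_segment_integrable (cst `|C|) b y _).1 => s _; exact: cvg_cst.
have bd z s : (`]l, r[%classic : set R) z -> (`[b, y]%classic : set R) s -> `|partial1of2 f z s| <= cst `|C| s.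
  move=> Hz Hs; rewrite dfE//; apply: le_trans (ler_norm C); apply: HC.
    by move: Hz; rewrite /= in_itv/= => /andP[? ?]; rewrite !ltW.
  by move: Hs; rewrite /= in_itv/= => /yt'.
have mby : measurable (`[b, y]%classic : set (measurableTypeR R)) by exact: measurable_itv.
have D := @derivable_under_integral R _ _ lam f `[b, y]%classic mby x l r Ixlr If df1 (cst `|C|)
  (fun=> normr_ge0 C) IG bd.
have E := @differentiation_under_integral R _ _ lam f `[b, y]%classic mby x l r Ixlr If df1 (cst `|C|)
  (fun=> normr_ge0 C) IG bd.
apply: DeriveDef; first exact: D.
rewrite -derive1E; apply: etrans E _.
by apply: eq_Rintegral => s /set_mem Hs; exact: dfE.
Qed.

End potentials.

(** * Phases modulo 2 pi *)

Section periods.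
Variable R : realType.
Implicit Types x y : R.

(* [x] is an integer multiple of [2 pi]. *)
Definition period x : Prop := cos x = 1 /\ sin x = 0.

Lemma period0 : period 0.
Proof. by split; [exact: cos0|exact: sin0]. Qed.

Lemma periodD x y : period x -> period y -> period (x + y).
Proof.
move=> [cx sx] [cy sy]; split; first by rewrite cosD cx cy sx sy; ring.
by rewrite sinD cx cy sx sy; ring.
Qed.

Lemma periodN x : period x -> period (- x).
Proof. by move=> [cx sx]; split; rewrite ?cosN ?sinN ?sx ?oppr0. Qed.

Lemma periodB x y : period x -> period y -> period (x - y).
Proof. by move=> px py; apply: periodD => //; exact: periodN. Qed.

Lemma period_eq x y : period (x - y) -> cos x = cos y /\ sin x = sin y.
Proof.
move=> [c s].
by split; rewrite -[in LHS](subrK y x) ?(cosD (x - y)) ?(sinD (x - y)) c s; ring.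
Qed.

Lemma period_reduce x : exists2 r, `|r| <= pi *+ 2 & period (x - r).
Proof.
have p0 : 0 < (pi : R) *+ 2 by rewrite pmulrn_lgt0// pi_gt0.
have pn (n : nat) : period ((pi : R) *+ 2 *+ n).
  by elim: n => [|n IH]; [exact: period0|rewrite mulrSr; apply: periodD => //;
    split; [exact: cos2pi|exact: sin2pi]].
pose n := Num.floor (x / (pi *+ 2)).
exists (x - pi *+ 2 * n%:~R).
  have /andP[h1 h2] : n%:~R <= x / (pi *+ 2) < (n + 1)%:~R by exact: floor_itv.
  move: h1 h2; rewrite ler_pdivlMr// ltr_pdivrMr// intrD mulrDl mul1r => h1 h2.
  rewrite ler_norml; apply/andP; split; rewrite mulrC; lra.
rewrite opprB addrC subrK; case: n => n.
  by rewrite mulr_natr; exact: pn.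
by rewrite NegzE mulrNz mulrN mulr_natr; apply: periodN; exact: pn.
Qed.

(** A discrete Poincare lemma modulo 2 pi on a full square of cells. [Phi] sums the increments along
    row 0 and then up the column, so vertical increments are exact, and the congruence for
    horizontal ones climbs from row to row through the cell circulations. *)
Lemma discrete_gauge (N : nat) (H V : nat -> nat -> R) :
  (forall i j, (i < N)%N -> (j < N)%N ->
     period (H i j + V i.+1 j - H i j.+1 - V i j)) ->
  exists Phi : nat -> nat -> R, (forall i j, Phi i j.+1 - Phi i j = V i j) /\
    forall i j, (i < N)%N -> (j <= N)%N -> period (H i j - (Phi i.+1 j - Phi i j)).
Proof.
move=> circ.
exists (fun i j => \sum_(0 <= k < i) H k 0%N + \sum_(0 <= l < j) V i l).
split=> [i j|i j iN]; first by rewrite (@big_nat_recr _ _ _ j)//=; ring.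
elim: j => [|j IH] jN.
  have z l : \sum_(0 <= k < 0) V l k = 0 by rewrite big_geq.
  rewrite !z !addr0 (@big_nat_recr _ _ _ i)//=.
  by rewrite (_ : H i 0%N - _ = 0); [exact: period0|ring].
have := periodB (IH (ltnW jN)) (circ i j iN jN).
congr period; rewrite !(@big_nat_recr _ _ _ j)//=; ring.
Qed.

End periods.

(** * Circulations around grid cells *)

Section grid.
Variable R : realType.
Local Notation P := (R * R)%type.
Local Notation lam := (@lebesgue_measure R).
Variables (M d : R).
Hypothesis d0 : 0 < d.
Implicit Types (f g u F : P -> R) (p q z : P) (U : set P) (H V : nat -> nat -> R) (i j k l : nat).

Definition gx i : R := - M + i%:R * d.
(** The margin d/4 makes neighbouring cells overlap in open sets, where their potentials can be
    compared, while staying d/4 away from the centres of the neighbours, where the vortices may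
    sit. *)
Definition opcell i j : set P := [set p |
  gx i - d / 4 < p.1 < gx i.+1 + d / 4 /\ gx j - d / 4 < p.2 < gx j.+1 + d / 4].
Definition clcell i j : set P := [set p |
  gx i - d / 4 <= p.1 <= gx i.+1 + d / 4 /\ gx j - d / 4 <= p.2 <= gx j.+1 + d / 4].
Definition midcell i j : P := (gx i + d / 2, gx j + d / 2).
Definition hedge g i j : R := Rintegral lam `[gx i, gx i.+1] (fun s => g (s, gx j)).
Definition vedge g i j : R := Rintegral lam `[gx j, gx j.+1] (fun s => g (gx i, s)).

Definition increments (H V : nat -> nat -> R) F i j : Prop :=
  [/\ H i j = F (gx i.+1, gx j) - F (gx i, gx j),
      H i j.+1 = F (gx i.+1, gx j.+1) - F (gx i, gx j.+1),
      V i j = F (gx i, gx j.+1) - F (gx i, gx j) &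
      V i.+1 j = F (gx i.+1, gx j.+1) - F (gx i.+1, gx j)].

Definition circ (H V : nat -> nat -> R) i j : R :=
  H i j + V i.+1 j - H i j.+1 - V i j.

Lemma increments_circ H V F i j : increments H V F i j -> circ H V i j = 0.
Proof. by move=> [e1 e2 e3 e4]; rewrite /circ e1 e2 e3 e4; ring. Qed.

Lemma gxS i : gx i.+1 = gx i + d.
Proof. by rewrite /gx -natr1; ring. Qed.

Lemma gx_lt i : gx i < gx i.+1.
Proof. by rewrite gxS ltrDl. Qed.

Lemma clcell_sub i j : opcell i j `<=` clcell i j.
Proof. by move=> p [/andP[? ?] /andP[? ?]]; split; rewrite !ltW. Qed.

Lemma opcell_open i j : open (opcell i j).
Proof.
rewrite (_ : opcell i j = box (midcell i j) (d / 2 + d / 4)); first exact: box_open.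
have dd := d0; have ih := gxS i; have jh := gxS j.
apply/seteqP; split=> p; rewrite /opcell /box /midcell /= !ltr_distl ih jh.
  by move=> [/andP[? ?] /andP[? ?]]; split; apply/andP; split; lra.
by move=> [/andP[? ?] /andP[? ?]]; split; apply/andP; split; lra.
Qed.

Lemma has_potential U i j g1 g2 : open U -> clcell i j `<=` U ->
  CC 1 U g1 -> CC 1 U g2 -> (forall p, U p -> pd true g2 p = pd false g1 p) ->
  exists F, (forall p, opcell i j p -> isd true F p (g1 p) /\ isd false F p (g2 p)) /\
    increments (hedge g1) (vedge g2) F i j.
Proof.
move=> oU cU C1 C2 cl.
have [|F HF] := poincare_rect oU _ C1 C2 cl (l := gx i - d / 4) (r := gx i.+1 + d / 4)
  (b := gx j - d / 4) (t := gx j.+1 + d / 4).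
  by move=> p p1 p2; apply: cU.
exists F; split; first by move=> p [p1 p2]; exact: HF.
have dd := d0; have ih := gxS i; have jh := gxS j.
have H1 y : gx j <= y <= gx j.+1 ->
    Rintegral lam `[gx i, gx i.+1] (fun s => g1 (s, y)) = F (gx i.+1, y) - F (gx i, y).
  move=> /andP[y1 y2].
  have cell s : gx i <= s <= gx i.+1 -> opcell i j (s, y).
    by move=> /andP[? ?]; split=> /=; apply/andP; split; lra.
  apply: (@FTC_segment _ _ (fun s => F (s, y)) _ _ (gx_lt i)) => s /cell Hs.
    apply: (@continuous_comp _ _ _ (sl true (s, y)) g1); first exact: sl_continuous.
    by apply: (CC_cont C1); apply: cU; exact: clcell_sub.
  have [D _] := HF _ Hs.1 Hs.2; exact: D.
have H2 x : gx i <= x <= gx i.+1 ->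
    Rintegral lam `[gx j, gx j.+1] (fun s => g2 (x, s)) = F (x, gx j.+1) - F (x, gx j).
  move=> /andP[x1 x2].
  have cell s : gx j <= s <= gx j.+1 -> opcell i j (x, s).
    by move=> /andP[? ?]; split=> /=; apply/andP; split; lra.
  apply: (@FTC_segment _ _ (fun s => F (x, s)) _ _ (gx_lt j)) => s /cell Hs.
    apply: (@continuous_comp _ _ _ (sl false (x, s)) g2); first exact: sl_continuous.
    by apply: (CC_cont C2); apply: cU; exact: clcell_sub.
  have [_ D] := HF _ Hs.1 Hs.2; exact: D.
split.
- by apply: H1; rewrite lexx ltW// gx_lt.
- by apply: H1; rewrite lexx ltW// gx_lt.
- by apply: H2; rewrite lexx ltW// gx_lt.
- by apply: H2; rewrite lexx ltW// gx_lt.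
Qed.

Definition dist2 z p : R := (p.1 - z.1) ^+ 2 + (p.2 - z.2) ^+ 2.
(* The angular form [d arg(p - z)], with components [tau1] and [tau2]; it is the
   rotated gradient of [ln (dist2 z) / 2]. *)
Definition tau1 z p : R := - (p.2 - z.2) * (dist2 z p)^-1.
Definition tau2 z p : R := (p.1 - z.1) * (dist2 z p)^-1.

Lemma isd_inv b f p (l : R) : f p != 0 -> isd b f p l -> isd b (fun q => (f q)^-1) p (- f p ^- 2 * l).
Proof.
move=> fp; apply: isd_comp; apply: is_derive_eq (is_deriveV fp (is_derive_id _ _)) _.
by rewrite /GRing.scale/= mulr1.
Qed.

Lemma isd_dist2 b z p : isd b (dist2 z) p (2 * (co b p - co b z)).
Proof.
have H (b' : bool) c : isd b (fun q => co b' q - c) p ((b == b')%:R - 0).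
  exact: (isdD (isd_co b b' p) (isdN (isd_cst b c p))).
rewrite (_ : dist2 z = fun q => (co true q - z.1) * (co true q - z.1)
  + (co false q - z.2) * (co false q - z.2)).
  apply: isd_eq.
    exact: (isdD (isdM (H true z.1) (H true z.1)) (isdM (H false z.2) (H false z.2))).
  by case: b {H} => /=; ring.
by apply/funext => q; rewrite /dist2 !expr2.
Qed.

Lemma CC_dist2 n U z : CC n U (dist2 z).
Proof.
by apply: CCD; apply: CCX; (apply: CCB; last exact: CC_cst);
  [exact: (CC_co n U true)|exact: (CC_co n U false)].
Qed.

Lemma dist2_open z : open [set p | 0 < dist2 z p].
Proof.
rewrite openE => p pz.
have N : nbhs (dist2 z p) [set y : R | 0 < y].
  by apply: open_nbhs_nbhs; split=> //; exact: open_gt.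
exact: (@CC_cont _ _ _ _ (CC_dist2 0 setT z) p I _ N).
Qed.

Lemma CC_tau n z : CC n [set p | 0 < dist2 z p] (tau1 z) /\
  CC n [set p | 0 < dist2 z p] (tau2 z).
Proof.
have CI : CC n [set p | 0 < dist2 z p] (fun p => (dist2 z p)^-1).
  by apply: CC_inv; [move=> p pz; rewrite gt_eqF|exact: CC_dist2].
split; apply: CCM => //; [apply: CCN|]; apply: CCB; try exact: CC_cst.
  exact: (CC_co n _ false).
exact: (CC_co n _ true).
Qed.

Lemma tau_closed z p : 0 < dist2 z p -> pd true (tau2 z) p = pd false (tau1 z) p.
Proof.
move=> pz; have p0 : dist2 z p != 0 by rewrite gt_eqF.
have [_ E1] := isd_pd (isdM (isdD (isd_co true true p) (isdN (isd_cst true z.1 p)))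
  (isd_inv p0 (isd_dist2 true z p))).
have [_ E2] := isd_pd (isdM (isdN (isdD (isd_co false false p) (isdN (isd_cst false z.2 p))))
  (isd_inv p0 (isd_dist2 false z p))).
apply: etrans E1 _; apply: etrans (esym E2).
rewrite /=; have E : dist2 z p = (p.1 - z.1) ^+ 2 + (p.2 - z.2) ^+ 2 by [].
have E' : (p.2 - z.2) ^+ 2 = dist2 z p - (p.1 - z.1) ^+ 2 by rewrite E; ring.
move: (dist2 z p) (p.1 - z.1) (p.2 - z.2) p0 E' {E pz} => r x y r0 E'.
apply/eqP; rewrite -subr_eq0; apply/eqP.
transitivity (2 * r^-1 - 2 * (x ^+ 2 + y ^+ 2) * r ^- 2); first by ring.
by rewrite E'; field.
Qed.

Lemma isd_ln_dist2 b z p : 0 < dist2 z p ->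
  isd b (fun q => 2^-1 * ln (dist2 z q)) p (if b then tau2 z p else - tau1 z p).
Proof.
move=> pz; apply: isd_eq.
  exact: (isdM (isd_cst b 2^-1 p) (isd_comp (is_derive1_ln pz) (isd_dist2 b z p))).
rewrite mul0r add0r /tau1 /tau2.
by case: b => /=; move: (dist2 z p)^-1 => y; field.
Qed.

Lemma segment_cst (a b c : R) : a < b ->
  Rintegral lam `[a, b] (fun=> c) = c * (b - a).
Proof.
move=> ab; rewrite mulrBr; apply: (@FTC_segment R (fun=> c) (fun t => c * t) a b ab) => t _.
  exact: cvg_cst.
have D := is_deriveZ c (is_derive_id t (1 : R)).
by apply: is_derive_eq D _; rewrite /GRing.scale/= mulr1.
Qed.

Lemma segment_ge (g : R -> R) (a b c : R) : a < b ->
  (forall t, a <= t <= b -> {for t, continuous g}) ->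
  (forall t, a <= t <= b -> c <= g t) -> c * (b - a) <= Rintegral lam `[a, b] g.
Proof.
move=> ab cg gc; have [Ig _] := continuous_segment_integrable cg.
have [Ic _] := @continuous_segment_integrable R (fun=> c) a b (fun t _ => @cvg_cst _ _ _ _ _).
rewrite -segment_cst//.
by apply: le_Rintegral => // t; rewrite /= in_itv/=; exact: gc.
Qed.

Lemma segment_le (g : R -> R) (a b c : R) : a < b ->
  (forall t, a <= t <= b -> {for t, continuous g}) ->
  (forall t, a <= t <= b -> g t <= c) -> Rintegral lam `[a, b] g <= c * (b - a).
Proof.
move=> ab cg gc; have [Ig _] := continuous_segment_integrable cg.
have [Ic _] := @continuous_segment_integrable R (fun=> c) a b (fun t _ => @cvg_cst _ _ _ _ _).
rewrite -segment_cst//.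
by apply: le_Rintegral => // t; rewrite /= in_itv/=; exact: gc.
Qed.

(** The exact value is 2 pi, but the coefficients of the vortices are obtained by dividing by this
    circulation, for which a lower bound suffices. On each edge the integrand, up to orientation, is
    d/2 over a squared distance of at most d^2 / 2, so each edge contributes at least 1. *)
Lemma circ_tau i j : 4 <= circ (hedge (tau1 (midcell i j))) (vedge (tau2 (midcell i j))) i j.
Proof.
set z := midcell i j.
have [C1 C2] := CC_tau 0 z.
have dd := d0; have ih := gxS i; have jh := gxS j.
have d00 : d != 0 by rewrite gt_eqF.
have D (x y : R) : (x == d / 2) || (x == - (d / 2)) || (y == d / 2) || (y == - (d / 2)) ->
    0 < x ^+ 2 + y ^+ 2.
  have d4 : 0 < (d / 2) ^+ 2 by rewrite exprn_gt0// divr_gt0.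
  move=> /orP[/orP[/orP[]|]|] /eqP ->; rewrite ?sqrrN.
  - by rewrite ltr_wpDr ?sqr_ge0.
  - by rewrite ltr_wpDr ?sqr_ge0.
  - by rewrite ltr_wpDl ?sqr_ge0.
  - by rewrite ltr_wpDl ?sqr_ge0.
have key (x : R) : - (d / 2) <= x <= d / 2 -> d^-1 <= (d / 2) * (x ^+ 2 + (d / 2) ^+ 2)^-1.
  move=> /andP[x1 x2].
  have x2d : x ^+ 2 <= (d / 2) ^+ 2.
    have xd : `|x| <= d / 2 by rewrite ler_norml x1.
    by rewrite -(real_normK (num_real x)) lerXn2r ?nnegrE// (le_trans _ xd).
  have p : 0 < x ^+ 2 + (d / 2) ^+ 2 by apply: D; rewrite eqxx !orbT.
  rewrite ler_pdivlMr// ler_pdivrMl//.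
  have -> : d * (d / 2) = (d / 2) ^+ 2 + (d / 2) ^+ 2 by field.
  by rewrite lerD2r.
have m1 (x : R) : x - (x + d / 2) = - (d / 2) by ring.
have m2 (x : R) : x + d - (x + d / 2) = d / 2 by field.
have h1 : 1 <= hedge (tau1 z) i j.
  have -> : 1 = d^-1 * (gx i.+1 - gx i) by rewrite ih; field.
  apply: (segment_ge (gx_lt i)) => s /andP[s1 s2].
    apply: (@continuous_comp _ _ _ (sl true (s, gx j)) (tau1 z)); first exact: sl_continuous.
    by apply: (CC_cont C1); apply: D => /=; apply/orP; right; apply/eqP; lra.
  apply: le_trans (key (s - z.1) _) _; first by rewrite /=; apply/andP; split; lra.
  by rewrite /tau1 /dist2 /= m1 opprK sqrrN.
have h2 : hedge (tau1 z) i j.+1 <= -1.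
  have -> : -1 = - d^-1 * (gx i.+1 - gx i) by rewrite ih; field.
  apply: (segment_le (gx_lt i)) => s /andP[s1 s2].
    apply: (@continuous_comp _ _ _ (sl true (s, gx j.+1)) (tau1 z)); first exact: sl_continuous.
    by apply: (CC_cont C1); apply: D => /=; apply/orP; left; apply/orP; right; apply/eqP; lra.
  rewrite lerNr; apply: le_trans (key (s - z.1) _) _; first by rewrite /=; apply/andP; split; lra.
  by rewrite /tau1 /dist2 /= jh m2 mulNr opprK.
have v1 : 1 <= vedge (tau2 z) i.+1 j.
  have -> : 1 = d^-1 * (gx j.+1 - gx j) by rewrite jh; field.
  apply: (segment_ge (gx_lt j)) => s /andP[s1 s2].
    apply: (@continuous_comp _ _ _ (sl false (gx i.+1, s)) (tau2 z)); first exact: sl_continuous.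
    by apply: (CC_cont C2); apply: D => /=; do 3 (apply/orP; left); apply/eqP; lra.
  apply: le_trans (key (s - z.2) _) _; first by rewrite /=; apply/andP; split; lra.
  by rewrite /tau2 /dist2 /= ih m2 addrC.
have v2 : vedge (tau2 z) i j <= -1.
  have -> : -1 = - d^-1 * (gx j.+1 - gx j) by rewrite jh; field.
  apply: (segment_le (gx_lt j)) => s /andP[s1 s2].
    apply: (@continuous_comp _ _ _ (sl false (gx i, s)) (tau2 z)); first exact: sl_continuous.
    by apply: (CC_cont C2); apply: D => /=; do 2 (apply/orP; left); apply/orP; right;
      apply/eqP; lra.
  rewrite lerNr; apply: le_trans (key (s - z.2) _) _; first by rewrite /=; apply/andP; split; lra.
  by rewrite /tau2 /dist2 /= m1 mulNr opprK sqrrN addrC.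
rewrite /circ; lra.
Qed.

End grid.

(** * Removal of the holonomies on the grid *)

Section gauge.
Variable R : realType.
Local Notation P := (R * R)%type.
Implicit Types (f g u F : P -> R) (p : P) (i j k l : nat).

Lemma isd_sum (I : Type) (r : seq I) (Q : pred I) (F : I -> P -> R) (L : I -> R) b p :
  (forall x, Q x -> isd b (F x) p (L x)) ->
  isd b (fun p => \sum_(x <- r | Q x) F x p) p (\sum_(x <- r | Q x) L x).
Proof.
move=> H; elim: r => [|x r IH].
  by under eq_fun do rewrite big_nil; rewrite big_nil; exact: isd_cst.
under eq_fun do rewrite big_cons; rewrite big_cons.
by case Qx: (Q x) => //; apply: isdD => //; exact: H.
Qed.

(** Order-convex sets stand in for intervals so that overlaps of two cells, products of
    intersections of intervals, are covered directly. *)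
Lemma rect_constant (A B : set R) F :
  (forall x y z, A x -> A y -> x <= z <= y -> A z) ->
  (forall x y z, B x -> B y -> x <= z <= y -> B z) ->
  (forall p b, A p.1 -> B p.2 -> isd b F p 0) ->
  forall p q, A p.1 -> B p.2 -> A q.1 -> B q.2 -> F p = F q.
Proof.
move=> cA cB dF.
have line b p s t : (forall c, (s <= c <= t) -> A (sl b p c).1 /\ B (sl b p c).2) ->
    s <= t -> F (sl b p s) = F (sl b p t).
  move=> H; rewrite le_eqVlt => /orP[/eqP ->//|st].
  have [c _ E] := mvt_line (d := fun=> 0) st
    (fun c Hc => dF (sl b p c) b (H c Hc).1 (H c Hc).2).
  by apply/esym/eqP; rewrite -subr_eq0 E mul0r.
have hor (x x' y : R) : A x -> A x' -> B y -> F (x, y) = F (x', y).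
  move=> Ax Ax' By; have [xx|xx] := leP x x'.
    by apply: (line true (x, y)) => // c cc; split=> //; exact: cA cc.
  by apply/esym; apply: (line true (x, y)) => [c cc|]; [split=> //; exact: cA cc|exact: ltW].
have ver (x y y' : R) : A x -> B y -> B y' -> F (x, y) = F (x, y').
  move=> Ax By By'; have [xx|xx] := leP y y'.
    by apply: (line false (x, y)) => // c cc; split=> //; exact: cB cc.
  by apply/esym; apply: (line false (x, y)) => [c cc|]; [split=> //; exact: cB cc|exact: ltW].
by move=> [p1 p2] [q1 q2] /= Ap Bp Aq Bq; rewrite (hor p1 q1)// (ver q1 p2 q2).
Qed.

Variables (O : set P) (M d : R) (N : nat) (th1 th2 : P -> R).
Hypotheses (oO : open O) (OM : O `<=` sq M) (d0 : 0 < d) (Nd : 2 * M < N%:R * d)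
  (Cth1 : CC 1 O th1) (Cth2 : CC 1 O th2)
  (th_closed : forall p, O p -> pd true th2 p = pd false th1 p).
Local Notation gx := (gx M d).
Local Notation opcell := (opcell M d).
Local Notation clcell := (clcell M d).
Local Notation midcell := (midcell M d).
Local Notation T := ('I_N * 'I_N)%type.

Definition good i j : bool := `[< clcell i j `<=` O >].
Definition bad (q : T) : bool := ~~ good q.1 q.2.
Definition pole (q : T) : P := midcell q.1 q.2.

Lemma gx_le i j : (i <= j)%N -> gx i <= gx j.
Proof. by move=> ij; rewrite lerD2l ler_wpM2r// ?ler_nat// ltW. Qed.

(** A centre is d/2 away from the sides of its own cell, of which another enlarged cell eats at most
    d/4. The bound is quantitative because it has to control the logarithms in S. *)
Lemma midcell_far i j a b p : (i, j) != (a, b) -> clcell i j p ->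
  (d / 4) ^+ 2 <= dist2 (midcell a b) p.
Proof.
have sqd x : d / 4 <= `|x| -> (d / 4) ^+ 2 <= x ^+ 2.
  move=> dx; rewrite -(real_normK (num_real x)) lerXn2r ?nnegrE// divr_ge0// ltW//.
have far k c x : k != c -> gx k - d / 4 <= x <= gx k.+1 + d / 4 ->
    d / 4 <= `|x - (gx c + d / 2)|.
  rewrite neq_ltn => /orP[] kc /andP[x1 x2]; have dd := d0.
    have h1 := gx_le kc; rewrite ler0_norm; lra.
  have h1 := gx_le kc; have h2 := gxS M d c; rewrite ger0_norm; lra.
rewrite xpair_eqE negb_and => /orP[ne|ne] [p1 p2]; rewrite /dist2.
  by rewrite ler_wpDr ?sqr_ge0//; apply: sqd; exact: far p1.
by rewrite ler_wpDl ?sqr_ge0//; apply: sqd; exact: far p2.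
Qed.

Lemma midcell_off i j a b p : (i, j) != (a, b) -> clcell i j p ->
  0 < dist2 (midcell a b) p.
Proof.
move=> ne pc; apply: lt_le_trans (midcell_far ne pc).
by rewrite exprn_gt0// divr_gt0.
Qed.

Lemma bad_neq i j (q : T) : good i j -> bad q -> (i, j) != (val q.1, val q.2).
Proof. by move=> gij; apply: contraNneq => -[<- <-]. Qed.

(** The form th / h together with the vortices, all of whose poles lie outside the enlarged good
    cells. *)
Definition beta1 (h : R) (s : T -> R) p : R :=
  h^-1 * th1 p + \sum_(q | bad q) s q * tau1 (pole q) p.
Definition beta2 (h : R) (s : T -> R) p : R :=
  h^-1 * th2 p + \sum_(q | bad q) s q * tau2 (pole q) p.

(* The coefficients of the vortices at the centers of the bad cells make the
   circulation of [beta] around every cell a multiple of [2 pi]. *)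
Lemma cell_potentials h : exists (s : T -> R) (Phi : nat -> nat -> R),
  (forall q, `|s q| <= pi *+ 2) /\
  forall i j, (i < N)%N -> (j < N)%N -> good i j -> exists G : P -> R,
    (forall p, opcell i j p ->
       isd true G p (beta1 h s p) /\ isd false G p (beta2 h s p)) /\
    forall a b, (a == i) || (a == i.+1) -> (b == j) || (b == j.+1) ->
      period (G (gx a, gx b) - Phi a b).
Proof.
pose ka (q : T) := circ (hedge M d (tau1 (pole q))) (vedge M d (tau2 (pole q))) q.1 q.2.
have ka4 q : 4 <= ka q by exact: circ_tau.
have ka0 q : 0 < ka q by apply: lt_le_trans (ka4 q).
have [r Hr] : {r : T -> R & forall q, `|r q| <= pi *+ 2 /\
    period (h^-1 * circ (hedge M d th1) (vedge M d th2) q.1 q.2 - r q)}.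
  apply: (@choice T R (fun q r => `|r| <= pi *+ 2 /\
    period (h^-1 * circ (hedge M d th1) (vedge M d th2) q.1 q.2 - r))) => q.
  have [x] := period_reduce (h^-1 * circ (hedge M d th1) (vedge M d th2) q.1 q.2).
  by exists x.
(* [r q] is the residue modulo 2 pi of the circulation of th / h around cell q, and [ka q] that of a
   unit vortex at its centre: this strength cancels the residue. As ka >= 1, it is bounded by 2 pi
   whatever h is. *)
pose s q := - r q / ka q.
pose H i j := h^-1 * hedge M d th1 i j + \sum_(q | bad q) s q * hedge M d (tau1 (pole q)) i j.
pose V i j := h^-1 * vedge M d th2 i j + \sum_(q | bad q) s q * vedge M d (tau2 (pole q)) i j.
have circE i j : circ H V i j = h^-1 * circ (hedge M d th1) (vedge M d th2) i j +
    \sum_(q | bad q) s q * circ (hedge M d (tau1 (pole q))) (vedge M d (tau2 (pole q))) i j.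
  rewrite /circ /H /V.
  have -> : \sum_(q | bad q) s q * (hedge M d (tau1 (pole q)) i j
      + vedge M d (tau2 (pole q)) i.+1 j - hedge M d (tau1 (pole q)) i j.+1
      - vedge M d (tau2 (pole q)) i j) =
    \sum_(q | bad q) s q * hedge M d (tau1 (pole q)) i j
    + \sum_(q | bad q) s q * vedge M d (tau2 (pole q)) i.+1 j
    - \sum_(q | bad q) s q * hedge M d (tau1 (pole q)) i j.+1
    - \sum_(q | bad q) s q * vedge M d (tau2 (pole q)) i j.
    rewrite -big_split -sumrB -sumrB; apply: eq_bigr => q _ /=; ring.
  by ring.
(* A vortex centred in another cell is exact on this one and adds no circulation, so each bad cell
   feels only its own vortex and the strengths are determined independently. *)
have tau_pot i j (q : T) : (i, j) != (val q.1, val q.2) -> exists F,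
   (forall p, opcell i j p -> isd true F p (tau1 (pole q) p) /\ isd false F p (tau2 (pole q) p)) /\
    increments M d (hedge M d (tau1 (pole q))) (vedge M d (tau2 (pole q))) F i j.
  move=> ne; have [C1 C2] := CC_tau 1 (pole q).
  apply: (has_potential d0 (@dist2_open R (pole q)) _ C1 C2).
    by move=> p; exact: midcell_off.
  by move=> p; exact: tau_closed.
have th_pot i j : good i j -> exists F,
   (forall p, opcell i j p -> isd true F p (th1 p) /\ isd false F p (th2 p)) /\
    increments M d (hedge M d th1) (vedge M d th2) F i j.
  by move=> /asboolP cO; exact: (has_potential d0 oO cO Cth1 Cth2 th_closed).
have cellpot i j : good i j -> exists F,
   (forall p, opcell i j p -> isd true F p (beta1 h s p) /\ isd false F p (beta2 h s p)) /\
    increments M d H V F i j.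
  move=> gij; have [F0 [dF0 [i1 i2 i3 i4]]] := th_pot i j gij.
  have [F HF] : {F : T -> P -> R & forall q, bad q ->
     (forall p, opcell i j p -> isd true (F q) p (tau1 (pole q) p) /\ isd false (F q) p (tau2 (pole q) p)) /\
    increments M d (hedge M d (tau1 (pole q))) (vedge M d (tau2 (pole q))) (F q) i j}.
    apply: (@choice T (P -> R) (fun q F => bad q ->
     (forall p, opcell i j p -> isd true F p (tau1 (pole q) p) /\ isd false F p (tau2 (pole q) p)) /\
      increments M d (hedge M d (tau1 (pole q))) (vedge M d (tau2 (pole q))) F i j)) => q.
    have [bq|nb] := boolP (bad q); last by exists (fun=> 0).
    by have [F HF] := tau_pot i j q (bad_neq gij bq); exists F.
  exists (fun p => h^-1 * F0 p + \sum_(q | bad q) s q * F q p); split.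
    move=> p pij; split; apply: isdD.
    - by apply: isd_eq; [exact: (isdM (isd_cst true h^-1 p) (dF0 p pij).1)|rewrite mul0r add0r].
    - apply: isd_sum => q bq; have [dF _] := HF q bq.
      by apply: isd_eq; [exact: (isdM (isd_cst true (s q) p) (dF p pij).1)|rewrite mul0r add0r].
    - by apply: isd_eq; [exact: (isdM (isd_cst false h^-1 p) (dF0 p pij).2)|rewrite mul0r add0r].
    - apply: isd_sum => q bq; have [dF _] := HF q bq.
      by apply: isd_eq; [exact: (isdM (isd_cst false (s q) p) (dF p pij).2)|rewrite mul0r add0r].
  have S (E : T -> R) (w w' : P) : (forall q, bad q -> E q = F q w - F q w') ->
      \sum_(q | bad q) s q * E q = \sum_(q | bad q) s q * F q w - \sum_(q | bad q) s q * F q w'.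
    by move=> HE; rewrite -sumrB; apply: eq_bigr => q bq; rewrite HE// mulrBr.
  split.
  - rewrite /H i1 (S _ (gx i.+1, gx j) (gx i, gx j)); first by ring.
    by move=> q bq; have [_ []] := HF q bq.
  - rewrite /H i2 (S _ (gx i.+1, gx j.+1) (gx i, gx j.+1)); first by ring.
    by move=> q bq; have [_ []] := HF q bq.
  - rewrite /V i3 (S _ (gx i, gx j.+1) (gx i, gx j)); first by ring.
    by move=> q bq; have [_ []] := HF q bq.
  - rewrite /V i4 (S _ (gx i.+1, gx j.+1) (gx i.+1, gx j)); first by ring.
    by move=> q bq; have [_ []] := HF q bq.
have circ_per i j : (i < N)%N -> (j < N)%N -> period (circ H V i j).
  move=> iN jN; have [gij|bij] := boolP (good i j).
    by have [F [_ /increments_circ ->]] := cellpot i j gij; exact: period0.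
  pose q0 : T := (Ordinal iN, Ordinal jN).
  rewrite circE (bigD1 q0) //= big1 => [|q /andP[bq qq0]]; last first.
    have [|F [_ /increments_circ ->]] := tau_pot i j q; last exact: mulr0.
    apply: contra qq0 => /eqP[iq jq]; apply/eqP.
    by rewrite (surjective_pairing q) /q0; congr pair; apply: val_inj.
  rewrite addr0 -[circ (hedge M d (tau1 (pole q0))) _ i j]/(ka q0) /s divfK; last by rewrite gt_eqF.
  by have [_] := Hr q0.
have [Phi [PhiV PhiH]] := discrete_gauge circ_per.
exists s, Phi; split.
  move=> q; rewrite /s normrM normrN normfV (gtr0_norm (ka0 q)) ler_pdivrMr//.
  have [rq _] := Hr q; apply: (le_trans rq); apply: ler_peMr.
    by rewrite mulrn_wge0// pi_ge0.
  have := ka4 q; lra.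
move=> i j iN jN gij; have [F [dF [i1 i2 i3 i4]]] := cellpot i j gij.
(* Normalised to agree with [Phi] exactly at the lower left corner; the edge increments carry the
   agreement modulo 2 pi to the other three corners. *)
exists (fun p => Phi i j + (F p - F (gx i, gx j))); split.
  move=> p /dF [D1 D2]; split; apply: isd_eq.
  - exact: (isdD (isd_cst true _ p) (isdD D1 (isdN (isd_cst true _ p)))).
  - by rewrite add0r oppr0 addr0.
  - exact: (isdD (isd_cst false _ p) (isdD D2 (isdN (isd_cst false _ p)))).
  - by rewrite add0r oppr0 addr0.
move=> a b /orP[] /eqP -> /orP[] /eqP ->.
- by rewrite subrr addr0 subrr; exact: period0.
- rewrite -i3 -(PhiV i j) (_ : _ - _ = 0); [exact: period0|ring].
- have := PhiH i j iN (ltnW jN); rewrite i1; congr period; ring.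
- have := PhiH i j iN (ltnW jN); rewrite i1 => p1.
  rewrite (_ : _ - Phi i.+1 j.+1 = F (gx i.+1, gx j) - F (gx i, gx j) - (Phi i.+1 j - Phi i j))//.
  by have := PhiV i.+1 j; rewrite i4 => E; move: E; set x := F _; set y := F _; lra.
Qed.

End gauge.

(** * Gluing the local phases *)

Section gluing.
Variable R : realType.
Local Notation P := (R * R)%type.
Implicit Types (p : P).

Lemma ln_bound (a b x : R) : 0 < a -> a <= x <= b -> `|ln x| <= `|ln a| + `|ln b|.
Proof.
move=> a0 /andP[ax xb].
have x0 : 0 < x by exact: lt_le_trans ax.
have h1 : ln a <= ln x by rewrite ler_ln.
have h2 : ln x <= ln b by rewrite ler_ln// posrE (lt_le_trans x0).
have := ler_norm (ln b); have := ler_norm (- ln a); rewrite normrN => h3 h4.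
have := normr_ge0 (ln a); have := normr_ge0 (ln b) => h5 h6.
by rewrite ler_norml; apply/andP; split; lra.
Qed.

(** Overlapping enlarged cells have a common corner inside both. There the two potentials are
    compared, since both agree with [Phi] modulo 2 pi at corners. *)
Lemma opcell_meet (M d : R) (i k : nat) (x : R) : 0 < d ->
  gx M d i - d / 4 < x < gx M d i.+1 + d / 4 ->
  gx M d k - d / 4 < x < gx M d k.+1 + d / 4 ->
  exists a, [/\ (a == i) || (a == i.+1), (a == k) || (a == k.+1),
    gx M d i - d / 4 < gx M d a < gx M d i.+1 + d / 4 &
    gx M d k - d / 4 < gx M d a < gx M d k.+1 + d / 4].
Proof.
move=> d0 /andP[i1 i2] /andP[k1 k2].
have le_of (m n : nat) : gx M d m - d / 4 < x -> x < gx M d n.+1 + d / 4 -> (m <= n.+1)%N.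
  move=> h1 h2; rewrite leqNgt; apply/negP => nm.
  have := gx_le M d0 nm; have := gxS M d n.+1; lra.
have self m : gx M d m - d / 4 < gx M d m < gx M d m.+1 + d / 4.
  by have := gxS M d m => E; apply/andP; split; lra.
have selfS m : gx M d m - d / 4 < gx M d m.+1 < gx M d m.+1 + d / 4.
  by have := gxS M d m => E; apply/andP; split; lra.
have ik := le_of i k i1 k2; have ki := le_of k i k1 i2.
have [lt|gt|->] := ltngtP i k.
- exists k; have -> : k = i.+1 by apply/eqP; rewrite eqn_leq ki.
  by rewrite !eqxx orbT self selfS.
- exists i; have -> : i = k.+1 by apply/eqP; rewrite eqn_leq ik.
  by rewrite !eqxx orbT self selfS.
- by exists k; rewrite !eqxx self.
Qed.

(* Up to the factor [exp (- S)] with [S] harmonic and bounded independently of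
   [h], the flat connection [th / h] has the unimodular section [c + i s]; [S]
   compensates the holonomies of [th / h], which need not be trivial. *)
Lemma flat_phase (O K : set P) (M : R) (th1 th2 : P -> R) :
  open O -> O `<=` sq M -> compact K -> K `<=` O -> CC 1 O th1 -> CC 1 O th2 ->
  (forall p, O p -> pd true th2 p = pd false th1 p) ->
  exists (V : set P) (C : R), [/\ open V, K `<=` V, V `<=` O &
    forall h : R, exists S c s : P -> R,
      [/\ CC 2 V S, forall p, V p -> `|S p| <= C, CC 2 V c, CC 2 V s &
       forall p, V p -> [/\ c p ^+ 2 + s p ^+ 2 = 1,
         isd true c p (- s p * (h^-1 * th1 p - pd false S p)),
         isd true s p (c p * (h^-1 * th1 p - pd false S p)),
         isd false c p (- s p * (h^-1 * th2 p + pd true S p)) &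
         isd false s p (c p * (h^-1 * th2 p + pd true S p))]]].
Proof.
move=> oO OM cK KO C1 C2 cl.
have [d4 d40 Kd4] := compact_box oO cK KO.
(* A point within 5 d / 4 of [K] and any point of its enlarged cell are less than 5 d / 2 from [K],
   within the margin 4 d inside [O]: such cells are good. *)
pose d := d4 / 4; have d0 : 0 < d by rewrite divr_gt0.
have d4E : d4 = 4 * d by rewrite /d; field.
pose N := (Num.truncn (2 * M / d)).+1.
have Nd : 2 * M < N%:R * d by rewrite -ltr_pdivrMr//; exact: truncnS_gt.
pose V : set P := \bigcup_(k in K) box k d.
pose ix (x : R) := Num.truncn ((x + M) / d).
have ixP p : O p -> [/\ gx M d (ix p.1) <= p.1 < gx M d (ix p.1).+1,
    gx M d (ix p.2) <= p.2 < gx M d (ix p.2).+1, (ix p.1 < N)%N & (ix p.2 < N)%N].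
  move=> /OM[]; rewrite !ler_norml => /andP[a1 a2] /andP[b1 b2].
  have one x : - M <= x -> x <= M -> (gx M d (ix x) <= x < gx M d (ix x).+1) /\ (ix x < N)%N.
    move=> x1 x2; have x0 : 0 <= (x + M) / d by apply: divr_ge0; [lra|exact: ltW].
    have /andP[t1 t2] := truncn_itv x0.
    split.
      move: t1 t2; rewrite -/(ix x) ler_pdivlMr// ltr_pdivrMr// /gx => t1 t2.
      by apply/andP; split; lra.
    rewrite ltnS; apply: le_truncn; rewrite ler_pM2r ?invr_gt0//; lra.
  by have [? ?] := one _ a1 a2; have [? ?] := one _ b1 b2.
(* The extra d/4 covers not only the points of [V] but also the boxes of radius d/4 around them, on
   which the local phases are compared. *)
have nearK (q k : P) : K k -> `|q.1 - k.1| < d + d / 4 -> `|q.2 - k.2| < d + d / 4 ->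
    O q /\ good O M d (ix q.1) (ix q.2).
  rewrite !ltr_distl => Kk /andP[a1 a2] /andP[b1 b2].
  have Oq : O q.
    by apply: (Kd4 k Kk); split; rewrite ltr_distl; apply/andP; split; lra.
  have [/andP[x1 x2] /andP[y1 y2] _ _] := ixP q Oq.
  have ih := gxS M d (ix q.1); have jh := gxS M d (ix q.2).
  split=> //; apply/asboolP => r [/andP[r1 r2] /andP[r3 r4]].
  by apply: (Kd4 k Kk); split; rewrite ltr_distl; apply/andP; split; lra.
have ltd (x : R) : x < d -> x < d + d / 4.
  by move=> xd; have dd := d0; lra.
have VO : V `<=` O.
  by move=> p [k Kk [p1 p2]]; have [] := nearK p k Kk (ltd _ p1) (ltd _ p2).
pose T := ('I_N * 'I_N)%type.
have Vcell p : V p -> [/\ good O M d (ix p.1) (ix p.2), (ix p.1 < N)%N, (ix p.2 < N)%N &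
    opcell M d (ix p.1) (ix p.2) p].
  move=> Vp; have := Vp => -[k Kk [p1 p2]].
  have [_ g] := nearK p k Kk (ltd _ p1) (ltd _ p2).
  have [/andP[? ?] /andP[? ?] ? ?] := ixP p (VO p Vp); split=> //.
  by split; apply/andP; split; lra.
have [D D0 HD] : exists2 D : R, 0 < D & forall p (q : T), O p -> dist2 (pole M d q) p <= D.
  pose E := 2 * `|M| + (N%:R + 1) * d.
  have E0 : 0 < E by rewrite ltr_wpDl// ?mulr_ge0// mulr_gt0// ltr_wpDl.
  exists (E ^+ 2 + E ^+ 2); first by rewrite addr_gt0 ?exprn_gt0.
  move=> p [q1 q2] /OM[]; rewrite !ler_norml => /andP[a1 a2] /andP[b1 b2].
  have one (x : R) (i : 'I_N) : - M <= x -> x <= M -> (x - (gx M d i + d / 2)) ^+ 2 <= E ^+ 2.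
    move=> x1 x2; rewrite -(real_normK (num_real (x - _))) lerXn2r ?nnegrE//; first exact: ltW.
    have i0 : 0 <= i%:R * d by rewrite mulr_ge0// ltW.
    have iN : i%:R * d <= N%:R * d by rewrite ler_pM2r// ler_nat ltnW.
    have M1 := ler_norm M; have M2 := ler_norm (- M); rewrite normrN in M2.
    rewrite /gx /E mulrDl mul1r ler_norml; apply/andP; split; lra.
  by rewrite /dist2 /= lerD// one.
pose A := (d / 4) ^+ 2; have A0 : 0 < A by rewrite exprn_gt0// divr_gt0.
(* Each vortex contributes at most its maximal strength times a bound on half the logarithm, the
   squared distance to its pole lying between [A] and [D]. Only the grid enters, not h. *)
pose c0 : R := pi *+ 2 * (2^-1 * (`|ln A| + `|ln D|)).
exists V, (\sum_(q : T | bad O M d q) c0); split=> //.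
- by apply: bigcup_open => k _; exact: box_open.
- by move=> k Kk; exists k => //; split; rewrite subrr normr0.
move=> h.
have [s_ [Phi [s_le pots]]] := @cell_potentials R O M d N th1 th2 oO d0 C1 C2 cl h.
have [G HG] : {G : nat * nat -> P -> R & forall ij, (ij.1 < N)%N -> (ij.2 < N)%N ->
    good O M d ij.1 ij.2 ->
    (forall p, opcell M d ij.1 ij.2 p ->
       isd true (G ij) p (beta1 O M d th1 h s_ p) /\ isd false (G ij) p (beta2 O M d th2 h s_ p)) /\
    forall a b, (a == ij.1) || (a == ij.1.+1) -> (b == ij.2) || (b == ij.2.+1) ->
      period (G ij (gx M d a, gx M d b) - Phi a b)}.
  apply: (@choice (nat * nat)%type (P -> R) (fun ij G => (ij.1 < N)%N -> (ij.2 < N)%N ->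
    good O M d ij.1 ij.2 ->
    (forall p, opcell M d ij.1 ij.2 p ->
       isd true G p (beta1 O M d th1 h s_ p) /\ isd false G p (beta2 O M d th2 h s_ p)) /\
    forall a b, (a == ij.1) || (a == ij.1.+1) -> (b == ij.2) || (b == ij.2.+1) ->
      period (G (gx M d a, gx M d b) - Phi a b))) => -[i j] /=.
  have [/and3P[iN jN gij]|nb] := boolP [&& (i < N)%N, (j < N)%N & good O M d i j].
    by have [F HF] := pots i j iN jN gij; exists F.
  by exists (fun=> 0) => iN jN gij; exfalso; move: nb; rewrite iN jN gij.
(* The harmonic conjugate of the vortices: its rotated gradient is their sum, so the corrected form
   is th / h plus the rotated gradient of S. *)
pose S p := \sum_(q | bad O M d q) s_ q * (2^-1 * ln (dist2 (pole M d q) p)).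
have far p (q : T) : V p -> bad O M d q -> A <= dist2 (pole M d q) p.
  move=> Vp bq; have [g _ _ /(clcell_sub) pc] := Vcell p Vp.
  by apply: midcell_far pc => //; exact: bad_neq bq.
have pos p (q : T) : V p -> bad O M d q -> 0 < dist2 (pole M d q) p.
  by move=> Vp bq; exact: lt_le_trans (far p q Vp bq).
have dS (b : bool) p : V p -> isd b S p
   (\sum_(q | bad O M d q) s_ q * (if b then tau2 (pole M d q) p else - tau1 (pole M d q) p)).
  move=> Vp; apply: isd_sum => q bq; apply: isd_eq.
    exact: (isdM (isd_cst b (s_ q) p) (isd_ln_dist2 b (pos p q Vp bq))).
  by rewrite mul0r add0r.
have S1 p : V p -> h^-1 * th1 p - pd false S p = beta1 O M d th1 h s_ p.
  move=> Vp; have [_ ->] := isd_pd (dS false p Vp); rewrite /beta1 -sumrN.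
  by congr (_ + _); apply: eq_bigr => q _; rewrite mulrN opprK.
have S2 p : V p -> h^-1 * th2 p + pd true S p = beta2 O M d th2 h s_ p.
  by move=> Vp; have [_ ->] := isd_pd (dS true p Vp).
pose ci p := (ix p.1, ix p.2).
(* The potential of the cell containing the point jumps from cell to cell, but by multiples of 2 pi;
   its cosine and sine therefore coincide locally with those of a single smooth potential. *)
have glue (p q : P) : V p -> box p (d / 4) q ->
    cos (G (ci q) q) = cos (G (ci p) q) /\ sin (G (ci q) q) = sin (G (ci p) q).
  move=> Vp [q1 q2]; have [gp pN1 pN2 pc] := Vcell p Vp.
  have := Vp => -[k Kk [p1 p2]].
  have ltq (x y z : R) : `|y - x| < d / 4 -> `|x - z| < d -> `|y - z| < d + d / 4.
    by move=> h1 h2; rewrite (addrC d); apply: le_lt_trans (ler_distD x y z) (ltrD h1 h2).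
  have [Oq gq] := nearK q k Kk (ltq _ _ _ q1 p1) (ltq _ _ _ q2 p2).
  have [/andP[x1 x2] /andP[y1 y2] qN1 qN2] := ixP q Oq.
  have qcq : opcell M d (ix q.1) (ix q.2) q by split; apply/andP; split; lra.
  have [/andP[u1 u2] /andP[v1 v2] _ _] := ixP p (VO p Vp).
  have qcp : opcell M d (ix p.1) (ix p.2) q.
    by move: q1 q2; rewrite !ltr_distl => /andP[? ?] /andP[? ?]; split; apply/andP; split; lra.
  have [dq verq] := HG (ci q) qN1 qN2 gq; have [dp verp] := HG (ci p) pN1 pN2 gp.
  have [a [a1 a2 a3 a4]] := opcell_meet d0 qcq.1 qcp.1.
  have [b [b1 b2 b3 b4]] := opcell_meet d0 qcq.2 qcp.2.
  apply: period_eq.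
  pose IA (x : R) := (gx M d (ix q.1) - d / 4 < x < gx M d (ix q.1).+1 + d / 4) /\
    (gx M d (ix p.1) - d / 4 < x < gx M d (ix p.1).+1 + d / 4).
  pose IB (x : R) := (gx M d (ix q.2) - d / 4 < x < gx M d (ix q.2).+1 + d / 4) /\
    (gx M d (ix p.2) - d / 4 < x < gx M d (ix p.2).+1 + d / 4).
  have conv (l r x y z : R) : l < x < r -> l < y < r -> x <= z <= y -> l < z < r.
    move=> /andP[lx xr] /andP[ly yr] /andP[xz zy].
    by rewrite (lt_le_trans lx xz) (le_lt_trans zy yr).
  (* Both potentials have the same gradient on the overlap, a rectangle, so their difference there
     is its value at the common corner. *)
  have E : G (ci q) q - G (ci p) q =
      G (ci q) (gx M d a, gx M d b) - G (ci p) (gx M d a, gx M d b).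
    apply: (@rect_constant R IA IB (fun r => G (ci q) r - G (ci p) r)) => //.
    - move=> x y z [? ?] [? ?] xzy; split; exact: conv xzy.
    - move=> x y z [? ?] [? ?] xzy; split; exact: conv xzy.
    - move=> r b' [r1 r2] [r3 r4].
      have [D1 D2] := dq r (conj r1 r3); have [D1' D2'] := dp r (conj r2 r4).
      by case: b'; apply: isd_eq;
        [exact: (isdD D1 (isdN D1'))|exact: subrr|exact: (isdD D2 (isdN D2'))|exact: subrr].
    - by split; [exact: qcq.1|exact: qcp.1].
    - by split; [exact: qcq.2|exact: qcp.2].
  rewrite E.
  have := periodB (verq a b a1 b1) (verp a b a2 b2).
  by congr period; ring.
have dG p b : V p -> isd b (G (ci p)) p (if b then beta1 O M d th1 h s_ p else beta2 O M d th2 h s_ p).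
  move=> Vp; have [gp pN1 pN2 pc] := Vcell p Vp.
  by have [dp _] := HG (ci p) pN1 pN2 gp; have [? ?] := dp p pc; case: b.
have CG p : V p -> CC 2 (opcell M d (ix p.1) (ix p.2)) (G (ci p)).
  move=> Vp; have [gp pN1 pN2 pc] := Vcell p Vp.
  have [dp _] := HG (ci p) pN1 pN2 gp.
  have /asboolP clO := gp.
  have opO : opcell M d (ix p.1) (ix p.2) `<=` O by move=> r /(clcell_sub)/clO.
  have off r q : opcell M d (ix p.1) (ix p.2) r -> bad O M d q -> 0 < dist2 (pole M d q) r.
    by move=> /(clcell_sub) rc bq; apply: midcell_off rc => //; exact: bad_neq bq.
  have Cb1 : CC 1 (opcell M d (ix p.1) (ix p.2)) (beta1 O M d th1 h s_).
    apply: CCD; first by apply: CCM; [exact: CC_cst|exact: CC_sub C1].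
    apply: CC_sum => q bq; apply: CCM; first exact: CC_cst.
    by have [+ _] := CC_tau 1 (pole M d q); apply: CC_sub => r rc; exact: off.
  have Cb2 : CC 1 (opcell M d (ix p.1) (ix p.2)) (beta2 O M d th2 h s_).
    apply: CCD; first by apply: CCM; [exact: CC_cst|exact: CC_sub C2].
    apply: CC_sum => q bq; apply: CCM; first exact: CC_cst.
    by have [_] := CC_tau 1 (pole M d q); apply: CC_sub => r rc; exact: off.
  pose dd (b : bool) := if b then beta1 O M d th1 h s_ else beta2 O M d th2 h s_.
  have Hdd b r : opcell M d (ix p.1) (ix p.2) r -> isd b (G (ci p)) r (dd b r).
    by move=> /dp [? ?]; case: b.
  have Cdd b : CC 1 (opcell M d (ix p.1) (ix p.2)) (dd b) by case: b.
  split.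
    have [+ _] := CC0_of_isd (@opcell_open R M d d0 _ _) Hdd (fun b => CCW (Cdd b)).
    exact.
  by exists dd => b; split=> [r|]; [exact: Hdd|exact: Cdd].
pose W p := box p (d / 4) `&` opcell M d (ix p.1) (ix p.2).
have oW p : open (W p) by apply: openI; [exact: box_open|exact: opcell_open].
have Wp p : V p -> W p p.
  move=> Vp; have [_ _ _ pc] := Vcell p Vp; split=> //.
  by split; rewrite subrr normr0 divr_gt0.
have C_cos_sin : CC 2 V (fun p => cos (G (ci p) p)) /\ CC 2 V (fun p => sin (G (ci p) p)).
  split; apply: CC_local => p Vp; exists (W p); (split; [exact: oW|exact: Wp|]).
    apply: (@CC_ext _ _ _ (fun q => cos (G (ci p) q))) => //.
      by move=> q [qb _]; have [-> _] := glue p q Vp qb.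
    by apply: (CC_cossin _).1; apply: CC_sub (CG p Vp) => q [].
  apply: (@CC_ext _ _ _ (fun q => sin (G (ci p) q))) => //.
    by move=> q [qb _]; have [_ ->] := glue p q Vp qb.
  by apply: (CC_cossin _).2; apply: CC_sub (CG p Vp) => q [].
exists S, (fun p => cos (G (ci p) p)), (fun p => sin (G (ci p) p)); split.
- apply: CC_sum => q bq; apply: CCM; first exact: CC_cst.
  apply: CCM; first exact: CC_cst.
  by apply: CC_ln; [move=> p Vp; exact: pos|exact: CC_dist2].
- move=> p Vp; apply: (le_trans (ler_norm_sum _ _ _)); apply: ler_sum => q bq.
  rewrite normrM /c0; apply: ler_pM => //.
  rewrite normrM (ger0_norm (_ : 0 <= 2^-1))// ler_wpM2l//.
  apply: ln_bound => //; apply/andP; split; first exact: far.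
  by apply: HD; exact: VO.
- exact: C_cos_sin.1.
- exact: C_cos_sin.2.
move=> p Vp; rewrite S1// S2//.
have bp : nbhs p (box p (d / 4)) by apply: box_nbhs; rewrite divr_gt0.
have isc b l : isd b (fun q => cos (G (ci p) q)) p l -> isd b (fun q => cos (G (ci q) q)) p l.
  apply: isd_near; apply: filterS bp => q qb; by have [] := glue p q Vp qb.
have iss b l : isd b (fun q => sin (G (ci p) q)) p l -> isd b (fun q => sin (G (ci q) q)) p l.
  apply: isd_near; apply: filterS bp => q qb; by have [] := glue p q Vp qb.
split.
- exact: cos2Dsin2.
- by apply: isc; exact: (isd_comp (is_derive_cos _) (dG p true Vp)).
- by apply: iss; exact: (isd_comp (is_derive_sin _) (dG p true Vp)).
- by apply: isc; exact: (isd_comp (is_derive_cos _) (dG p false Vp)).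
- by apply: iss; exact: (isd_comp (is_derive_sin _) (dG p false Vp)).
Qed.

End gluing.

(** * The trial states and the limit *)

Section upper_bound.
Variable R : realType.
Local Notation P := (R * R)%type.
Local Notation mu := (@leb2 R).
Implicit Types (p : P).

Lemma leb2_box (p : P) (r : R) : 0 < r -> mu (box p r) = ((r *+ 2) * (r *+ 2))%:E.
Proof.
move=> r0; have B (x : R) : lebesgue_measure (ball x r) = (r *+ 2)%:E.
  by rewrite lebesgue_measure_ball// ltW.
rewrite box_ball /leb2 product_measure1E; [|exact: measurable_ball|exact: measurable_ball].
by rewrite EFinM; congr (_ * _)%E; exact: B.
Qed.

(** Here [m] is any upper bound of [psi] on a small box, which spares a minimiser and any
    information on [psi] near one. The constant [D] is chosen before h, which rests on the uniform
    bound of [flat_phase]. *)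
Lemma upper_test (O K : set P) (M : R) (A1 A2 B psi : P -> R) (m e r : R) (p0 : P) :
  open O -> O `<=` sq M -> 0 < M -> CC 1 O A1 -> CC 1 O A2 -> CC 0 O B -> CC 2 O psi ->
  (forall p, O p -> pd true A2 p - pd false A1 p = B p) ->
  (forall p, O p -> pd true (pd true psi) p + pd false (pd false psi) p = B p) ->
  compact K -> K `<=` O -> (forall p, O p -> ~ K p -> - e <= psi p) ->
  0 < r -> box p0 r `<=` K -> (forall p, box p0 r p -> psi p <= m) ->
  exists2 D : R, 0 < D & forall h, 0 < h -> exists a a1 a2 b b1 b2 : P -> R,
    [/\ H10 O a a1 a2, H10 O b b1 b2,
        fine (\int[mu]_(p in O) ((a p ^+ 2 + b p ^+ 2)%:E))%E != 0 &
        pauli_rayleigh O h A1 A2 B a a1 a2 b b1 b2 <= D * h ^+ 2 * expR (2 * (m + e) / h)].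
Proof.
move=> oO OM M0 C1 C2 CB Cpsi curlA lap cK KO psi_e r0 boxK psi_m.
have [dpsi1 Cpsi1] := CC_pd true oO Cpsi; have [dpsi2 Cpsi2] := CC_pd false oO Cpsi.
pose th1 p := A1 p + pd false psi p; pose th2 p := A2 p - pd true psi p.
have Cth1 : CC 1 O th1 by exact: CCD.
have Cth2 : CC 1 O th2 by exact: CCB.
have cl p : O p -> pd true th2 p = pd false th1 p.
  move=> Op.
  have [_ E1] := isd_pd (isdD ((CC_pd true oO C2).1 p Op) (isdN ((CC_pd true oO Cpsi1).1 p Op))).
  have [_ E2] := isd_pd (isdD ((CC_pd false oO C1).1 p Op) ((CC_pd false oO Cpsi2).1 p Op)).
  rewrite -[th2]/(fun q => A2 q - pd true psi q) -[th1]/(fun q => A1 q + pd false psi q) E1 E2.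
  have := curlA p Op; rewrite -(lap p Op).
  move: (pd true (pd true psi) p) (pd false (pd false psi) p) (pd true A2 p) (pd false A1 p).
  by clear => w x y z E; lra.
have [V [C [oV KV VO phase]]] := flat_phase oO OM cK KO Cth1 Cth2 cl.
have [chi [[schi [K' [cK' K'V chi0]]] chi01 chi1]] := cutoff oV cK KV.
have clK' : closed K' by apply: compact_closed => //; exact: norm_hausdorff.
have K'O : K' `<=` O by move=> p /K'V/VO.
have K'M : K' `<=` sq M by move=> p /K'O/OM.
have tchi : tf K' 2 chi by split=> //; exact: CC_of_smooth.
have tchi1 := tf_pd clK' true tchi; have tchi2 := tf_pd clK' false tchi.
pose G p := pd true chi p ^+ 2 + pd false chi p ^+ 2.
have tG : tf K' 1 G by apply: (tf_mass oV clK' K'V tchi1 tchi2).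
have IG := tfI K'M tG.
have G0 : 0 <= I2 G by apply: Rintegral_ge0 => p _; rewrite addr_ge0 ?sqr_ge0.
have GK p : K p -> G p = 0.
  move=> Kp; have E b : pd b chi p = 0.
    have H : isd b chi p 0.
      by apply: isd_near (isd_cst b 1 p); apply: filterS (chi1 p Kp) => q ->.
    by have [] := isd_pd H.
  by rewrite /G !E expr0n addr0.
pose n0 := I2 (\1_(box p0 r) : P -> R).
have Ibox : mu.-integrable setT (EFin \o (\1_(box p0 r) : P -> R)).
  apply: (@bounded_sq_integrable _ M _ 1).
  - by apply: measurable_indic; exact: box_measurable.
  - by move=> p; rewrite indicE; case: (_ \in _); rewrite ?normr1 ?normr0.
  - move=> p nM; rewrite indicE; have [/set_mem/boxK/KO/OM//|//] := boolP (p \in _).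
have n00 : 0 < n0.
  suff -> : n0 = (r *+ 2) * (r *+ 2) by rewrite mulr_gt0// mulrn_wgt0.
  rewrite /n0 /I2 /Rintegral integral_indic//; last exact: box_measurable.
  by rewrite setIT; exact: (congr1 fine (leb2_box p0 r0)).
(* One factor exp (2 C) is lost on S in the energy and another in the mass; [n0] is the area of the
   box. The 1 secures positivity. *)
exists (expR (4 * C) * I2 G / n0 + 1).
  by rewrite ltr_wpDl// divr_ge0 ?mulr_ge0 ?expR_ge0// ltW.
move=> h h0.
have [S [c [s [CS SC Cc Cs dphase]]]] := phase h.
pose E p := expR (- h^-1 * psi p + S p).
have CE : CC 2 V E.
  by apply: CC_exp; apply: CCD CS; apply: CCM; [exact: CC_cst|exact: CC_sub Cpsi].
pose a p := (E p * c p) * chi p; pose b p := (E p * s p) * chi p.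
have ta : tf K' 2 a by apply: (tfMl oV clK' K'V _ tchi); exact: CCM.
have tb : tf K' 2 b by apply: (tfMl oV clK' K'V _ tchi); exact: CCM.
have out k u p : tf K' k u -> ~ O p -> u p = 0.
  by move=> t nO; apply: (tf0 t) => /K'O.
have tm := tf_mass oV clK' K'V ta tb.
have tk := tf_kin oO clK' K'O h (CCW C1) (CCW C2) (tfW ta) (tfW tb).
have td := tf_dbar oO clK' K'O h (CCW C1) (CCW C2) (tfW ta) (tfW tb).
have tB : tf K' 0 (fun p => B p * mass a b p).
  by apply: (tfMl oO clK' K'O CB); exact: tfW (tfW tm).
have massE p : V p -> mass a b p = E p ^+ 2 * chi p ^+ 2.
  move=> Vp; have [cs1 _ _ _ _] := dphase p Vp.
  by rewrite -[RHS]mul1r -cs1 /mass /a /b; ring.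
(* The factor of chi in the trial state is annihilated by pi_1 + i pi_2, the derivatives of [psi], S
   and the phase cancelling against [A]; only the gradient of chi survives. *)
have dbarE p : K' p -> dbar h A1 A2 a (pd true a) (pd false a) b (pd true b) (pd false b) p
    = h ^+ 2 * E p ^+ 2 * G p.
  move=> K'p; have Vp := K'V p K'p; have Op := VO p Vp.
  have [cs1 dc1 ds1 dc2 ds2] := dphase p Vp.
  have dE (u : bool) : isd u E p (E p * (- h^-1 * pd u psi p + pd u S p)).
    apply: (isd_comp (is_derive_expR _)); apply: isdD; last exact: (CC_pd u oV CS).1.
    apply: isd_eq (isdM (isd_cst u (- h^-1) p) ((CC_pd u oO Cpsi).1 p Op)) _.
    by rewrite mul0r add0r.
  have dchi u := tf_isd u p tchi.
  have [_ a1E] := isd_pd (isdM (isdM (dE true) dc1) (dchi true)).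
  have [_ a2E] := isd_pd (isdM (isdM (dE false) dc2) (dchi false)).
  have [_ b1E] := isd_pd (isdM (isdM (dE true) ds1) (dchi true)).
  have [_ b2E] := isd_pd (isdM (isdM (dE false) ds2) (dchi false)).
  rewrite /dbar -[a]/(fun p => (E p * c p) * chi p) -[b]/(fun p => (E p * s p) * chi p).
  rewrite a1E a2E b1E b2E /G /th1 /th2.
  rewrite -[RHS]mul1r -cs1.
  have hn : h != 0 by rewrite gt_eqF.
  move: (pd true chi p) (pd false chi p) (pd true psi p) (pd false psi p)
    (pd true S p) (pd false S p) (E p) (c p) (s p) (chi p) (A1 p) (A2 p) => *.
  by field.
have I_le : I2 (dbar h A1 A2 a (pd true a) (pd false a) b (pd true b) (pd false b))
    <= h ^+ 2 * expR (2 * (e / h + C)) * I2 G.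
  rewrite -I2Z//; apply: I2_le; [exact: (tfI K'M td)|exact: (tfI K'M (tfZ oO clK' K'O _ tG))|].
  move=> p; have [K'p|nK'] := pselect (K' p); last first.
    by rewrite (tf0 td nK') (tf0 tG nK') mulr0.
  rewrite dbarE//; have [Kp|nK] := pselect (K p); first by rewrite GK// !mulr0.
  have Vp := K'V p K'p.
  apply: ler_wpM2r; first by rewrite addr_ge0 ?sqr_ge0.
  apply: ler_wpM2l; first exact: sqr_ge0.
  rewrite /E -expRM_natl ler_expR ler_wpM2l// lerD//; last by have := SC p Vp; rewrite ler_norml => /andP[].
  rewrite mulNr (mulrC h^-1) -mulNr ler_wpM2r ?invr_ge0 ?(ltW h0)//.
  by rewrite lerNl psi_e//; exact: VO.
have m_ge : expR (- (2 * (m / h + C))) * n0 <= I2 (mass a b).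
  rewrite -I2Z//; apply: I2_le; [|exact: (tfI K'M tm)|].
    by apply: eq_integrable (integrableZl _ (expR (- (2 * (m / h + C)))) Ibox) => //.
  move=> p; rewrite indicE; have [/set_mem bp|_] := boolP (p \in box p0 r); last first.
    by rewrite mulr0 addr_ge0 ?sqr_ge0.
  have Kp := boxK p bp; have Vp := KV p Kp.
  rewrite mulr1 massE// (nbhs_singleton (chi1 p Kp)) expr1n mulr1.
  rewrite /E -expRM_natl ler_expR -mulrN ler_wpM2l// opprD lerD//; last by have := SC p Vp; rewrite ler_norml => /andP[].
  by rewrite mulNr lerN2 (mulrC h^-1) ler_wpM2r ?invr_ge0 ?(ltW h0)// psi_m.
have m_gt : 0 < I2 (mass a b) by apply: lt_le_trans m_ge; rewrite mulr_gt0 ?expR_gt0.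
have mE : fine (\int[mu]_(p in O) ((a p ^+ 2 + b p ^+ 2)%:E))%E = I2 (mass a b).
  by rewrite (@I2_on _ O)// => p; exact: out tm.
exists a, (pd true a), (pd false a), b, (pd true b), (pd false b); split.
- exact: (tf_H10 oO OM M0 cK' K'O ta).
- exact: (tf_H10 oO OM M0 cK' K'O tb).
- by rewrite mE gt_eqF.
rewrite /pauli_rayleigh mE.
rewrite -[X in X - _]/(Rintegral mu O (kin h A1 A2 a (pd true a) (pd false a) b (pd true b) (pd false b))).
rewrite -[fine (\int[mu]_(p in O) _)]/(Rintegral mu O (fun p => B p * mass a b p)).
rewrite -(@I2_on _ O); last by move=> p; exact: out tk.
rewrite -(@I2_on _ O); last by move=> p; exact: out tB.
rewrite (pauli_identity oO clK' K'O K'M h C1 C2 CB curlA ta tb).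
rewrite ler_pdivrMr//.
apply: (le_trans I_le).
have h20 := sqr_ge0 h.
apply: (@le_trans _ _ ((expR (4 * C) * I2 G / n0) * h ^+ 2 * expR (2 * (m + e) / h)
    * (expR (- (2 * (m / h + C))) * n0))); last first.
  apply: ler_pM => //.
  - by rewrite !mulr_ge0 ?expR_ge0 ?divr_ge0// ?invr_ge0 ltW.
  - by rewrite mulr_ge0 ?expR_ge0// ltW.
  by rewrite ler_wpM2r ?expR_ge0// ler_wpM2r// lerDl.
(* Splits the energy exponent into the claimed rate, the constant exp (4 C) and the exponent of the
   lower bound on the mass. *)
have -> : expR (2 * (e / h + C)) = expR (4 * C) * expR (2 * (m + e) / h) * expR (- (2 * (m / h + C))).
  by rewrite -!expRD; congr expR; field; rewrite gt_eqF.
rewrite le_eqVlt; apply/orP; left; apply/eqP.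
move: (expR (4 * C)) (expR (2 * (m + e) / h)) (expR (- _)) (I2 G) => *.
by field; rewrite gt_eqF.
Qed.

End upper_bound.

(** * Logarithmic limit of two-sided exponential bounds *)

Section log_limit.
Variable R : realType.

(** After h log the bounds become h ln c + 2 h ln h + m and h ln D + 2 h ln h + m + e. The constant
    [D] may depend on e, which is fixed before h tends to 0; the lower bound also keeps [lam h]
    positive, so that [ln] is monotone on all the values compared. *)
Lemma log_limit (lam : R -> R) (m c C : R) : 0 < c -> 0 < C ->
  (forall h, 0 < h <= C -> c * h ^+ 2 * expR (m / h) <= lam h) ->
  (forall e, 0 < e -> exists2 D, 0 < D &
     forall h, 0 < h <= C -> lam h <= D * h ^+ 2 * expR ((m + e) / h)) ->
  (fun h => h * ln (lam h)) @ 0^'+ --> m.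
Proof.
move=> c0 C0 lower upper; apply/cvgrPdist_le => e e0.
have e20 : 0 < e / 2 by rewrite divr_gt0.
have [D D0 lamD] := upper (e / 2) e20.
pose d1 := e / 2 / (`|ln D| + 1); pose d2 := e / 2 / (`|ln c| + 1).
have b1 (x : R) : 0 < `|x| + 1 by rewrite ltr_wpDl.
have d10 : 0 < d1 by rewrite !divr_gt0.
have d20 : 0 < d2 by rewrite !divr_gt0.
have d30 : 0 < (e / 8) ^+ 2 by rewrite exprn_gt0// divr_gt0.
near=> h.
have h0 : 0 < h by near: h; exact: nbhs_right_gt.
have hC : h <= C by apply: ltW; near: h; exact: nbhs_right_lt.
have h1 : h <= 1 by apply: ltW; near: h; exact: nbhs_right_lt.
have hd1 : h <= d1 by apply: ltW; near: h; exact: nbhs_right_lt.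
have hd2 : h <= d2 by apply: ltW; near: h; exact: nbhs_right_lt.
(* Matched to h ln h >= - 2 sqrt h: the term 2 h ln h is then at least - e / 2. The upper estimate
   only needs h ln h <= 0, from h <= 1. *)
have hd3 : h <= (e / 8) ^+ 2 by apply: ltW; near: h; exact: nbhs_right_lt.
have hh : 0 < h <= C by rewrite h0.
have lam_lo := lower h hh; have lam_up := lamD h hh.
have lnE (D' m' : R) : 0 < D' -> h * ln (D' * h ^+ 2 * expR (m' / h)) =
    h * ln D' + 2 * (h * ln h) + m'.
  move=> D'0; rewrite lnM ?posrE ?mulr_gt0 ?exprn_gt0 ?expR_gt0//.
  rewrite lnM ?posrE ?exprn_gt0// expRK lnXn// -mulr_natl.
  by field; rewrite gt_eqF.
have pos (D' m' : R) : 0 < D' -> 0 < D' * h ^+ 2 * expR (m' / h).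
  by move=> D'0; rewrite !mulr_gt0 ?exprn_gt0 ?expR_gt0.
have lam0 : 0 < lam h by apply: lt_le_trans lam_lo; exact: pos.
have : h * ln (c * h ^+ 2 * expR (m / h)) <= h * ln (lam h).
  by rewrite ler_pM2l// ler_ln ?posrE// pos.
have : h * ln (lam h) <= h * ln (D * h ^+ 2 * expR ((m + e / 2) / h)).
  by rewrite ler_pM2l// ler_ln ?posrE// pos.
rewrite !lnE// => up lo.
have small (x d : R) : d = e / 2 / (`|x| + 1) -> h <= d -> `|h * x| <= e / 2.
  move=> -> hd; rewrite normrM gtr0_norm//.
  apply: (@le_trans _ _ (h * (`|x| + 1))); first by rewrite ler_pM2l// lerDl.
  by rewrite -ler_pdivlMr.
have sD := small (ln D) d1 erefl hd1; have sc := small (ln c) d2 erefl hd2.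
have lnh : h * ln h <= 0 by rewrite pmulr_rle0// ln_le0.
have sh : 0 < Num.sqrt h by rewrite sqrtr_gt0.
have hs : Num.sqrt h ^+ 2 = h by rewrite sqr_sqrtr// ltW.
have she : Num.sqrt h <= e / 8.
  by rewrite -(ler_pXn2r (n := 2))// ?nnegrE ?ltW ?divr_gt0// hs.
(* With x = sqrt h, the inequality ln (1/x) < 1/x is multiplied by x^2, and ln h = 2 ln x. *)
have lnh2 : - (2 * Num.sqrt h) <= h * ln h.
  rewrite -{2 3}hs lnXn//; move: (Num.sqrt h) sh => x x0.
  have H : ln x^-1 < x^-1 by apply: ln_sublinear; rewrite invr_gt0.
  have : x ^+ 2 * - x^-1 <= x ^+ 2 * ln x.
    by rewrite ler_pM2l ?exprn_gt0// lerNl -lnV ?posrE// ltW.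
  rewrite mulrN expr2 -[x * x * x^-1]mulrA divff ?gt_eqF// mulr1 -mulr_natl; lra.
move: sD sc; rewrite !ler_norml => /andP[_ sD] /andP[sc _].
by apply/andP; split; lra.
Unshelve. all: by end_near. Qed.

End log_limit.

(** * Compactness of sublevel sets *)

Section sublevel.
Variable R : realType.
Local Notation P := (R * R)%type.
Implicit Types (p : P).

Lemma sublevel_compact (O : set P) (psi : P -> R) (y : R) : bounded_set2 O ->
  {within closure O, continuous psi} -> compact [set p | closure O p /\ psi p <= y].
Proof.
move=> [M OM] /subspace_continuousP cpsi.
apply: (subclosed_compact _ (closure_compact OM)); last by move=> p [].
move=> q Kq; have cq : closure O q.
  rewrite (closure_id (closure O)).1; last exact: closed_closure.
  by apply: closureS Kq => p [].
split=> //; rewrite leNgt; apply/negP => yq.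
have : \forall p \near q, closure O p -> y < psi p.
  by have := cpsi q cq _ (open_nbhs_nbhs (conj (@open_gt R y) yq)).
by move=> /Kq[p [[cp py] H]]; have := H cp; rewrite ltNge py.
Qed.

End sublevel.

(** * Assembly of the two bounds for the Dirichlet ground state energy *)

Theorem theorem1p3 (R : realType) (O : set (R * R)) (B psi0 A1 A2 : R * R -> R) :
  smooth_domain O ->
  Cinf_bar O B ->
  (forall p, closure O p -> 0 < B p) ->
  (* psi0 : classical solution of  Delta psi0 = B in O, psi0 = 0 on dO *)
  Ck_in 2 O psi0 ->
  {within closure O, continuous psi0} ->
  (forall p, O p -> pdw [:: true; true] psi0 p + pdw [:: false; false] psi0 p = B p) ->
  (forall p, (closure O `\` O) p -> psi0 p = 0) ->
  (* A = (A1, A2) in C^1(closure O; R^2) with curl A = B *)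
  Ck_bar 1 O A1 -> Ck_bar 1 O A2 ->
  (forall p, O p -> pd true A2 p - pd false A1 p = B p) ->
  (fun h => h * ln (lambdaD h A1 A2 B O)) @ 0^'+ -->
    2 * inf [set psi0 p | p in O].
Proof.
move=> [oO On0 _ Obd _] BC Bpos psiC cpsi lap psi_bd A1C A2C curlA.
have CB : CC 0 O B by apply: CC_of_Ck; have [] := BC 0.
have C1 : CC 1 O A1 by apply: CC_of_Ck; have [] := A1C.
have C2 : CC 1 O A2 by apply: CC_of_Ck; have [] := A2C.
have Cpsi : CC 2 O psi0 by exact: CC_of_Ck.
have B0 p : O p -> 0 < B p by move=> /subset_closure; exact: Bpos.
have psi_le0 := max_principle oO On0 Obd Cpsi cpsi.
have {}psi_le0 p : O p -> psi0 p <= 0.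
  by apply: psi_le0 => // q Oq; have := B0 q Oq; rewrite -(lap q Oq).
have psi_inf := lbounded_image On0 Obd cpsi.
set m := inf _.
have m_le p : O p -> m <= psi0 p by move=> Op; apply: (ge_inf psi_inf.2); exists p.
have [M M0 OM] : exists2 M : R, 0 < M & O `<=` sq M.
  have [M HM] := Obd; exists (`|M| + 1); first by rewrite ltr_wpDl.
  have M1 : M <= `|M| + 1 by rewrite ler_wpDr// ler_norm.
  by move=> p /HM[h1 h2]; split; apply: le_trans M1.
have [K1 K10 A1K] := Ck_bar_bounded Obd A1C.
have [K2 K20 A2K] := Ck_bar_bounded Obd A2C.
have [K3 K30 BK] := Ck_bar_bounded Obd (BC 0).
(* The summand 1 gives C >= 1, so that a bound of [B] by [C] is also one by C^2, the form required
   for the square root of [B]. *)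
pose C := K1 + K2 + K3 + 1.
have C0 : 0 < C by rewrite !addr_gt0.
have A1C' p : O p -> `|A1 p| <= C by move=> /A1K; rewrite /C; lra.
have A2C' p : O p -> `|A2 p| <= C by move=> /A2K; rewrite /C; lra.
have BC' p : O p -> B p <= C ^+ 2.
  move=> /BK BK3; apply: (@le_trans _ _ C).
    by apply: le_trans (ler_norm _) (le_trans BK3 _); rewrite /C; lra.
  by rewrite expr2 ler_peMl ?ltW// /C; lra.
have lower h a a1 a2 b b1 b2 (h0 : 0 < h) (hC : h <= C) :=
  @lower_H10 R O M oO OM M0 h m C A1 A2 B psi0 h0 C1 C2 CB Cpsi curlA lap psi_le0 m_le B0
    A1C' A2C' BC' hC a a1 a2 b b1 b2.
have trial e : 0 < e -> exists2 D : R, 0 < D & forall h, 0 < h ->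
  exists a a1 a2 b b1 b2 : R * R -> R,
    [/\ H10 O a a1 a2, H10 O b b1 b2,
        fine (\int[@leb2 R]_(p in O) ((a p ^+ 2 + b p ^+ 2)%:E))%E != 0 &
        pauli_rayleigh O h A1 A2 B a a1 a2 b b1 b2 <= D * h ^+ 2 * expR ((2 * m + e) / h)].
  (* Two losses of d, one for a point where [psi0] is only close to its infimum and one for the
     level where the cutoff begins, enter the exponent doubled: 2 (m + d + d) = 2 m + e. *)
  move=> e0; pose d := e / 4; have d0 : 0 < d by rewrite divr_gt0.
  have [_ [p0 Op0 <-] p0m] := inf_adherent d0 psi_inf; rewrite -/m in p0m.
  have : \forall p \near p0, O p /\ psi0 p < m + d.
    apply: filterI; first exact: open_nbhs_nbhs.
    exact: (CC_cont Cpsi Op0) (open_nbhs_nbhs (conj (@open_lt R (m + d)) p0m)).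
  move=> /nbhs_box[r r0 rU].
  pose Q := [set p : R * R | `|p.1 - p0.1| <= r / 2 /\ `|p.2 - p0.2| <= r / 2].
  have r2 : r / 2 < r by rewrite ltr_pdivrMr// ltr_pMr// ltr1n.
  have QU p : Q p -> O p /\ psi0 p < m + d.
    by move=> [q1 q2]; apply: rU; split; exact: le_lt_trans r2.
  (* The sublevel set avoids the boundary because [psi0] vanishes there, hence is compact inside
     [O]. The square [Q] is added because its points need not lie below the level - d when e is
     large. *)
  pose K := [set p | closure O p /\ psi0 p <= - d] `|` Q.
  have cK : compact K by apply: compactU; [exact: sublevel_compact|exact: cbox_compact].
  have KO : K `<=` O.
    move=> p [[cp pd]|/QU[]//]; apply: contrapT => nO.
    by move: pd; rewrite psi_bd// oppr_ge0 leNgt d0.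
  have [p Op nK| |p [p1 p2]|p [p1 p2]|D D0 HD] := @upper_test R O K M A1 A2 B psi0 (m + d) d (r / 2) p0 oO OM M0
    C1 C2 CB Cpsi curlA lap cK KO.
  - rewrite leNgt; apply/negP => /ltW pd; apply: nK; left; split=> //.
    exact: subset_closure.
  - by rewrite divr_gt0.
  - by right; split; exact: ltW.
  - by apply: ltW; have [] := QU p; [split; exact: ltW|].
  exists D => // h h0.
  have -> : 2 * m + e = 2 * (m + d + d) by rewrite /d; field.
  exact: HD.
(* Without an admissible state the infimum defining [lambdaD] would be a default value; the trial
   state for e = 1 provides one. *)
have ne h : 0 < h -> [set r | exists a a1 a2 b b1 b2 : R * R -> R,
      [/\ H10 O a a1 a2, H10 O b b1 b2,
          fine (\int[@leb2 R]_(p in O) ((a p ^+ 2 + b p ^+ 2)%:E))%E != 0 &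
          r = pauli_rayleigh O h A1 A2 B a a1 a2 b b1 b2]] !=set0.
  move=> h0; have [D _ HD] := trial 1 ltr01.
  have [a [a1 [a2 [b [b1 [b2 [Ha Hb nz _]]]]]]] := HD h h0.
  by exists (pauli_rayleigh O h A1 A2 B a a1 a2 b b1 b2), a, a1, a2, b, b1, b2.
apply: (@log_limit _ _ _ (4 * M ^+ 2)^-1 C) => //.
- by rewrite invr_gt0 mulr_gt0// exprn_gt0.
- move=> h /andP[h0 hC]; apply: lb_le_inf; first exact: ne.
  move=> _ [a [a1 [a2 [b [b1 [b2 [Ha Hb nz ->]]]]]]].
  by rewrite (mulrC _ (h ^+ 2)); exact: lower.
- move=> e /trial[D D0 HD]; exists D => // h /andP[h0 hC].
  have [a [a1 [a2 [b [b1 [b2 [Ha Hb nz le]]]]]]] := HD h h0.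
  apply: le_trans le; apply: ge_inf; last by exists a, a1, a2, b, b1, b2.
  (* The infimum is below each Rayleigh quotient only if the set is bounded below, which the lower
     estimate supplies. *)
  exists (h ^+ 2 / (4 * M ^+ 2) * expR (2 * m / h)).
  by move=> _ [a' [a1' [a2' [b' [b1' [b2' [Ha' Hb' nz' ->]]]]]]]; exact: lower.
Qed.
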